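(* Let $q\in\mathcal S(\mathbb R;\mathbb R)$. The following are equivalent. (1) $q=\beta(\varphi)$ for a unique $\varphi\in\operatorname{Diff}_{\mathcal S}(\mathbb R)$. (2) $q=w'-w^2$ for a unique $w\in\mathcal S_0(\mathbb R;\mathbb R)$. (3) $H_q$ has no negative eigenvalues and $R_q(0)=0$. (4) $H_q$ has no negative eigenvalues and $T_q(0)=1$. When these conditions hold, the zero-energy right Jost solution satisfies $f_+(\cdot,0)>0$ and $f_+(x,0)\to 1$ as $x\to\pm\infty$, and the diffeomorphism $\varphi$ in (1) satisfies $\varphi'(x)=f_+(x,0)^{-2}$ for all $x\in\mathbb R$.
   Context: $\mathcal S(\mathbb R;\mathbb R)$ is the space of real-valued Schwartz functions on $\mathbb R$, and $\mathcal S_0(\mathbb R;\mathbb R)=\{w\in\mathcal S(\mathbb R;\mathbb R): \int_{\mathbb R}w\,dx=0\}$. $\operatorname{Diff}_{\mathcal S}(\mathbb R)$ is the set of orientation-preserving diffeomorphisms $\varphi$ of $\mathbb R$ with $\varphi'-1\in\mathcal S(\mathbb R;\mathbb R)$ and $\varphi(x)-x\to 0$ as $x\to-\infty$. The real Bers map is $\beta(\varphi)=\tfrac12 S(\varphi)$, where $S(\varphi)=\frac{\varphi'''}{\varphi'}-\frac32\left(\frac{\varphi''}{\varphi'}\right)^2$ is the Schwarzian derivative. For $q\in\mathcal S(\mathbb R;\mathbb R)$, $H_q=-\partial_x^2-q$ is the Schr\''odinger operator (note the sign of $q$), self-adjoint on $L^2(\mathbb R)$. For $\operatorname{Im}k\ge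 0$ the Jost solutions $f_\pm(\cdot,k)$ are the solutions of $-y''-qy=k^2y$ fixed by $f_+(x,k)=e^{ikx}(1+o(1))$ as $x\to+\infty$ and $f_-(x,k)=e^{-ikx}(1+o(1))$ as $x\to-\infty$ (at $k=0$, $f_\pm(x,0)\to 1$ as $x\to\pm\infty$). For real $k\ne 0$ the coefficients $a_q(k),b_q(k)$ are defined by $f_-(x,k)=a_q(k)f_+(x,-k)+b_q(k)f_+(x,k)$, and $T_q(k)=1/a_q(k)$, $R_q(k)=b_q(k)/a_q(k)$ are the transmission coefficient and the (right) reflection coefficient. Values at $k=0$ are understood as limits as $k\to 0$ along the real axis. *)

(* Defs.v *)
(* Real line: MathComp-Analysis over an arbitrary [R : realType]; complex
   numbers: [R[i]] from mathcomp-real-closed. *)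
From HB Require Import structures.
From mathcomp Require Import all_boot all_order all_algebra.
From mathcomp Require Import complex.
From mathcomp Require Import all_classical all_reals all_analysis.

Set Implicit Arguments.
Unset Strict Implicit.
Unset Printing Implicit Defensive.

Import Order.TTheory GRing.Theory Num.Theory.
Import numFieldNormedType.Exports.

Local Open Scope classical_set_scope.
Local Open Scope ring_scope.
Local Open Scope complex_scope.

Section RealLine.
Variable R : realType.
Implicit Types f w q phi : R -> R.

Definition smooth f : Prop :=
  forall (n : nat) (x : R), derivable (derive1n n f) x 1.

Definition schwartz f : Prop :=
  smooth f /\
  forall m n : nat, exists C : R, forall x : R, `|x| ^+ m * `|derive1n n f x| <= C.

Definition schwartz0 w : Prop :=
  schwartz w /\ \int[lebesgue_measure]_x w x = 0.

Definition diffeo phi : Prop :=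
  exists psi : R -> R,
    [/\ cancel phi psi, cancel psi phi, smooth phi & smooth psi].

Definition diff_schwartz phi : Prop :=
  [/\ diffeo phi,
      forall x : R, 0 < derive1 phi x,
      schwartz (fun x => derive1 phi x - 1) &
      phi x - x @[x --> -oo] --> (0 : R)].

Definition schwarzian phi (x : R) : R :=
  derive1n 3 phi x / derive1 phi x
  - 3 / 2 * (derive1n 2 phi x / derive1 phi x) ^+ 2.

Definition bers phi (x : R) : R := 2^-1 * schwarzian phi x.

End RealLine.

Section ComplexValued.
Variable R : realType.
Implicit Types (u v g h y : R -> R[i]) (q : R -> R).

(* [R[i]] carries no normed-module structure over [R] in the library, so
   derivatives and integrals of functions [R -> R[i]] are taken componentwise. *)
Definition cderivable y (x : R) : Prop :=
  derivable (@complex.Re R \o y) x 1 /\ derivable (@complex.Im R \o y) x 1.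

Definition cderive y (x : R) : R[i] :=
  derive1 (@complex.Re R \o y) x +i* derive1 (@complex.Im R \o y) x.

Definition cintegral (D : set R) y : R[i] :=
  (\int[lebesgue_measure]_(x in D) complex.Re (y x)) +i*
  (\int[lebesgue_measure]_(x in D) complex.Im (y x)).

Definition cexp (z : R[i]) : R[i] :=
  (expR (complex.Re z))%:C * (cos (complex.Im z) +i* sin (complex.Im z)).

Definition L2 u : Prop :=
  @complex.Re R \o u \in Lfun (@lebesgue_measure R) 2%:E /\
  @complex.Im R \o u \in Lfun (@lebesgue_measure R) 2%:E.

(* [u] is the C^1 representative of an element of the Sobolev space H^2(R)
   whose weak second derivative is [g]: [u'] is absolutely continuous with
   a.e. derivative [g], and [u], [u'], [g] are in L^2. *)
Definition sobolev2 u g : Prop :=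
  [/\ L2 u, L2 (cderive u), L2 g,
      forall x : R, cderivable u x &
      forall a b : R, a <= b -> cderive u b - cderive u a = cintegral `[a, b] g].

(* The graph of [H_q = - d^2/dx^2 - q] on L^2(R), with domain H^2(R);
   equality in L^2 is equality almost everywhere. *)
Definition schrodinger q u h : Prop :=
  exists2 g : R -> R[i], sobolev2 u g &
    {ae lebesgue_measure, forall x, h x = - g x - (q x)%:C * u x}.

Definition eigenvalue q (lambda : R) : Prop :=
  exists2 u : R -> R[i],
    ~ {ae lebesgue_measure, forall x, u x = 0} &
    schrodinger q u (fun x => lambda%:C * u x).

Definition no_negative_eigenvalue q : Prop :=
  forall lambda : R, lambda < 0 -> ~ eigenvalue q lambda.

Definition schrodinger_solution q (k : R[i]) y : Prop :=
  [/\ forall x : R, cderivable y x,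
      forall x : R, cderivable (cderive y) x &
      forall x : R,
        - cderive (cderive y) x - (q x)%:C * y x = k ^+ 2 * y x].

(* [(R[i])^o] is [R[i]] with the topology of its modulus. *)
Definition is_jost_right q (k : R[i]) y : Prop :=
  schrodinger_solution q k y /\
  (y x / cexp ('i * k * x%:C) : (R[i])^o) @[x --> +oo] --> (1 : (R[i])^o).

Definition is_jost_left q (k : R[i]) y : Prop :=
  schrodinger_solution q k y /\
  (y x / cexp (- ('i * k * x%:C)) : (R[i])^o) @[x --> -oo] --> (1 : (R[i])^o).

(* [f_+(., k)] and [f_-(., k)], by definite description; they exist and are
   unique for [q] Schwartz and [Im k >= 0]. *)
Definition jost_right q (k : R[i]) : R -> R[i] :=
  xget (fun=> 0) [set y | is_jost_right q k y].

Definition jost_left q (k : R[i]) : R -> R[i] :=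
  xget (fun=> 0) [set y | is_jost_left q k y].

(* The pair [(a_q(k), b_q(k))], by definite description; meaningful for [k != 0]. *)
Definition scattering q (k : R) : R[i] * R[i] :=
  xget (0, 0) [set ab | forall x : R,
    jost_left q k%:C x =
      ab.1 * jost_right q (- k%:C) x + ab.2 * jost_right q k%:C x].

Definition transmission q (k : R) : R[i] := (scattering q k).1^-1.

Definition reflection q (k : R) : R[i] :=
  (scattering q k).2 / (scattering q k).1.

(* The value at zero energy is [c], as the limit along nonzero real [k]. *)
Definition value_at_zero (F : R -> R[i]) (c : R[i]) : Prop :=
  (F k : (R[i])^o) @[k --> (0 : R)^'] --> (c : (R[i])^o).

End ComplexValued.

(* Main.v *)
Require Import Defs.
From HB Require Import structures.
From mathcomp Require Import all_boot all_order all_algebra.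
From mathcomp Require Import complex ring lra.
From mathcomp Require Import all_classical all_reals all_analysis measurable_realfun.

Set Implicit Arguments.
Unset Strict Implicit.
Unset Printing Implicit Defensive.

Import Order.TTheory GRing.Theory Num.Theory.
Import numFieldNormedType.Exports.

Local Open Scope classical_set_scope.
Local Open Scope ring_scope.
Local Open Scope complex_scope.

(** Everything is reduced to the existence of a zero-energy ground state, a positive
    solution [y] of [- y'' = q y] tending to 1 at both ends ([ground_state]). It is
    unique, and [y - 1] is a Schwartz function ([ground_state_schwartz]).

    The first two conditions are changes of unknown. If [q = beta (phi)], then
    [y = phi' ^ (- 1 / 2)] is a ground state, and conversely [phi' = y ^- 2] defines a
    diffeomorphism ([diff_schwartz_ground], [ground_diff]); this also gives the formula for
    [phi']. If [q = w' - w ^ 2], then [y] is the exponential of minus a primitive of [w],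
    and conversely [w = - y' / y]; the limits of [y] at both ends agree exactly when [w] has
    integral 0 ([riccati_ground], [ground_riccati]). The uniqueness of [phi] and [w] is that
    of [y].

    For the scattering data, let [y, u] be the real solutions of energy [k ^ 2] which are
    asymptotic to [cos (k x)] and [sin (k x) / k] at [+oo], and [Y, U] those at [-oo]. Then
    [f_+ = y + i k u], [f_- = Y - i k U], and the matrix with [Y = al y + ga u],
    [U = be y + de u] has determinant 1 and entries which differ from their values at
    [k = 0] by [O(k ^ 2)] ([transfer]). The coefficients are
    [a = (al + de) / 2 + i (ga / k - k be) / 2] and
    [b = (al - de) / 2 - i (ga / k + k be) / 2] ([scatteringE]).
    So [R (0) = 0] holds if and only if [ga (0) = 0] and [al (0) = 1] or [-1], and
    [T (0) = 1] if and only if [ga (0) = 0] and [al (0) = 1]: the zero-energy solutions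
    [Y] and [y], which tend to 1 at [-oo] and at [+oo], are then proportional, with factor
    [al (0)]. If moreover [y > 0], then the factor is 1 and [y] is a ground state.

    Positivity is what the spectral condition provides. A ground state factorizes the
    operator and so excludes negative eigenvalues ([ground_state_L2]). Conversely, the
    negative energies at which some solution is positive have a largest element if no
    zero-energy solution is positive, and a positive solution at this energy decays at
    both ends, so it is an eigenfunction ([positive_zero_energy]). If some zero-energy
    solution is positive, then [y] has no zero, by comparison of the two
    ([principal_solution_no_zero]). *)

(** [is_derive] is a type class, solved by instance search wherever a lemma is
    applied; as a plain proposition it stays an ordinary premise. *)
Definition drv (R : realType) (f : R -> R) (x d : R) : Prop := is_derive x 1 f d.

(** * Derivatives and differential inequalities *)

Section Calculus.
Variable R : realType.
Implicit Types (f g F G E H h : R -> R) (a b c x y d e : R).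

Lemma drv_eq f x d e : drv f x d -> d = e -> drv f x e.
Proof. by move=> H <-. Qed.

Lemma drv_ext f g x d : f =1 g -> drv f x d -> drv g x d.
Proof. by move=> /funext ->. Qed.

Lemma drv_cst a x : drv (fun=> a) x 0.
Proof. exact: is_derive_cst. Qed.

Lemma drv_id x : drv (fun t : R => t) x 1.
Proof. exact: is_derive_id. Qed.

Lemma drvD f g x d e : drv f x d -> drv g x e -> drv (fun t => f t + g t) x (d + e).
Proof. exact: is_deriveD. Qed.

Lemma drvN f x d : drv f x d -> drv (fun t => - f t) x (- d).
Proof. exact: is_deriveN. Qed.

Lemma drvB f g x d e : drv f x d -> drv g x e -> drv (fun t => f t - g t) x (d - e).
Proof. exact: is_deriveB. Qed.

Lemma drvM f g x d e : drv f x d -> drv g x e ->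
  drv (fun t => f t * g t) x (f x * e + g x * d).
Proof. exact: is_deriveM. Qed.

Lemma drvX f n x d : drv f x d -> drv (fun t => f t ^+ n) x (n%:R * f x ^+ n.-1 * d).
Proof.
move=> fd; elim: n => [|n IH].
  by rewrite mulr0n !mul0r; under eq_fun do rewrite expr0; exact: drv_cst.
under eq_fun do rewrite exprS.
apply: drv_eq (drvM fd IH) _; case: n {IH} => [|n]; first by rewrite !expr0; ring.
by rewrite /= !exprS -[in RHS]natr1; ring.
Qed.

Lemma drvV f x d : f x != 0 -> drv f x d -> drv (fun t => (f t)^-1) x (- d / f x ^+ 2).
Proof.
move=> fx /(is_deriveV fx) H; apply: drv_eq H _.
by rewrite /GRing.scale /= !mulNr mulrC.
Qed.

Lemma drv_comp f g x d e : drv f (g x) d -> drv g x e -> drv (fun t => f (g t)) x (d * e).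
Proof. exact: is_derive1_comp. Qed.

Lemma drv_expR f x d : drv f x d -> drv (fun t => expR (f t)) x (expR (f x) * d).
Proof. by move=> fd; apply: (drv_comp _ fd); exact: is_derive_expR. Qed.

Lemma drv_ln f x d : 0 < f x -> drv f x d -> drv (fun t => ln (f t)) x (d / f x).
Proof.
move=> fx fd; rewrite mulrC; apply: (drv_comp _ fd); exact: is_derive1_ln.
Qed.

Lemma drv_cos f x d : drv f x d -> drv (fun t => cos (f t)) x (- sin (f x) * d).
Proof. by move=> fd; apply: (drv_comp _ fd); exact: is_derive_cos. Qed.

Lemma drv_sin f x d : drv f x d -> drv (fun t => sin (f t)) x (cos (f x) * d).
Proof. by move=> fd; apply: (drv_comp _ fd); exact: is_derive_sin. Qed.

Lemma drv_atan f x d : drv f x d -> drv (fun t => atan (f t)) x (d / (1 + f x ^+ 2)).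
Proof. by move=> fd; rewrite mulrC; apply: (drv_comp _ fd); exact: is_derive1_atan. Qed.

Lemma drv_continuous f x d : drv f x d -> {for x, continuous f}.
Proof. by move=> [fd _]; apply/differentiable_continuous/derivable1_diffP. Qed.

Lemma drv_derive1 f x d : drv f x d -> derive1 f x = d.
Proof. by move=> [_ <-]; rewrite derive1E. Qed.

Lemma derivable_drv f x : derivable f x 1 -> drv f x (derive1 f x).
Proof. by move=> fx; rewrite derive1E; exact: derivableP. Qed.

End Calculus.

Ltac drv_step :=
  match goal with
  | |- drv (fun _ => ?c) _ _ => eapply (@drv_cst _ c)
  | |- drv (fun t => @?f t + - @?g t) _ _ => eapply (@drvB _ f g)
  | |- drv (fun t => @?f t + @?g t) _ _ => eapply (@drvD _ f g)
  | |- drv (fun t => - @?f t) _ _ => eapply (@drvN _ f)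
  | |- drv (fun t => @?f t * @?g t) _ _ => eapply (@drvM _ f g)
  | |- drv (fun t => @?f t ^+ ?n) _ _ => eapply (@drvX _ f n)
  | |- drv (fun t => (@?f t)^-1) _ _ => eapply (@drvV _ f)
  | |- drv (fun t => expR (@?f t)) _ _ => eapply (@drv_expR _ f)
  | |- drv (fun t => ln (@?f t)) _ _ => eapply (@drv_ln _ f)
  | |- drv (fun t => cos (@?f t)) _ _ => eapply (@drv_cos _ f)
  | |- drv (fun t => sin (@?f t)) _ _ => eapply (@drv_sin _ f)
  | |- drv (fun t => atan (@?f t)) _ _ => eapply (@drv_atan _ f)
  | |- drv (fun t => t) _ _ => eapply drv_id
  | H : forall t, drv ?f t _ |- drv ?f _ _ => eapply H
  | H : drv ?f _ _ |- drv ?f _ _ => eapply H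
  end.
(* Differentiates the body by the rules above; leaves the equation between the
   derivatives and the side conditions. *)
Ltac drv := eapply drv_eq; [repeat drv_step|].

Section Comparison.
Variable R : realType.
Implicit Types (f g F G E H h : R -> R) (a b c x y d e : R).

Lemma drv_ge0_le f df a b : a <= b -> (forall x, drv f x (df x)) ->
  (forall x, a <= x <= b -> 0 <= df x) -> f a <= f b.
Proof.
move=> ab fd df0.
have fc : {within `[a, b], continuous f}.
  by apply: continuous_subspaceT => x; exact: drv_continuous (fd x).
have [c] := MVT_segment ab (fun x _ => fd x) fc.
rewrite in_itv/= => cab fE; rewrite -subr_ge0 fE mulr_ge0 ?subr_ge0//.
exact: df0.
Qed.

Lemma drv_le0_ge f df a b : a <= b -> (forall x, drv f x (df x)) ->
  (forall x, a <= x <= b -> df x <= 0) -> f b <= f a.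
Proof.
move=> ab fd df0; rewrite -lerN2.
apply: (@drv_ge0_le (fun t => - f t) (fun t => - df t) _ _ ab) => [x|x /df0].
  by drv.
by rewrite oppr_ge0.
Qed.

Lemma drv_eq_cst f df a b : (forall x, drv f x (df x)) ->
  (forall x, df x = 0) -> f a = f b.
Proof.
move=> fd df0; have fd0 x : is_derive x 1 f 0 by have := fd x; rewrite df0.
exact: is_derive_0_is_cst fd0.
Qed.

(** A domination of derivatives integrates in both directions from a common zero at
    the origin. *)
Lemma drv_norm_le f g df dg a b x : a <= 0 <= b -> a <= x <= b ->
  (forall x, drv f x (df x)) -> (forall x, drv g x (dg x)) ->
  f 0 = 0 -> g 0 = 0 ->
  (forall x, a <= x <= b -> `|df x| <= dg x) -> `|f x| <= `|g x|.
Proof.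
move=> /andP[a0 b0] /andP[ax xb] fd gd f0 g0 fg.
have [x0|/ltW x0] := leP 0 x.
  have h y : 0 <= y <= x -> `|df y| <= dg y.
    by move=> /andP[y0 yx]; apply: fg; rewrite (le_trans a0 y0) (le_trans yx xb).
  have := @drv_ge0_le (fun t => g t - f t) (fun t => dg t - df t) 0 x x0.
  have := @drv_ge0_le (fun t => g t + f t) (fun t => dg t + df t) 0 x x0.
  rewrite f0 g0 addr0 subr0 => h1 h2.
  have {}h1 : 0 <= g x + f x.
    apply: h1 => y; first by drv.
    by move=> /h; rewrite ler_norml => /andP[? _]; lra.
  have {}h2 : 0 <= g x - f x.
    apply: h2 => y; first by drv.
    by move=> /h; rewrite ler_norml => /andP[? ?]; lra.
  by rewrite (@ger0_norm _ (g x)) ?ler_norml; lra.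
have h y : x <= y <= 0 -> `|df y| <= dg y.
  by move=> /andP[y0 yx]; apply: fg; rewrite (le_trans ax y0) (le_trans yx b0).
have := @drv_ge0_le (fun t => g t - f t) (fun t => dg t - df t) x 0 x0.
have := @drv_ge0_le (fun t => g t + f t) (fun t => dg t + df t) x 0 x0.
rewrite f0 g0 addr0 subr0 => h1 h2.
have {}h1 : g x + f x <= 0.
  apply: h1 => y; first by drv.
  by move=> /h; rewrite ler_norml => /andP[? _]; lra.
have {}h2 : g x - f x <= 0.
  apply: h2 => y; first by drv.
  by move=> /h; rewrite ler_norml => /andP[? ?]; lra.
by rewrite (@ler0_norm _ (g x)) ?ler_norml; lra.
Qed.

(** With [H] a primitive of the rate [h], [E exp (- H)] is nonincreasing to the right
    of [c] and [E exp H] is nondecreasing to its left. *)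
Lemma gronwall E dE H h a b c x : (forall x, drv E x (dE x)) ->
  (forall x, drv H x (h x)) -> 0 <= E c -> a <= c <= b -> a <= x <= b ->
  (forall x, a <= x <= b -> `|dE x| <= h x * E x) ->
  E x <= E c * expR `|H x - H c|.
Proof.
move=> Ed Hd E0 /andP[ac cb] /andP[ax xb] hE.
have [cx|/ltW xc] := leP c x.
  have := @drv_le0_ge (fun t => E t * expR (- H t))
    (fun t => expR (- H t) * (dE t - h t * E t)) c x cx.
  have e1 : expR (- H c) = expR (H x - H c) * expR (- H x).
    by rewrite -expRD; congr expR; ring.
  rewrite e1 mulrA ler_pM2r ?expR_gt0// => /(_ _ _)/le_trans; apply.
  - by move=> t; drv; ring.
  - move=> t /andP[ct tx]; apply: mulr_ge0_le0; first exact: expR_ge0.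
    have := hE t; rewrite (le_trans ac ct) (le_trans tx xb) => /(_ isT).
    by rewrite ler_norml => /andP[_]; lra.
  by rewrite ler_wpM2l// ler_expR ler_norm.
have := @drv_ge0_le (fun t => E t * expR (H t))
  (fun t => expR (H t) * (dE t + h t * E t)) x c xc.
have e1 : expR (H c) = expR (H c - H x) * expR (H x).
  by rewrite -expRD; congr expR; ring.
rewrite e1 mulrA ler_pM2r ?expR_gt0// => /(_ _ _)/le_trans; apply.
- by move=> t; drv; ring.
- move=> t /andP[ct tx]; apply: mulr_ge0; first exact: expR_ge0.
  have := hE t; rewrite (le_trans ax ct) (le_trans tx cb) => /(_ isT).
  by rewrite ler_norml => /andP[]; lra.
by rewrite ler_wpM2l// ler_expR distrC ler_norm.
Qed.

End Comparison.

(** * Primitives of continuous functions *)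

Section Primitive.
Variable R : realType.
Implicit Types (f F : R -> R) (a b x y : R).

Lemma drv_near f g x d : (\forall t \near x, f t = g t) -> drv f x d -> drv g x d.
Proof. exact: near_eq_is_derive. Qed.

Lemma near_norm_lt x a : `|x| < a -> \forall t \near x, `|t| < a.
Proof.
exact: (@cvgr_norm_lt R R^o R (nbhs x) _ id x cvg_id).
Qed.

(** Integrals from [-N] are glued over all [N]: two of them, normalized to vanish
    at 0, have the same derivative where both are defined. *)
Lemma primitive f : continuous f ->
  exists F, F 0 = 0 /\ forall x, drv F x (f x).
Proof.
move=> fc.
pose I N x := (\int[lebesgue_measure]_(t in `[- N, x]) f t)%R.
have Id N x : - N < x -> drv (I N) x (f x).
  move=> Nx; have xx1 : x < x + 1 by rewrite ltrDl.
  have fi : lebesgue_measure.-integrable `[- N, x + 1] (EFin \o f).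
    apply: continuous_compact_integrable; first exact: segment_compact.
    exact: continuous_subspaceT.
  have [dI <-] := continuous_FTC1_closed xx1 fi Nx (fc x).
  exact: derivable_drv.
pose J N x := I N x - I N 0.
have JE N M t : - N < Num.min t 0 -> - M < Num.min t 0 -> J N t = J M t.
  rewrite !lt_min => /andP[Nt N0] /andP[Mt M0]; apply/eqP.
  rewrite -subr_eq0; apply/eqP.
  pose D s := I N s - I M s.
  suff : D t = D 0 by rewrite /D /J; lra.
  have Dd s : Num.min t 0 <= s -> drv D s 0.
    rewrite ge_min => ts; rewrite /D; drv; last exact: subrr (f s).
    - by apply: Id; case/orP: ts; exact: lt_le_trans.
    - by apply: Id; case/orP: ts; exact: lt_le_trans.
  have Dc a b : Num.min t 0 <= a -> {within `[a, b], continuous D}.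
    move=> ta; apply: derivable_within_continuous => s; rewrite in_itv/= => /andP[s1 _].
    by have [] := Dd s (le_trans ta s1).
  have [t0|/ltW t0] := leP t 0.
  - have Dd' s : s \in `]t, 0[ -> is_derive s 1 D ((fun=> 0) s).
      by rewrite in_itv/= => /andP[/ltW s1 _]; apply: Dd; rewrite ge_min s1.
    have [|c _] := MVT_segment t0 Dd'; first by apply: Dc; rewrite ge_min lexx.
    by rewrite mul0r; lra.
  - have Dd' s : s \in `]0, t[ -> is_derive s 1 D ((fun=> 0) s).
      by rewrite in_itv/= => /andP[/ltW s1 _]; apply: Dd; rewrite ge_min s1 orbT.
    have [|c _] := MVT_segment t0 Dd'; first by apply: Dc; rewrite ge_min lexx orbT.
    by rewrite mul0r; lra.
exists (fun x => J (`|x| + 1) x); split=> [|x]; first by rewrite /J subrr.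
have Jx : drv (J (`|x| + 1)) x (f x).
  rewrite /J; drv; last exact: subr0.
  by apply: Id; have := ler_norm (- x); rewrite normrN; lra.
apply: drv_near Jx.
have : \forall t \near x, `|t| < `|x| + 1 by apply: near_norm_lt; rewrite ltrDl.
apply: filterS => t tx; have nt := ler_norm (- t); rewrite normrN in nt.
have nx := normr_ge0 x; have nt0 := normr_ge0 t.
by apply: JE; rewrite lt_min; lra.
Qed.

Definition prim f := xget (fun=> 0) [set F | F 0 = 0 /\ forall x, drv F x (f x)].

Lemma primP f : continuous f -> prim f 0 = 0 /\ forall x, drv (prim f) x (f x).
Proof.
move=> /primitive[F FP]; rewrite /prim.
by case: xgetP => [G _ //|/(_ F)[]].
Qed.

Lemma continuous_drv f df : (forall x, drv f x (df x)) -> continuous f.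
Proof. by move=> fd x; exact: drv_continuous (fd x). Qed.

Lemma prim_continuous f : continuous f -> continuous (prim f).
Proof. by move=> /primP[_]; exact: continuous_drv. Qed.

Lemma geometric_small (r C : R) : (forall n, `|r| <= C * 2^-1 ^+ n) -> r = 0.
Proof.
move=> rC; apply/eqP; rewrite -normr_eq0 eq_le normr_ge0 andbT leNgt.
apply/negP => r0.
have C0 : 0 <= C by have := rC 0; rewrite expr0 mulr1; apply: le_trans.
have := @archi_boundP R (C / `|r|) (divr_ge0 C0 (ltW r0)).
set n := Num.bound _; rewrite ltr_pdivrMr// ltNge => /negP; apply.
have := rC n; rewrite -(@ler_pM2r _ (2 ^+ n)) ?exprn_gt0// -mulrA -exprMn.
rewrite mulVf// expr1n mulr1 => /(le_trans _); apply.
rewrite mulrC ler_pM2l// -natrX ler_nat; exact: ltnW (ltn_expl _ _).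
Qed.

(** The sequences [u n - 2 K / 2 ^ n] and [u n + 2 K / 2 ^ n] are monotone and adjacent,
    so the supremum of the first one is a limit, with the stated rate. *)
Lemma geometric_cauchy (u : nat -> R) (K : R) :
  (forall n, `|u n.+1 - u n| <= K * 2^-1 ^+ n) ->
  exists l, forall n, `|l - u n| <= 2 * K * 2^-1 ^+ n.
Proof.
move=> uK; have uK' n : u n - K * 2^-1 ^+ n <= u n.+1 <= u n + K * 2^-1 ^+ n.
  by have := uK n; rewrite ler_norml; lra.
have K0 n : 0 <= K * 2^-1 ^+ n by apply: le_trans (uK n).
pose w n := u n - 2 * K * 2^-1 ^+ n; pose v n := u n + 2 * K * 2^-1 ^+ n.
have wS n m : w n <= w (n + m)%N.
  elim: m => [|m IH]; first by rewrite addn0.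
  apply: le_trans IH _; rewrite /w addnS exprS.
  by have := uK' (n + m)%N; lra.
have vS n m : v (n + m)%N <= v n.
  elim: m => [|m IH]; first by rewrite addn0.
  apply: le_trans IH; rewrite /v addnS exprS.
  by have := uK' (n + m)%N; lra.
have wv n m : w n <= v m.
  apply: le_trans (wS n m) _; rewrite addnC; apply: le_trans (vS m n).
  by rewrite /w /v; have := K0 (m + n)%N; lra.
have sw : has_sup (range w) by split; [exists (w 0), 0|exists (v 0) => _ [n _ <-]].
exists (sup (range w)) => n; rewrite ler_norml.
have : w n <= sup (range w) by apply: sup_upper_bound => //; exists n.
have : sup (range w) <= v n by apply: ge_sup => [|_ [m _ <-]]; [exists (w 0), 0|].
by rewrite /w /v; lra.
Qed.

End Primitive.

(** * The initial value problem *)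

Section InitialValue.
Variable R : realType.
Implicit Types (p f y z : R -> R) (a b x X : R).

Definition solves p y z := forall x, drv y x (z x) /\ drv z x (- p x * y x).

Lemma bounded_on f X : continuous f -> exists2 M, 0 < M & forall x, `|x| <= X -> `|f x| <= M.
Proof.
move=> fc; have [X0|X0] := leP 0 X; last first.
  by exists 1 => // x /le_lt_trans/(_ X0); rewrite ltNge normr_ge0.
have XX : - X <= X by lra.
have fc' : {within `[- X, X], continuous (fun x => `|f x|)}.
  apply: continuous_subspaceT => x; apply: continuous_comp; first exact: fc.
  exact: (@norm_continuous _ R^o).
have [c _ cP] := EVT_max XX fc'.
exists (`|f c| + 1); first by rewrite ltr_wpDl.
move=> x; rewrite ler_norml => xX; apply: le_trans (cP x _) _; first by rewrite in_itv.
by rewrite lerDl.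
Qed.

Section Picard.
Variables (p : R -> R) (a b : R).
Hypothesis pc : continuous p.

Fixpoint picard n : (R -> R) * (R -> R) :=
  if n is m.+1 then
    (fun x => a + prim (picard m).2 x,
     fun x => b + prim (fun t => - p t * (picard m).1 t) x)
  else (fun=> a, fun=> b).

Let Y n := (picard n).1.
Let Z n := (picard n).2.

Lemma pc_mul f : continuous f -> continuous (fun t => - p t * f t).
Proof.
move=> fc x; apply: continuousM (fc x).
by apply: continuousN; exact: pc.
Qed.

Lemma picard_continuous n : continuous (Y n) /\ continuous (Z n).
Proof.
elim: n => [|n [Yn Zn]]; first by split; exact: cst_continuous.
split=> x; apply: (@cvgD _ R^o); [exact: cvg_cst| |exact: cvg_cst|].
  exact: prim_continuous Zn x.
exact: prim_continuous (pc_mul Yn) x.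
Qed.

Lemma picard_drv n x : drv (Y n.+1) x (Z n x) /\ drv (Z n.+1) x (- p x * Y n x).
Proof.
have [Yc Zc] := picard_continuous n.
have [_ Zd] := primP Zc; have [_ Yd] := primP (pc_mul Yc).
by split; rewrite /Y /Z /=; drv; exact: add0r.
Qed.

Lemma picard0 n : Y n 0 = a /\ Z n 0 = b.
Proof.
case: n => // n; have [Yc Zc] := picard_continuous n.
have [Z0 _] := primP Zc; have [Y0 _] := primP (pc_mul Yc).
by rewrite /Y /Z /= Z0 Y0 !addr0.
Qed.

(** Weighting the sup norm by [cosh (2 Q x)], with [Q >= 1] a bound of the
    coefficient, makes the Picard map a contraction of ratio 1/2 on the whole
    interval. *)
Lemma picard_contraction X : exists K, forall n x, `|x| <= X ->
  `|Y n.+1 x - Y n x| <= K * 2^-1 ^+ n /\ `|Z n.+1 x - Z n x| <= K * 2^-1 ^+ n.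
Proof.
have [P P0 PP] := bounded_on X pc.
pose Q := P + 1; pose L := 2 * Q.
pose om x := expR (L * x) + expR (- (L * x)).
pose si x := expR (L * x) - expR (- (L * x)).
have om1 x : 1 <= om x.
  have := expR_ge1Dx (L * x); have := expR_ge1Dx (- (L * x)).
  by rewrite /om; lra.
have siom x : `|si x| <= om x.
  have := expR_ge0 (L * x); have := expR_ge0 (- (L * x)).
  by rewrite /si /om ler_norml => ? ?; lra.
have [K1 K10 K1P] : exists2 M, 0 < M & forall x, `|x| <= X -> `|Y 1 x - Y 0 x| <= M.
  apply: bounded_on => x; apply: continuousB; [exact: (picard_continuous 1).1|].
  exact: (picard_continuous 0).1.
have [K2 K20 K2P] : exists2 M, 0 < M & forall x, `|x| <= X -> `|Z 1 x - Z 0 x| <= M.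
  apply: bounded_on => x; apply: continuousB; [exact: (picard_continuous 1).2|].
  exact: (picard_continuous 0).2.
pose K := K1 + K2.
have step n x : `|x| <= X -> `|Y n.+1 x - Y n x| <= K * 2^-1 ^+ n * om x /\
    `|Z n.+1 x - Z n x| <= K * 2^-1 ^+ n * om x.
  elim: n x => [|n IH] x xX.
    have h : K <= K * 2^-1 ^+ 0 * om x.
      by rewrite expr0 mulr1 ler_peMr// /K addr_ge0// ltW.
    split; apply: le_trans h; rewrite /K.
      by apply: le_trans (K1P _ xX) _; rewrite lerDl ltW.
    by apply: le_trans (K2P _ xX) _; rewrite lerDr ltW.
  set k := K * 2^-1 ^+ n in IH *.
  have k0 : 0 <= k by rewrite mulr_ge0// ?exprn_ge0// /K addr_ge0// ltW.
  have -> : K * 2^-1 ^+ n.+1 = k / 2 by rewrite exprS /k; ring.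
  have X0 : - X <= 0 <= X by have := normr_ge0 x; lra.
  have xX' : - X <= x <= X by rewrite -ler_norml.
  have gd t : drv (fun t => k / 2 * si t) t (k * Q * om t).
    by rewrite /si /om /L; drv; field.
  have g0 : k / 2 * si 0 = 0 by rewrite /si !mulr0 oppr0 subrr mulr0.
  have E (f df : R -> R) : (forall t, drv f t (df t)) -> f 0 = 0 ->
      (forall t, `|t| <= X -> `|df t| <= k * Q * om t) -> `|f x| <= k / 2 * om x.
    move=> fd f0 fb; have := drv_norm_le X0 xX' fd gd f0 g0.
    move=> /(_ _)/le_trans -> //; first by move=> t; rewrite -ler_norml => /fb.
    rewrite normrM ger0_norm ?divr_ge0//.
    by apply: ler_wpM2l; rewrite ?divr_ge0.
  have Q1 : 1 <= Q by rewrite /Q lerDr ltW.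
  have kom t : 0 <= k * om t by rewrite mulr_ge0// (le_trans _ (om1 t)).
  split.
  - apply: (E (fun t => Y n.+2 t - Y n.+1 t) (fun t => Z n.+1 t - Z n t)).
    + by move=> t; have [? _] := picard_drv n.+1 t; have [? _] := picard_drv n t; drv.
    + by rewrite (picard0 n.+2).1 (picard0 n.+1).1 subrr.
    + move=> t tX; apply: le_trans (IH t tX).2 _.
      by rewrite (mulrAC k) ler_peMr.
  - apply: (E (fun t => Z n.+2 t - Z n.+1 t)
      (fun t => - p t * Y n.+1 t - (- p t * Y n t))).
    + by move=> t; have [_ ?] := picard_drv n.+1 t; have [_ ?] := picard_drv n t; drv.
    + by rewrite (picard0 n.+2).2 (picard0 n.+1).2 subrr.
    + move=> t tX; rewrite -mulrBr normrM normrN (mulrAC k) (mulrC _ Q).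
      apply: ler_pM => //; last exact: (IH t tX).1.
      by apply: le_trans (PP t tX) _; rewrite /Q lerDl.
exists (K * (2 * expR (L * X))) => n x xX; have [h1 h2] := step n x xX.
have L0 : 0 <= L by rewrite /L /Q mulr_ge0// addr_ge0// ltW.
have omX : om x <= 2 * expR (L * X).
  have : expR (L * x) <= expR (L * X).
    by rewrite ler_expR ler_wpM2l// (le_trans (ler_norm _) xX).
  have : expR (- (L * x)) <= expR (L * X).
    by rewrite ler_expR -mulrN ler_wpM2l// (le_trans (ler_norm _))// normrN.
  by rewrite /om; lra.
have h : K * 2^-1 ^+ n * om x <= K * (2 * expR (L * X)) * 2^-1 ^+ n.
  by rewrite [leRHS]mulrAC ler_wpM2l// mulr_ge0 ?exprn_ge0// /K addr_ge0// ltW.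
by split; [apply: le_trans h1 h|apply: le_trans h2 h].
Qed.

(** By [picard_contraction] the iterates converge geometrically, uniformly on bounded
    intervals; hence the limit is continuous and satisfies the integral equations. *)
Lemma ivp_exists : exists y z, [/\ solves p y z, y 0 = a & z 0 = b].
Proof.
have bnd X := picard_contraction X.
have /choice[yz yzP] : forall x, exists l : R * R, exists K, forall n,
    `|l.1 - Y n x| <= K * 2^-1 ^+ n /\ `|l.2 - Z n x| <= K * 2^-1 ^+ n.
  move=> x; have [K KP] := bnd `|x|.
  have [l1 l1P] := geometric_cauchy (fun n => (KP n x (lexx _)).1).
  have [l2 l2P] := geometric_cauchy (fun n => (KP n x (lexx _)).2).
  by exists (l1, l2), (2 * K).
pose y x := (yz x).1; pose z x := (yz x).2.
have unif X : exists2 K, 0 <= K & forall n x, `|x| <= X ->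
    `|y x - Y n x| <= K * 2^-1 ^+ n /\ `|z x - Z n x| <= K * 2^-1 ^+ n.
  have [K KP] := bnd X; exists `|2 * K| => // n x xX.
  have h (u : nat -> R) l : (forall n, `|u n.+1 - u n| <= K * 2^-1 ^+ n) ->
      (exists C, forall n, `|l - u n| <= C * 2^-1 ^+ n) ->
      forall n, `|l - u n| <= `|2 * K| * 2^-1 ^+ n.
    move=> uK [C lC] m; have [l' l'P] := geometric_cauchy uK.
    suff -> : l = l'.
      by apply: le_trans (l'P m) _; rewrite ler_wpM2r ?exprn_ge0// ler_norm.
    apply/eqP; rewrite -subr_eq0; apply/eqP.
    apply: (@geometric_small _ _ (C + 2 * K)) => i.
    rewrite mulrDl; have -> : l - l' = (l - u i) - (l' - u i) by ring.
    by apply: le_trans (ler_normB _ _) _; rewrite lerD.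
  have [C CP] := yzP x; split.
    by apply: (h (fun n => Y n x)) => [m|]; [exact: (KP m x xX).1|exists C => m; exact: (CP m).1].
  by apply: (h (fun n => Z n x)) => [m|]; [exact: (KP m x xX).2|exists C => m; exact: (CP m).2].
have lim_cont (f : R -> R) (F : nat -> R -> R) : (forall n, continuous (F n)) ->
    (forall X, exists2 K, 0 <= K & forall n x, `|x| <= X -> `|f x - F n x| <= K * 2^-1 ^+ n) ->
    continuous f.
  move=> Fc fF x; have [K K0 KP] := fF (`|x| + 1).
  apply/cvgrPdist_le => e e0.
  have [n nP] : exists n, K * 2^-1 ^+ n <= e / 3.
    apply: contrapT => /forallNP H.
    have /eqP : e / 3 = 0.
      apply: (@geometric_small _ _ K) => n.
      by rewrite gtr0_norm ?divr_gt0// ltW// ltNge; apply/negP.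
    by rewrite gt_eqF// divr_gt0.
  have xx1 : `|x| < `|x| + 1 by rewrite ltrDl.
  have xn := near_norm_lt xx1.
  have e30 : 0 < e / 3 by rewrite divr_gt0.
  have /cvgrPdist_le/(_ _ e30) Fn := Fc n x.
  near=> t.
  have h1 := le_trans (KP n x (ltW xx1)) nP.
  have h2 : `|f t - F n t| <= e / 3.
    by apply: le_trans (KP n t _) nP; apply: ltW; near: t.
  have h3 : `|F n x - F n t| <= e / 3 by near: t.
  have -> : f x - f t = (f x - F n x) + (F n x - F n t) - (f t - F n t) by ring.
  apply: le_trans (ler_normB _ _) _.
  by have := ler_normD (f x - F n x) (F n x - F n t); lra.
have yc : continuous y.
  apply: (lim_cont _ Y) => [n|X]; first exact: (picard_continuous n).1.
  by have [K K0 KP] := unif X; exists K => // n x xX; exact: (KP n x xX).1.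
have zc : continuous z.
  apply: (lim_cont _ Z) => [n|X]; first exact: (picard_continuous n).2.
  by have [K K0 KP] := unif X; exists K => // n x xX; exact: (KP n x xX).2.
have eqn (f g : R -> R) c (F G : nat -> R -> R) : continuous g ->
    (forall n x, drv (F n.+1) x (G n x)) -> (forall n, F n 0 = c) ->
    (forall X, exists2 K, 0 <= K & forall n x, `|x| <= X -> `|f x - F n x| <= K * 2^-1 ^+ n) ->
    (forall X, exists2 K, 0 <= K & forall n x, `|x| <= X -> `|g x - G n x| <= K * 2^-1 ^+ n) ->
    forall x, f x = c + prim g x.
  move=> gc FG Fc fF gG x.
  have [K K0 KP] := fF `|x|; have [M M0 MP] := gG `|x|.
  have [g0 gd] := primP gc.
  apply/eqP; rewrite -subr_eq0; apply/eqP.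
  apply: (@geometric_small _ _ (K + M * `|x|)) => n.
  have X0 : - `|x| <= 0 <= `|x| by have := normr_ge0 x; lra.
  have xX : - `|x| <= x <= `|x| by rewrite -ler_norml.
  have h := @drv_norm_le _ (fun t => c + prim g t - F n.+1 t)
    (fun t => M * 2^-1 ^+ n * t) (fun t => g t - G n t) (fun=> M * 2^-1 ^+ n) _ _ x X0 xX.
  have {}h : `|c + prim g x - F n.+1 x| <= `|M * 2^-1 ^+ n * x|.
    apply: h.
    - by move=> t; have := FG n t => ?; drv; ring.
    - by move=> t; drv; ring.
    - by rewrite g0 Fc addr0 subrr.
    - by rewrite mulr0.
    - by move=> t; rewrite -ler_norml => /MP; apply.
  rewrite normrM (ger0_norm (mulr_ge0 M0 _)) ?exprn_ge0// in h.
  have h2 : `|f x - F n.+1 x| <= K * 2^-1 ^+ n.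
    apply: le_trans (KP n.+1 x (lexx _)) _; rewrite ler_wpM2l// exprS.
    by rewrite ler_piMl ?exprn_ge0// invf_le1// ler1n.
  have -> : f x - (c + prim g x) = (f x - F n.+1 x) - (c + prim g x - F n.+1 x) by ring.
  by apply: le_trans (ler_normB _ _) _; rewrite mulrDl mulrAC lerD// mulrAC.
have yE : forall x, y x = a + prim z x.
  apply: (eqn _ _ _ Y Z) => //.
  - by move=> n x; exact: (picard_drv n x).1.
  - by move=> n; exact: (picard0 n).1.
  - by move=> X; have [K K0 KP] := unif X; exists K => // n x xX; exact: (KP n x xX).1.
  - by move=> X; have [K K0 KP] := unif X; exists K => // n x xX; exact: (KP n x xX).2.
have zE : forall x, z x = b + prim (fun t => - p t * y t) x.
  apply: (eqn _ _ _ Z (fun n t => - p t * Y n t)) => //.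
  - exact: pc_mul.
  - by move=> n x; exact: (picard_drv n x).2.
  - by move=> n; exact: (picard0 n).2.
  - by move=> X; have [K K0 KP] := unif X; exists K => // n x xX; exact: (KP n x xX).2.
  - move=> X; have [K K0 KP] := unif X; have [P P0 PP] := bounded_on X pc.
    exists (P * K); first by rewrite mulr_ge0// ltW.
    move=> n x xX; rewrite -mulrBr normrM normrN -mulrA.
    by rewrite ler_pM// ?PP//; exact: (KP n x xX).1.
have [z0 zd] := primP zc; have [y0 yd] := primP (pc_mul yc).
exists y, z; split; [|by rewrite yE z0 addr0|by rewrite zE y0 addr0].
move=> x; split.
  apply: (@drv_ext _ (fun x => a + prim z x)) => [t|]; first by rewrite -yE.
  by drv; exact: add0r.
apply: (@drv_ext _ (fun x => b + prim (fun t => - p t * y t) x)) => [t|].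
  by rewrite -zE.
by drv; exact: add0r.
Unshelve. all: by end_near. Qed.

End Picard.
End InitialValue.

(** * Wronskians and bases of solutions *)

Section LinearTheory.
Variable R : realType.
Implicit Types (p f g y z u v : R -> R) (a b x : R).

Lemma solves_lin p y z u v a b : solves p y z -> solves p u v ->
  solves p (fun t => a * y t + b * u t) (fun t => a * z t + b * v t).
Proof.
move=> yz uv x; have [yd zd] := yz x; have [ud vd] := uv x.
by split; drv; ring.
Qed.

Lemma wronskian_cst p y z u v x t : solves p y z -> solves p u v ->
  y x * v x - z x * u x = y t * v t - z t * u t.
Proof.
move=> yz uv.
apply: (@drv_eq_cst _ (fun x => y x * v x - z x * u x) (fun=> 0)) => // r.
have [yd zd] := yz r; have [ud vd] := uv r.
by drv; ring.
Qed.

Lemma solves_basis p y z u v f g : solves p y z -> solves p u v -> solves p f g ->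
  (forall x, y x * v x - z x * u x = 1) ->
  exists a b, forall x, f x = a * y x + b * u x /\ g x = a * z x + b * v x.
Proof.
move=> yz uv fg W.
exists (f 0 * v 0 - g 0 * u 0), (- (f 0 * z 0 - g 0 * y 0)) => x.
rewrite -(wronskian_cst x 0 fg uv) -(wronskian_cst x 0 fg yz).
by split; [rewrite -[LHS]mulr1|rewrite -[LHS]mulr1]; rewrite -(W x); ring.
Qed.

Definition ivp p a b : (R -> R) * (R -> R) :=
  xget (fun=> 0, fun=> 0) [set yz | [/\ solves p yz.1 yz.2, yz.1 0 = a & yz.2 0 = b]].

Lemma ivpP p a b : continuous p ->
  [/\ solves p (ivp p a b).1 (ivp p a b).2, (ivp p a b).1 0 = a & (ivp p a b).2 0 = b].
Proof.
move=> pc; rewrite /ivp; have [y [z yz]] := ivp_exists a b pc.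
by case: xgetP => [yz' _ //|/(_ (y, z))[]].
Qed.

Lemma ivp_wronskian p x : continuous p ->
  (ivp p 1 0).1 x * (ivp p 0 1).2 x - (ivp p 1 0).2 x * (ivp p 0 1).1 x = 1.
Proof.
move=> pc; have [yz y0 z0] := ivpP 1 0 pc; have [uv u0 v0] := ivpP 0 1 pc.
by rewrite (wronskian_cst x 0 yz uv) y0 z0 u0 v0; ring.
Qed.

Lemma ivp_basis p f g : continuous p -> solves p f g ->
  forall x, f x = f 0 * (ivp p 1 0).1 x + g 0 * (ivp p 0 1).1 x /\
            g x = f 0 * (ivp p 1 0).2 x + g 0 * (ivp p 0 1).2 x.
Proof.
move=> pc fg; have [yz y0 z0] := ivpP 1 0 pc; have [uv u0 v0] := ivpP 0 1 pc.
have [a [b ab]] := solves_basis yz uv fg (fun x => ivp_wronskian x pc).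
have [-> ->] := ab 0; rewrite y0 u0 z0 v0 !mulr0 !mulr1 addr0 add0r.
exact: ab.
Qed.

Lemma solves_eq0 p y z x : continuous p -> solves p y z -> y x = 0 -> z x = 0 ->
  forall t, y t = 0 /\ z t = 0.
Proof.
move=> pc yz yx zx t.
have [cc _ _] := ivpP 1 0 pc; have [ss _ _] := ivpP 0 1 pc.
have W := ivp_wronskian t pc.
have := wronskian_cst x t yz cc; have := wronskian_cst x t yz ss.
rewrite yx zx !mul0r subrr => /esym h1 /esym h2.
split; rewrite -[LHS]mulr1 -W.
  transitivity ((y t * (ivp p 0 1).2 t - z t * (ivp p 0 1).1 t) * (ivp p 1 0).1 t -
    (y t * (ivp p 1 0).2 t - z t * (ivp p 1 0).1 t) * (ivp p 0 1).1 t); first ring.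
  by rewrite h1 h2; ring.
transitivity ((y t * (ivp p 0 1).2 t - z t * (ivp p 0 1).1 t) * (ivp p 1 0).2 t -
  (y t * (ivp p 1 0).2 t - z t * (ivp p 1 0).1 t) * (ivp p 0 1).2 t); first ring.
by rewrite h1 h2; ring.
Qed.

(** A solution touching zero from above has a double zero there. *)
Lemma solves_ge0_gt0 p y z x0 : continuous p -> solves p y z ->
  (forall x, 0 <= y x) -> y x0 != 0 -> forall x, 0 < y x.
Proof.
move=> pc yz y0 yx0 x; rewrite lt0r y0 andbT; apply/eqP => yx.
have xx : x - 1 <= x + 1 by lra.
have xi : x \in `]x - 1, x + 1[ by rewrite in_itv/=; lra.
have yd t : t \in `]x - 1, x + 1[ -> derivable y t 1 by move=> _; case: (yz t) => -[].
have [|_ yx'] := derive1_at_min xx yd xi; first by move=> t _; rewrite yx.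
have [[_ zx] _] := yz x; rewrite yx' in zx.
have [y00 _] := solves_eq0 pc yz yx (esym zx) x0.
by rewrite y00 eqxx in yx0.
Qed.

Lemma pos_ivt f a b : continuous f -> 0 < f a -> f b <= 0 -> exists c, f c = 0.
Proof.
move=> fc fa fb; have [ab|/ltW ba] := leP a b.
  have [||c _ <-] := @IVT _ f a b 0 ab; last by exists c.
    exact: continuous_subspaceT.
  by rewrite ge_min le_max fb (ltW fa) orbT.
have [||c _ <-] := @IVT _ f b a 0 ba; last by exists c.
  exact: continuous_subspaceT.
by rewrite ge_min le_max fb (ltW fa) orbT.
Qed.

End LinearTheory.

(** * Decay at infinity *)

Section Decay.
Variable R : realType.
Implicit Types (f g F : R -> R) (K l x a b : R).

Lemma jap_gt0 x : 0 < 1 + x ^+ 2.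
Proof. by rewrite ltr_pwDl// sqr_ge0. Qed.

Lemma jap_ge1 x : 1 <= 1 + x ^+ 2.
Proof. by rewrite lerDl sqr_ge0. Qed.

Lemma norm_le_jap x : `|x| <= 1 + x ^+ 2.
Proof.
by rewrite -real_normK ?num_real//; have := sqr_ge0 (`|x| - 1); nra.
Qed.

Lemma cvg_pinfty_jap f l K : (forall x, 1 <= x -> `|f x - l| * (1 + x ^+ 2) <= K) ->
  f x @[x --> +oo] --> l.
Proof.
move=> fl; apply/cvgrPdist_le => e e0; near=> x.
have x1 : 1 <= x by near: x; apply: nbhs_pinfty_ge; rewrite num_real.
have xK : K / e <= x by near: x; apply: nbhs_pinfty_ge; rewrite num_real.
rewrite distrC -(ler_pM2r (jap_gt0 x)); apply: le_trans (fl _ x1) _.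
rewrite ler_pdivrMr// mulrC in xK; apply: le_trans xK _; rewrite ler_pM2l//.
by apply: le_trans (norm_le_jap x); exact: ler_norm.
Unshelve. all: by end_near. Qed.

(** For [1 <= x] the derivative of [K (1 + x ^ 2) ^- (n + 1)] dominates [df], so [f]
    plus or minus this function is monotone, and the limit [l] lies in between. *)
Lemma decay f df n K : (forall x, drv f x (df x)) ->
  (forall x, 1 <= x -> `|df x| * (1 + x ^+ 2) ^+ n.+2 <= K) ->
  exists l, forall x, 1 <= x -> `|f x - l| * (1 + x ^+ 2) ^+ n.+1 <= K.
Proof.
move=> fd fK; pose W x : R := (1 + x ^+ 2)^-1.
have W0 x : 0 < W x by rewrite invr_gt0 jap_gt0.
have K0 : 0 <= K by apply: le_trans (fK 1 (lexx _)); rewrite mulr_ge0// exprn_ge0// ltW// jap_gt0.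
have Wd x : drv (fun x => K * W x ^+ n.+1) x (- (K * (n.+1%:R * (2 * x)) * W x ^+ n.+2)).
  have j0 : 1 + x ^+ 2 != 0 by rewrite gt_eqF// jap_gt0.
  rewrite /W; drv => //.
  by rewrite /= !exprS; field.
have dW x : 1 <= x -> `|df x| <= K * (n.+1%:R * (2 * x)) * W x ^+ n.+2.
  move=> x1; rewrite /W exprVn ler_pdivlMr ?exprn_gt0 ?jap_gt0//.
  apply: le_trans (fK x x1) _; rewrite ler_peMr//.
  have : 1 <= n.+1%:R :> R by rewrite ler1n.
  by move=> n1; nra.
pose g x := f x - K * W x ^+ n.+1; pose G x := f x + K * W x ^+ n.+1.
have g_nd a b : 1 <= a -> a <= b -> g a <= g b.
  move=> a1 ab; apply: (drv_ge0_le ab (fun x => drvB (fd x) (Wd x))) => x.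
  move=> /andP[/(le_trans a1)/dW + _]; rewrite ler_norml => /andP[? _]; lra.
have G_ni a b : 1 <= a -> a <= b -> G b <= G a.
  move=> a1 ab; apply: (drv_le0_ge ab (fun x => drvD (fd x) (Wd x))) => x.
  move=> /andP[/(le_trans a1)/dW + _]; rewrite ler_norml => /andP[_ ?]; lra.
have gG x : g x <= G x by have := mulr_ge0 K0 (exprn_ge0 n.+1 (ltW (W0 x))); rewrite /g /G; lra.
have gG' a b : 1 <= a -> 1 <= b -> g a <= G b.
  move=> a1 b1; have [ab|/ltW ba] := leP a b.
    exact: le_trans (g_nd _ _ a1 ab) (gG b).
  exact: le_trans (gG a) (G_ni _ _ b1 ba).
pose S := [set g x | x in [set x | 1 <= x]].
have S0 : S !=set0 by exists (g 1), 1 => //=.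
have sS : has_sup S by split=> //; exists (G 1) => _ [x x1 <-]; exact: gG'.
exists (sup S) => x x1.
have h1 : g x <= sup S by apply: sup_upper_bound => //; exists x.
have h2 : sup S <= G x by apply: ge_sup => // _ [y y1 <-]; exact: gG'.
rewrite -ler_pdivlMr ?exprn_gt0 ?jap_gt0// -exprVn -/(W x).
by move: h1 h2; rewrite /g /G ler_norml; lra.
Qed.

Lemma drv_refl f x d : drv f (- x) d -> drv (fun t => f (- t)) x (- d).
Proof.
move=> fd; have Nd : drv (fun t : R => - t) x (- 1) by drv.
by have := drv_comp fd Nd; rewrite mulrN1.
Qed.

Lemma decayN f df n K : (forall x, drv f x (df x)) ->
  (forall x, x <= -1 -> `|df x| * (1 + x ^+ 2) ^+ n.+2 <= K) ->
  exists l, forall x, x <= -1 -> `|f x - l| * (1 + x ^+ 2) ^+ n.+1 <= K.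
Proof.
move=> fd fK.
have [||l lP] := @decay (fun x => f (- x)) (fun x => - df (- x)) n K.
- by move=> x; exact: drv_refl.
- by move=> x x1; rewrite normrN -sqrrN; apply: fK; lra.
by exists l => x x1; have := lP (- x); rewrite opprK sqrrN; apply; lra.
Qed.

Lemma cvg_ninfty_jap f l K : (forall x, x <= -1 -> `|f x - l| * (1 + x ^+ 2) <= K) ->
  f x @[x --> -oo] --> l.
Proof.
move=> fl; apply/cvgNy_compNP; apply: (@cvg_pinfty_jap _ _ K) => x x1.
by rewrite /= -sqrrN; apply: fl; lra.
Qed.

End Decay.

(** * Variation of constants *)

Section Amplitudes.
Variable R : realType.
Implicit Types (q y z u v : R -> R) (k a b x : R).

(** The free solution with value 0 and slope 1 at the origin; unlike [sin (k x)] it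
    stays independent of [cos (k x)] in the limit [k = 0]. *)
Definition ksin k x : R := if k == 0 then x else sin (k * x) / k.
Definition kcos k x : R := cos (k * x).

Lemma ksinE k x : k * ksin k x = sin (k * x).
Proof.
rewrite /ksin; case: eqP => [->|/eqP k0]; first by rewrite !mul0r sin0.
by rewrite mulrC divfK.
Qed.

Lemma kcos_drv k x : drv (kcos k) x (- (k ^+ 2 * ksin k x)).
Proof. by rewrite expr2 -mulrA ksinE /kcos; drv; ring. Qed.

Lemma ksin_drv k x : drv (ksin k) x (kcos k x).
Proof.
have [k0|k0] := eqVneq k 0.
  rewrite /kcos k0 mul0r cos0; apply: drv_ext (drv_id x) => t.
  by rewrite /ksin eqxx.
apply: (@drv_ext _ (fun x => sin (k * x) / k)) => [t|]; first by rewrite /ksin (negbTE k0).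
by rewrite /kcos; drv; field.
Qed.

Lemma kcos2Dksin2 k x : kcos k x ^+ 2 + k ^+ 2 * ksin k x ^+ 2 = 1.
Proof. by rewrite -exprMn ksinE cos2Dsin2. Qed.

Lemma kcos_le1 k x : `|kcos k x| <= 1.
Proof. by rewrite ler_norml cos_geN1 cos_le1. Qed.

Lemma kcos0 k : kcos k 0 = 1. Proof. by rewrite /kcos mulr0 cos0. Qed.

Lemma ksin0 k : ksin k 0 = 0.
Proof. by rewrite /ksin mulr0 sin0 mul0r if_same. Qed.

Lemma ball_norm x : - `|x| <= 0 <= `|x| /\ - `|x| <= x <= `|x|.
Proof. by split; [have := normr_ge0 x; lra|rewrite -ler_norml]. Qed.

Lemma ksin_le k x : `|ksin k x| <= `|x|.
Proof.
have [x0 xx] := ball_norm x.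
apply: (@drv_norm_le _ _ id (kcos k) (fun=> 1) _ _ x x0 xx) => //.
- exact: ksin_drv.
- exact: drv_id.
- exact: ksin0.
- by move=> t _; exact: kcos_le1.
Qed.

Lemma kcos_sub1 k x : `|kcos k x - 1| <= k ^+ 2 * x ^+ 2.
Proof.
have [x0 xx] := ball_norm x.
have := @drv_norm_le _ (fun x => kcos k x - 1) (fun t => k ^+ 2 * `|x| * t)
  (fun x => - (k ^+ 2 * ksin k x)) (fun=> k ^+ 2 * `|x|) _ _ x x0 xx.
move=> /(_ _ _ _ _ _)/le_trans; apply.
- by move=> t; have Cd := kcos_drv k; drv; exact: subr0.
- by move=> t; drv; ring.
- by rewrite kcos0 subrr.
- by rewrite mulr0.
- move=> t tx; rewrite normrN normrM ger0_norm ?sqr_ge0// ler_wpM2l ?sqr_ge0//.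
  by apply: le_trans (ksin_le _ _) _; rewrite ler_norml.
rewrite -mulrA normrM ger0_norm ?sqr_ge0// normrM normr_id -expr2.
by rewrite real_normK ?num_real.
Qed.

Lemma ksin_subx k x : `|ksin k x - x| <= k ^+ 2 * x ^+ 2 * `|x|.
Proof.
have [x0 xx] := ball_norm x.
have := @drv_norm_le _ (fun x => ksin k x - x) (fun t => k ^+ 2 * x ^+ 2 * t)
  (fun x => kcos k x - 1) (fun=> k ^+ 2 * x ^+ 2) _ _ x x0 xx.
move=> /(_ _ _ _ _ _)/le_trans; apply.
- by move=> t; have Sd := ksin_drv k; drv; ring.
- by move=> t; drv; ring.
- by rewrite ksin0 subrr.
- by rewrite mulr0.
- move=> t tx; apply: le_trans (kcos_sub1 _ _) _; rewrite ler_wpM2l ?sqr_ge0//.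
  rewrite -real_normK ?num_real// -[leRHS]real_normK ?num_real//.
  by rewrite lerXn2r ?nnegrE// ler_norml.
by rewrite normrM ger0_norm// mulr_ge0 ?sqr_ge0.
Qed.

(** The amplitudes of [y = A cos (k x) + B sin (k x) / k],
    [y' = - k A sin (k x) + B cos (k x)]: variation of the constants of the free
    equation. *)
Definition ampc k y z x : R := y x * kcos k x - z x * ksin k x.
Definition amps k y z x : R := k ^+ 2 * y x * ksin k x + z x * kcos k x.

Lemma ampK k y z x : y x = ampc k y z x * kcos k x + amps k y z x * ksin k x.
Proof.
rewrite -[LHS]mulr1 -(kcos2Dksin2 k x) /ampc /amps; ring.
Qed.

Lemma amp_wronskian k y z u v x :
  ampc k y z x * amps k u v x - amps k y z x * ampc k u v x = y x * v x - z x * u x.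
Proof.
rewrite -[RHS]mulr1 -(kcos2Dksin2 k x) /ampc /amps; ring.
Qed.

Variables (q : R -> R) (kap : R).
Hypothesis qc : continuous q.
Hypothesis q_decay : forall x, `|q x| * (1 + x ^+ 2) ^+ 4 <= kap.

Definition pot k x : R := q x + k ^+ 2.

Lemma pot_continuous k : continuous (pot k).
Proof. by move=> x; apply: (@cvgD _ R^o); [exact: qc|exact: cvg_cst]. Qed.

Lemma kap_ge0 : 0 <= kap.
Proof.
by apply: le_trans (q_decay 0); rewrite mulr_ge0// exprn_ge0// ltW// jap_gt0.
Qed.

Lemma q_decayW n x : (n <= 4)%N -> `|q x| * (1 + x ^+ 2) ^+ n <= kap.
Proof.
move=> n4; apply: le_trans (q_decay x); rewrite ler_wpM2l//.
by apply: ler_weXn2l => //; exact: jap_ge1.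
Qed.

Lemma ampc_drv k y z x : solves (pot k) y z ->
  drv (ampc k y z) x (q x * ksin k x * y x).
Proof.
move=> yz; have [yd zd] := yz x; have Cd := kcos_drv k x; have Sd := ksin_drv k x.
by rewrite /ampc; drv; rewrite /pot; ring.
Qed.

Lemma amps_drv k y z x : solves (pot k) y z ->
  drv (amps k y z) x (- (q x * kcos k x * y x)).
Proof.
move=> yz; have [yd zd] := yz x; have Cd := kcos_drv k x; have Sd := ksin_drv k x.
by rewrite /amps; drv; rewrite /pot; ring.
Qed.

(** A bounded primitive of [K / (1 + x ^ 2)], the rate of all Gronwall estimates over
    the whole line. *)
Definition hat K x : R := K * atan x.

Lemma hat_drv K x : drv (hat K) x (K / (1 + x ^+ 2)).
Proof. by rewrite /hat; drv; rewrite mulr0 addr0 mul1r. Qed.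

Lemma hat_le K x : 0 <= K -> `|hat K x - hat K 0| <= K * 2.
Proof.
move=> K0; rewrite /hat atan0 mulr0 subr0 normrM ger0_norm// ler_wpM2l//.
have := atan_ltpi2 x; have := atan_gtNpi2 x; have := pihalf_lt2 R.
rewrite ler_norml; lra.
Qed.

Lemma energy_ineq (X a b C S : R) : 0 <= X -> `|C| <= 1 -> `|S| <= X ->
  `|(a * S - b * C) * (a * C + b * S)| <= (a ^+ 2 + b ^+ 2) * (1 + X ^+ 2).
Proof.
move=> X0 C1 SX.
have h1 : `|a * S - b * C| <= `|a| * X + `|b|.
  apply: le_trans (ler_normB _ _) _; rewrite !normrM lerD ?ler_wpM2l//.
  by rewrite ler_piMr.
have h2 : `|a * C + b * S| <= `|a| + `|b| * X.
  apply: le_trans (ler_normD _ _) _; rewrite !normrM lerD ?ler_wpM2l//.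
  by rewrite ler_piMr.
rewrite normrM; apply: le_trans (ler_pM _ _ h1 h2) _ => //.
rewrite -(@real_normK _ a) ?num_real// -(@real_normK _ b) ?num_real//.
have := normr_ge0 a; have := normr_ge0 b.
move: `|a| `|b| => a' b' b0 a0.
have := mulr_ge0 a0 b0; have := sqr_ge0 (a' - b'); have := sqr_ge0 (X - 1).
nra.
Qed.

(** The amplitudes are constant for the free equation, and in general the squared
    amplitude has logarithmic derivative at most [2 |q| (1 + x ^ 2)], which is integrable;
    the bound is the same for all [k]. *)
Lemma amp_bounded k y z x : solves (pot k) y z ->
  ampc k y z x ^+ 2 + amps k y z x ^+ 2 <= (y 0 ^+ 2 + z 0 ^+ 2) * expR (4 * kap).
Proof.
move=> yz; pose A := ampc k y z; pose B := amps k y z.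
pose E x := A x ^+ 2 + B x ^+ 2.
have E0 : E 0 = y 0 ^+ 2 + z 0 ^+ 2.
  by rewrite /E /A /B /ampc /amps kcos0 ksin0; ring.
pose dE x := 2 * q x * ((A x * ksin k x - B x * kcos k x) * (A x * kcos k x + B x * ksin k x)).
have Ed t : drv E t (dE t).
  have Ad := ampc_drv t yz; have Bd := amps_drv t yz.
  by rewrite /E /A /B; drv; rewrite /dE /= (ampK k y z t) -/A -/B; ring.
have Ege0 t : 0 <= E t by rewrite addr_ge0 ?sqr_ge0.
rewrite -E0 -/(A x) -/(B x) -/(E x).
have [x0 xx] := ball_norm x.
have k20 : 0 <= 2 * kap by rewrite mulr_ge0// kap_ge0.
apply: le_trans (gronwall Ed (hat_drv (2 * kap)) (Ege0 0) x0 xx _) _.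
  move=> t _; rewrite /dE normrM normrM ger0_norm//.
  apply: le_trans (ler_wpM2l _ (energy_ineq (A t) (B t) (normr_ge0 t) (kcos_le1 k t) (ksin_le k t))) _.
    by rewrite mulr_ge0.
  rewrite real_normK ?num_real// -/(E t).
  rewrite (mulrC (E t)) mulrA ler_wpM2r// ler_pdivlMr ?jap_gt0//.
  by rewrite -!mulrA ler_wpM2l// -expr2; exact: q_decayW.
rewrite ler_wpM2l// ler_expR; apply: le_trans (hat_le _ _) _ => //.
by rewrite mulrAC -natrM.
Qed.

Lemma sqr_le_norm (a Q : R) : a ^+ 2 <= Q -> `|a| <= 1 + Q.
Proof.
rewrite -real_normK ?num_real//; have := normr_ge0 a; move: `|a| => {}a; nra.
Qed.

Lemma amp_bounded_norm k y z : solves (pot k) y z ->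
  exists2 M, 0 <= M & forall x,
    `|ampc k y z x| <= M /\ `|amps k y z x| <= M.
Proof.
move=> yz; exists (1 + (y 0 ^+ 2 + z 0 ^+ 2) * expR (4 * kap)).
  by rewrite addr_ge0// mulr_ge0 ?expR_ge0// addr_ge0 ?sqr_ge0.
move=> x; have := amp_bounded x yz.
have := sqr_ge0 (ampc k y z x); have := sqr_ge0 (amps k y z x).
by split; apply: sqr_le_norm; lra.
Qed.

Lemma sol_bounded k y z : solves (pot k) y z ->
  exists2 M, 0 <= M & forall x, `|y x| <= M * (1 + x ^+ 2).
Proof.
move=> yz; have [M M0 MP] := amp_bounded_norm yz; exists (M * 2).
  by rewrite mulr_ge0.
move=> x; have [a1 b1] := MP x; rewrite (ampK k y z x).
apply: le_trans (ler_normD _ _) _; rewrite !normrM.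
have h1 : `|ampc k y z x| * `|kcos k x| <= M * 1 by rewrite ler_pM// kcos_le1.
have h2 : `|amps k y z x| * `|ksin k x| <= M * (1 + x ^+ 2).
  by rewrite ler_pM// (le_trans (ksin_le _ _))// norm_le_jap.
apply: le_trans (lerD h1 h2) _; have := jap_ge1 x; nra.
Qed.

(** The free solution with amplitudes [a] and [b] is the asymptotic form of [y]. The
    rate of convergence matters: at [k = 0] the amplitude [b] is multiplied by [x]. *)
Definition asym_right k y z a b := exists K, forall x, 1 <= x ->
  `|ampc k y z x - a| * (1 + x ^+ 2) <= K /\ `|amps k y z x - b| * (1 + x ^+ 2) <= K.

Definition asym_left k y z a b := exists K, forall x, x <= -1 ->
  `|ampc k y z x - a| * (1 + x ^+ 2) <= K /\ `|amps k y z x - b| * (1 + x ^+ 2) <= K.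

Lemma asym_exists k y z : solves (pot k) y z ->
  (exists a b, asym_right k y z a b) /\ (exists a b, asym_left k y z a b).
Proof.
move=> yz; have [M M0 MP] := sol_bounded yz.
have hq x (F : R) : `|F| <= 1 + x ^+ 2 ->
    `|q x * F * y x| * (1 + x ^+ 2) ^+ 2 <= kap * M.
  move=> Fx; have j0 := ltW (jap_gt0 x).
  have h : `|F * y x| * (1 + x ^+ 2) ^+ 2 <= (1 + x ^+ 2) ^+ 4 * M.
    rewrite [leRHS](_ : _ = (1 + x ^+ 2) * (M * (1 + x ^+ 2)) * (1 + x ^+ 2) ^+ 2); last by ring.
    by rewrite ler_wpM2r ?exprn_ge0// normrM ler_pM.
  rewrite -(mulrA (q x)) normrM -(mulrA `|q x|).
  apply: le_trans (ler_wpM2l (normr_ge0 _) h) _.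
  by rewrite (mulrA `|q x|) ler_wpM2r.
have hA x : `|q x * ksin k x * y x| * (1 + x ^+ 2) ^+ 2 <= kap * M.
  by apply: hq; apply: le_trans (ksin_le _ _) (norm_le_jap x).
have hB x : `|- (q x * kcos k x * y x)| * (1 + x ^+ 2) ^+ 2 <= kap * M.
  by rewrite normrN; apply: hq; exact: le_trans (kcos_le1 _ _) (jap_ge1 x).
have Ad x := ampc_drv x yz; have Bd x := amps_drv x yz.
split.
  have [a aP] := decay Ad (fun x _ => hA x).
  have [b bP] := decay Bd (fun x _ => hB x).
  by exists a, b, (kap * M) => x x1; split; [exact: aP|exact: bP].
have [a aP] := decayN Ad (fun x _ => hA x).
have [b bP] := decayN Bd (fun x _ => hB x).
by exists a, b, (kap * M) => x x1; split; [exact: aP|exact: bP].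
Qed.

Lemma asym_right_cvg k y z a b : asym_right k y z a b ->
  ampc k y z x @[x --> +oo] --> a /\ amps k y z x @[x --> +oo] --> b.
Proof.
by move=> [K KP]; split; apply: (@cvg_pinfty_jap _ _ _ K) => x /KP[].
Qed.

Lemma asym_left_cvg k y z a b : asym_left k y z a b ->
  ampc k y z x @[x --> -oo] --> a /\ amps k y z x @[x --> -oo] --> b.
Proof.
by move=> [K KP]; split; apply: (@cvg_ninfty_jap _ _ _ K) => x /KP[].
Qed.

End Amplitudes.

(** * The amplitudes at low energy *)

Section LowEnergy.
Variable R : realType.
Implicit Types (q y z u v f g : R -> R) (k a b x : R).

Lemma cvg_norm_le (F : set_system R) f (l C : R) : ProperFilter F ->
  f x @[x --> F] --> l -> (forall x, `|f x| <= C) -> `|l| <= C.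
Proof.
move=> FF fl fC; rewrite leNgt; apply/negP => Cl.
have fC' : \forall x \near F, C < `|f x|.
  exact: (@cvgr_norm_gt R R^o _ _ _ _ _ fl).
have [x] := filter_ex fC'.
by rewrite ltNge fC.
Qed.

(** What remains near [k = 0] of a regular dependence on the energy [k ^ 2]. *)
Definition flat f := exists K, forall k, `|k| <= 1 -> `|f k - f 0| <= K * k ^+ 2.

Lemma flatB f g : flat f -> flat g -> flat (fun k => f k - g k).
Proof.
move=> [K KP] [M MP]; exists (K + M) => k k1.
have -> : f k - g k - (f 0 - g 0) = (f k - f 0) - (g k - g 0) by ring.
by apply: le_trans (ler_normB _ _) _; rewrite mulrDl lerD ?KP ?MP.
Qed.

Lemma flatM f g : flat f -> flat g -> flat (fun k => f k * g k).
Proof.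
move=> [K KP] [M MP]; exists ((`|f 0| + `|K|) * `|M| + `|g 0| * `|K|) => k k1.
have k2 : k ^+ 2 <= 1 by rewrite -real_normK ?num_real// expr_le1.
have fk : `|f k - f 0| <= `|K| * k ^+ 2.
  by apply: le_trans (KP k k1) _; rewrite ler_wpM2r ?sqr_ge0// ler_norm.
have gk : `|g k - g 0| <= `|M| * k ^+ 2.
  by apply: le_trans (MP k k1) _; rewrite ler_wpM2r ?sqr_ge0// ler_norm.
have fb : `|f k| <= `|f 0| + `|K|.
  rewrite -[f k](subrK (f 0)); apply: le_trans (ler_normD _ _) _.
  rewrite addrC lerD2l; apply: le_trans fk _.
  by rewrite ler_piMr.
have -> : f k * g k - f 0 * g 0 = f k * (g k - g 0) + g 0 * (f k - f 0) by ring.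
apply: le_trans (ler_normD _ _) _; rewrite !normrM [leRHS]mulrDl -!mulrA.
by rewrite lerD// ler_pM.
Qed.

Lemma ksin_0 x : ksin 0 x = x.
Proof. by rewrite /ksin eqxx. Qed.

Lemma kcos_0 x : kcos 0 x = 1.
Proof. by rewrite /kcos mul0r cos0. Qed.

Variables (q : R -> R) (kap : R).
Hypothesis q_decay : forall x, `|q x| * (1 + x ^+ 2) ^+ 4 <= kap.

Lemma remainder_le (a b M k x : R) : `|a| <= M -> `|b| <= M ->
  `|a * (ksin k x * kcos k x - x) + b * (ksin k x ^+ 2 - x ^+ 2)|
    <= 4 * M * (k ^+ 2 * (1 + x ^+ 2) ^+ 2) /\
  `|a * (kcos k x ^+ 2 - 1) + b * (ksin k x * kcos k x - x)|
    <= 4 * M * (k ^+ 2 * (1 + x ^+ 2) ^+ 2).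
Proof.
move=> aM bM; set w := 1 + x ^+ 2; set N := k ^+ 2 * w ^+ 2.
have k0 := sqr_ge0 k; have w1 : 1 <= w := jap_ge1 x; have xw : `|x| <= w := norm_le_jap x.
have x2w : x ^+ 2 <= w by rewrite /w lerDr.
have C1 := kcos_sub1 k x; have C2 := kcos_le1 k x.
have S1 := ksin_subx k x; have S2 := ksin_le k x.
have x3 : k ^+ 2 * x ^+ 2 * `|x| <= N.
  by rewrite /N -mulrA ler_wpM2l// expr2 ler_pM ?sqr_ge0.
have h1 : `|ksin k x * kcos k x - x| <= 2 * N.
  rewrite (_ : _ - _ = (ksin k x - x) * kcos k x + x * (kcos k x - 1)); last by ring.
  have -> : 2 * N = N + N by ring.
  apply: le_trans (ler_normD _ _) _; rewrite lerD// normrM.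
    by rewrite -[N]mulr1 ler_pM// (le_trans S1).
  by apply: le_trans x3; rewrite mulrC ler_wpM2r.
have h2 : `|ksin k x ^+ 2 - x ^+ 2| <= 2 * N.
  rewrite subr_sqr normrM.
  have s : `|ksin k x + x| <= 2 * `|x|.
    by apply: le_trans (ler_normD _ _) _; lra.
  apply: le_trans (ler_pM _ _ S1 s) _ => //.
  rewrite [leLHS](_ : _ = 2 * (k ^+ 2 * (x ^+ 2 * `|x| ^+ 2))); last by ring.
  by rewrite ler_wpM2l// ler_wpM2l// real_normK ?num_real// expr2 ler_pM ?sqr_ge0.
have h3 : `|kcos k x ^+ 2 - 1| <= 2 * N.
  rewrite -[1](expr1n _ 2) subr_sqr normrM mulrC.
  apply: ler_pM => //; first by apply: le_trans (ler_normD _ _) _; rewrite normr1; lra.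
  apply: le_trans C1 _; rewrite ler_wpM2l//; apply: le_trans x2w _.
  by rewrite expr2 ler_peMr// (le_trans ler01).
have N0 : 0 <= N by rewrite mulr_ge0// sqr_ge0.
have E (s t : R) : `|s| <= 2 * N -> `|t| <= 2 * N -> `|a * s + b * t| <= 4 * M * N.
  move=> sN tN; apply: le_trans (ler_normD _ _) _; rewrite !normrM.
  have := ler_pM (normr_ge0 a) (normr_ge0 s) aM sN.
  have := ler_pM (normr_ge0 b) (normr_ge0 t) bM tN.
  lra.
by split; apply: E.
Qed.

(** The amplitudes at energy [k ^ 2] stay within [O(k ^ 2)] of those at zero energy,
    uniformly on the line: the coefficients of the amplitude equation are
    even in [k]. *)
Lemma amp_close u v : solves (pot q 0) u v ->
  exists C, forall k y z, solves (pot q k) y z -> y 0 = u 0 -> z 0 = v 0 ->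
  forall x, `|ampc k y z x - ampc 0 u v x| <= C * k ^+ 2 /\
            `|amps k y z x - amps 0 u v x| <= C * k ^+ 2.
Proof.
move=> uv; have [M M0 MP] := amp_bounded_norm q_decay uv.
have kap0 := kap_ge0 q_decay.
pose L := (2 + 8 * M) * kap.
have L0 : 0 <= L by rewrite mulr_ge0// addr_ge0// mulr_ge0.
exists (1 + expR (L * 2)) => k y z yz y0 z0 x.
pose A t := ampc k y z t; pose B t := amps k y z t.
pose A0 t := ampc 0 u v t; pose B0 t := amps 0 u v t.
pose C := kcos k; pose S := ksin k.
pose D1 t := A t - A0 t; pose D2 t := B t - B0 t.
pose r1 t := A0 t * (S t * C t - t) + B0 t * (S t ^+ 2 - t ^+ 2).
pose r2 t := A0 t * (C t ^+ 2 - 1) + B0 t * (S t * C t - t).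
have yE t : y t = A t * C t + B t * S t by exact: ampK.
have uE t : u t = A0 t + B0 t * t by rewrite (ampK 0 u v t) kcos_0 ksin_0 mulr1.
(* [k ^ 4] absorbs the source terms [r1] and [r2], which are of order [k ^ 2] *)
pose F t := D1 t ^+ 2 + D2 t ^+ 2 + k ^+ 4.
pose dF t := 2 * q t * ((D1 t * S t - D2 t * C t) * (D1 t * C t + D2 t * S t))
  + 2 * q t * (D1 t * r1 t - D2 t * r2 t).
have Fd t : drv F t (dF t).
  have Ad := ampc_drv t yz; have Bd := amps_drv t yz.
  have A0d := ampc_drv t uv; have B0d := amps_drv t uv.
  rewrite /F /D1 /D2 /A /B /A0 /B0; drv.
  rewrite /= ksin_0 kcos_0 uE yE -/(A t) -/(B t) -/(A0 t) -/(B0 t).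
  rewrite /dF /D1 /D2 /r1 /r2 /C /S; ring.
have F0 : F 0 = k ^+ 4.
  rewrite /F /D1 /D2 /A /B /A0 /B0 /ampc /amps y0 z0 !kcos0 !ksin0; ring.
have Fge t : D1 t ^+ 2 + D2 t ^+ 2 <= F t by rewrite lerDl exprn_even_ge0.
have dFF t : `|dF t| <= L / (1 + t ^+ 2) * F t.
  set w := 1 + t ^+ 2.
  have w0 : 0 < w := jap_gt0 t; have w1 : 1 <= w := jap_ge1 t.
  have [a0M b0M] := MP t; have [r1M r2M] := remainder_le k t a0M b0M.
  have F0' : 0 <= F t by apply: le_trans (Fge t); rewrite addr_ge0 ?sqr_ge0.
  have w2F : 0 <= w ^+ 2 * F t by rewrite mulr_ge0 ?sqr_ge0.
  have h1 : `|2 * q t * ((D1 t * S t - D2 t * C t) * (D1 t * C t + D2 t * S t))|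
      <= 2 * `|q t| * (w ^+ 2 * F t).
    rewrite normrM (normrM 2) ger0_norm// ler_wpM2l ?mulr_ge0//.
    apply: le_trans (energy_ineq (D1 t) (D2 t) (normr_ge0 t) (kcos_le1 k t) (ksin_le k t)) _.
    rewrite real_normK ?num_real// -/w mulrC.
    rewrite ler_pM// ?addr_ge0 ?sqr_ge0 ?(ltW w0)//.
    by rewrite expr2 ler_peMr// ltW.
  have h2 : `|2 * q t * (D1 t * r1 t - D2 t * r2 t)| <= 8 * M * `|q t| * (w ^+ 2 * F t).
    rewrite normrM (normrM 2) ger0_norm//.
    have h : `|D1 t * r1 t - D2 t * r2 t| <= 4 * M * (w ^+ 2 * F t).
      apply: le_trans (ler_normB _ _) _; rewrite !normrM.
      apply: le_trans (lerD (ler_wpM2l (normr_ge0 _) r1M) (ler_wpM2l (normr_ge0 _) r2M)) _.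
      rewrite [leLHS](_ : _ = 4 * M * (w ^+ 2 * (k ^+ 2 * (`|D1 t| + `|D2 t|)))); last by rewrite -/w; ring.
      apply: ler_wpM2l; first by rewrite mulr_ge0.
      apply: ler_wpM2l; first exact: sqr_ge0.
      rewrite /F -(@real_normK _ (D1 t)) ?num_real// -(@real_normK _ (D2 t)) ?num_real//.
      rewrite (_ : k ^+ 4 = (k ^+ 2) ^+ 2); last by ring.
      move: `|D1 t| `|D2 t| (k ^+ 2) => d1 d2 e.
      have := sqr_ge0 (d1 - e); have := sqr_ge0 (d2 - e).
      have := sqr_ge0 d1; have := sqr_ge0 d2; nra.
    apply: le_trans (ler_wpM2l _ h) _; first by rewrite mulr_ge0.
    by rewrite le_eqVlt; apply/orP; left; apply/eqP; ring.
  apply: le_trans (ler_normD _ _) _; apply: le_trans (lerD h1 h2) _.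
  rewrite [leLHS](_ : _ = (2 + 8 * M) * (`|q t| * w ^+ 2) * F t); last by ring.
  rewrite ler_wpM2r// /L -mulrA ler_wpM2l ?addr_ge0 ?mulr_ge0//.
  rewrite ler_pdivlMr// -mulrA -exprSr.
  exact: (q_decayW q_decay).
have [x0 xx] := ball_norm x.
have Fx : F x <= k ^+ 4 * expR (L * 2).
  rewrite -F0; apply: le_trans (gronwall Fd (hat_drv L) _ x0 xx (fun t _ => dFF t)) _.
    by rewrite F0 exprn_even_ge0.
  by rewrite ler_wpM2l ?F0 ?exprn_even_ge0// ler_expR; exact: hat_le.
have E (d : R) : d ^+ 2 <= F x -> `|d| <= (1 + expR (L * 2)) * k ^+ 2.
  move=> dF2; have e0 := expR_ge0 (L * 2).
  have c0 : 0 <= (1 + expR (L * 2)) * k ^+ 2 by rewrite mulr_ge0 ?sqr_ge0// addr_ge0.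
  rewrite -(@ler_pXn2r _ 2)// ?nnegrE// real_normK ?num_real//.
  apply: le_trans dF2 (le_trans Fx _).
  rewrite exprMn -exprM mulrC ler_wpM2r ?exprn_even_ge0//; nra.
by split; apply: E; apply: le_trans (Fge x); rewrite ?lerDl ?lerDr sqr_ge0.
Qed.

End LowEnergy.

(** * The transfer matrix *)

Section Transfer.
Variable R : realType.
Implicit Types (y z u v : R -> R) (k a b c d x : R).

Lemma cvgr_unique (F : set_system R) (f : R -> R) a b : ProperFilter F ->
  f x @[x --> F] --> a -> f x @[x --> F] --> b -> a = b.
Proof. by move=> FF; apply: cvg_unique; exact: (@norm_hausdorff R R^o). Qed.

Lemma asym_right_lin k y z u v a b c d s t :
  asym_right k y z a b -> asym_right k u v c d ->
  asym_right k (fun x => s * y x + t * u x) (fun x => s * z x + t * v x)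
    (s * a + t * c) (s * b + t * d).
Proof.
move=> [K KP] [M MP]; exists (`|s| * K + `|t| * M) => x x1.
have [a1 b1] := KP x x1; have [c1 d1] := MP x x1.
have j0 := ltW (jap_gt0 x).
have E (p r : R) : `|p| * (1 + x ^+ 2) <= K -> `|r| * (1 + x ^+ 2) <= M ->
    `|s * p + t * r| * (1 + x ^+ 2) <= `|s| * K + `|t| * M.
  move=> pK rM; apply: le_trans (ler_wpM2r j0 (ler_normD _ _)) _.
  by rewrite !normrM mulrDl -!mulrA lerD// ler_wpM2l.
split.
  apply: le_trans (E _ _ a1 c1); rewrite le_eqVlt; apply/orP; left; apply/eqP.
  by congr (`|_| * _); rewrite /ampc; ring.
apply: le_trans (E _ _ b1 d1); rewrite le_eqVlt; apply/orP; left; apply/eqP.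
by congr (`|_| * _); rewrite /amps; ring.
Qed.

Lemma asym_left_lin k y z u v a b c d s t :
  asym_left k y z a b -> asym_left k u v c d ->
  asym_left k (fun x => s * y x + t * u x) (fun x => s * z x + t * v x)
    (s * a + t * c) (s * b + t * d).
Proof.
move=> [K KP] [M MP]; exists (`|s| * K + `|t| * M) => x x1.
have [a1 b1] := KP x x1; have [c1 d1] := MP x x1.
have j0 := ltW (jap_gt0 x).
have E (p r : R) : `|p| * (1 + x ^+ 2) <= K -> `|r| * (1 + x ^+ 2) <= M ->
    `|s * p + t * r| * (1 + x ^+ 2) <= `|s| * K + `|t| * M.
  move=> pK rM; apply: le_trans (ler_wpM2r j0 (ler_normD _ _)) _.
  by rewrite !normrM mulrDl -!mulrA lerD// ler_wpM2l.
split.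
  apply: le_trans (E _ _ a1 c1); rewrite le_eqVlt; apply/orP; left; apply/eqP.
  by congr (`|_| * _); rewrite /ampc; ring.
apply: le_trans (E _ _ b1 d1); rewrite le_eqVlt; apply/orP; left; apply/eqP.
by congr (`|_| * _); rewrite /amps; ring.
Qed.

Lemma asym_det (F : set_system R) (A B C D : R -> R) a b c d : ProperFilter F ->
  A x @[x --> F] --> a -> B x @[x --> F] --> b ->
  C x @[x --> F] --> c -> D x @[x --> F] --> d ->
  forall e, (forall x, A x * D x - B x * C x = e) -> a * d - b * c = e.
Proof.
move=> FF Aa Bb Cc Dd e E.
have l : A x * D x - B x * C x @[x --> F] --> a * d - b * c.
  by apply: (@cvgB _ R^o); apply: cvgM.
apply: (cvgr_unique FF l); under eq_fun do rewrite E.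
exact: cvg_cst.
Qed.

Variables (q : R -> R) (kap : R).
Hypothesis qc : continuous q.
Hypothesis q_decay : forall x, `|q x| * (1 + x ^+ 2) ^+ 4 <= kap.

(** The real solutions of energy [k ^ 2] asymptotic to [cos (k x)] and
    [sin (k x) / k]: the Jost solutions are [y + i k u] on the right and
    [y - i k u] on the left. *)
Definition right_basis k y z u v := [/\ solves (pot q k) y z, solves (pot q k) u v,
  asym_right k y z 1 0 & asym_right k u v 0 1].

Definition left_basis k y z u v := [/\ solves (pot q k) y z, solves (pot q k) u v,
  asym_left k y z 1 0 & asym_left k u v 0 1].

(** Both bases are combinations of the solutions with unit Cauchy data at the origin,
    whose limit amplitudes at either end are [flat] by [amp_close]. The entries are
    bilinear in these amplitudes, and the determinant is a product of two
    Wronskians. *)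
Lemma transfer : exists (al be ga de : R -> R) (y z u v Y Z U V : R -> R -> R),
  [/\ flat al, flat be, flat ga & flat de] /\ forall k,
  [/\ right_basis k (y k) (z k) (u k) (v k), left_basis k (Y k) (Z k) (U k) (V k),
      al k * de k - be k * ga k = 1 &
      forall x, Y k x = al k * y k x + ga k * u k x /\
                U k x = be k * y k x + de k * u k x].
Proof.
have pc k : continuous (pot q k) by exact: pot_continuous.
pose cc k := ivp (pot q k) 1 0; pose ss k := ivp (pot q k) 0 1.
have ccP k : solves (pot q k) (cc k).1 (cc k).2 by case: (ivpP 1 0 (pc k)).
have ssP k : solves (pot q k) (ss k).1 (ss k).2 by case: (ivpP 0 1 (pc k)).
have lim : forall k, exists ab : (R * R) * (R * R) * ((R * R) * (R * R)),
    [/\ asym_right k (cc k).1 (cc k).2 ab.1.1.1 ab.1.1.2,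
        asym_right k (ss k).1 (ss k).2 ab.1.2.1 ab.1.2.2,
        asym_left k (cc k).1 (cc k).2 ab.2.1.1 ab.2.1.2 &
        asym_left k (ss k).1 (ss k).2 ab.2.2.1 ab.2.2.2].
  move=> k; have [[a [b h1]] [c [d h2]]] := asym_exists q_decay (ccP k).
  have [[a' [b' h1']] [c' [d' h2']]] := asym_exists q_decay (ssP k).
  by exists ((a, b), (a', b'), ((c, d), (c', d'))).
have [ab abP] := choice lim.
pose a1 k := (ab k).1.1.1; pose b1 k := (ab k).1.1.2.
pose a2 k := (ab k).1.2.1; pose b2 k := (ab k).1.2.2.
pose c1 k := (ab k).2.1.1; pose d1 k := (ab k).2.1.2.
pose c2 k := (ab k).2.2.1; pose d2 k := (ab k).2.2.2.
have c1r k : asym_right k (cc k).1 (cc k).2 (a1 k) (b1 k) by case: (abP k).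
have s1r k : asym_right k (ss k).1 (ss k).2 (a2 k) (b2 k) by case: (abP k).
have c1l k : asym_left k (cc k).1 (cc k).2 (c1 k) (d1 k) by case: (abP k).
have s1l k : asym_left k (ss k).1 (ss k).2 (c2 k) (d2 k) by case: (abP k).
have W k x : ampc k (cc k).1 (cc k).2 x * amps k (ss k).1 (ss k).2 x
    - amps k (cc k).1 (cc k).2 x * ampc k (ss k).1 (ss k).2 x = 1.
  by rewrite amp_wronskian; exact: ivp_wronskian.
have detr k : a1 k * b2 k - b1 k * a2 k = 1.
  have [h1 h2] := asym_right_cvg (c1r k); have [h3 h4] := asym_right_cvg (s1r k).
  exact: asym_det h1 h2 h3 h4 _ (W k).
have detl k : c1 k * d2 k - d1 k * c2 k = 1.
  have [h1 h2] := asym_left_cvg (c1l k); have [h3 h4] := asym_left_cvg (s1l k).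
  exact: asym_det h1 h2 h3 h4 _ (W k).
have flat_lim (F : set_system R) (e : R -> R) (h : R -> R -> R) : ProperFilter F ->
    (forall k, h k x @[x --> F] --> e k) ->
    (exists C, forall k x, `|h k x - h 0 x| <= C * k ^+ 2) -> flat e.
  move=> FF he [C CP]; exists C => k _.
  apply: (@cvg_norm_le _ F (fun x => h k x - h 0 x)) (CP k).
  exact: (@cvgB _ R^o _ _ _ _ _ _ _ (he k) (he 0)).
have [C CP] := amp_close q_decay (ccP 0).
have {}CP k := CP k _ _ (ccP k).
have [D DP] := amp_close q_decay (ssP 0).
have {}DP k := DP k _ _ (ssP k).
have cc0 k : (cc k).1 0 = (cc 0).1 0 /\ (cc k).2 0 = (cc 0).2 0.
  by have [_ -> ->] := ivpP 1 0 (pc k); have [_ -> ->] := ivpP 1 0 (pc 0).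
have ss0 k : (ss k).1 0 = (ss 0).1 0 /\ (ss k).2 0 = (ss 0).2 0.
  by have [_ -> ->] := ivpP 0 1 (pc k); have [_ -> ->] := ivpP 0 1 (pc 0).
have {}CP k := CP k (cc0 k).1 (cc0 k).2.
have {}DP k := DP k (ss0 k).1 (ss0 k).2.
have fa1 : flat a1.
  by apply: flat_lim (fun k => (asym_right_cvg (c1r k)).1) _; exists C => k x; exact: (CP k x).1.
have fb1 : flat b1.
  by apply: flat_lim (fun k => (asym_right_cvg (c1r k)).2) _; exists C => k x; exact: (CP k x).2.
have fa2 : flat a2.
  by apply: flat_lim (fun k => (asym_right_cvg (s1r k)).1) _; exists D => k x; exact: (DP k x).1.
have fb2 : flat b2.
  by apply: flat_lim (fun k => (asym_right_cvg (s1r k)).2) _; exists D => k x; exact: (DP k x).2.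
have fc1 : flat c1.
  by apply: flat_lim (fun k => (asym_left_cvg (c1l k)).1) _; exists C => k x; exact: (CP k x).1.
have fd1 : flat d1.
  by apply: flat_lim (fun k => (asym_left_cvg (c1l k)).2) _; exists C => k x; exact: (CP k x).2.
have fc2 : flat c2.
  by apply: flat_lim (fun k => (asym_left_cvg (s1l k)).1) _; exists D => k x; exact: (DP k x).1.
have fd2 : flat d2.
  by apply: flat_lim (fun k => (asym_left_cvg (s1l k)).2) _; exists D => k x; exact: (DP k x).2.
pose comb (e f : R -> R) k x := e k * (cc k).1 x + f k * (ss k).1 x.
pose comb' (e f : R -> R) k x := e k * (cc k).2 x + f k * (ss k).2 x.
exists (fun k => d2 k * a1 k - d1 k * a2 k), (fun k => c1 k * a2 k - c2 k * a1 k),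
  (fun k => d2 k * b1 k - d1 k * b2 k), (fun k => c1 k * b2 k - c2 k * b1 k).
exists (comb b2 (fun k => - b1 k)), (comb' b2 (fun k => - b1 k)).
exists (comb (fun k => - a2 k) a1), (comb' (fun k => - a2 k) a1).
exists (comb d2 (fun k => - d1 k)), (comb' d2 (fun k => - d1 k)).
exists (comb (fun k => - c2 k) c1), (comb' (fun k => - c2 k) c1).
split; first by split; apply: flatB; apply: flatM.
move=> k; have dr := detr k; have dl := detl k; split.
- split; try exact: solves_lin.
  + by have := asym_right_lin (b2 k) (- b1 k) (c1r k) (s1r k); congr asym_right; [rewrite -dr; ring|ring].
  + by have := asym_right_lin (- a2 k) (a1 k) (c1r k) (s1r k); congr asym_right; [ring|rewrite -dr; ring].
- split; try exact: solves_lin.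
  + by have := asym_left_lin (d2 k) (- d1 k) (c1l k) (s1l k); congr asym_left; [rewrite -dl; ring|ring].
  + by have := asym_left_lin (- c2 k) (c1 k) (c1l k) (s1l k); congr asym_left; [ring|rewrite -dl; ring].
- transitivity ((a1 k * b2 k - b1 k * a2 k) * (c1 k * d2 k - d1 k * c2 k)); first ring.
  by rewrite dr dl mulr1.
move=> x; rewrite /comb; split.
  transitivity ((a1 k * b2 k - b1 k * a2 k) * (d2 k * (cc k).1 x + - d1 k * (ss k).1 x)); last ring.
  by rewrite dr mul1r.
transitivity ((a1 k * b2 k - b1 k * a2 k) * (- c2 k * (cc k).1 x + c1 k * (ss k).1 x)); last ring.
by rewrite dr mul1r.
Qed.

End Transfer.

(** * Plane waves *)

Section ComplexLimits.
Variable R : realType.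
Implicit Types (T : Type) (r : R).

Lemma gt0_complexP (e : R[i]) : 0 < e -> exists2 r, 0 < r & e = r%:C.
Proof.
case: e => a b; rewrite ltcE /= => /andP[/eqP b0 a0]; exists a => //.
by rewrite b0.
Qed.

Lemma complex_norm_ge (z : R[i]) : (`|complex.Re z|%:C <= `|z|) /\ (`|complex.Im z|%:C <= `|z|).
Proof.
rewrite normc_def !lecR -[X in X <= _ /\ _]sqrtr_sqr -[X in _ /\ X <= _]sqrtr_sqr.
by split; apply: ler_wsqrtr; rewrite ?lerDl ?lerDr sqr_ge0.
Qed.

Lemma complex_norm_le (z : R[i]) : `|z| <= (`|complex.Re z| + `|complex.Im z|)%:C.
Proof.
rewrite normc_def lecR -[leRHS]ger0_norm ?addr_ge0// -sqrtr_sqr.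
apply: ler_wsqrtr; rewrite -(@real_normK _ (complex.Re z)) ?num_real//.
rewrite -(@real_normK _ (complex.Im z)) ?num_real//.
have := normr_ge0 (complex.Re z); have := normr_ge0 (complex.Im z).
by move: `|_| `|_| => u v u0 v0; have := mulr_ge0 u0 v0; nra.
Qed.

Lemma cvgCP T (F : set_system T) (f : T -> R[i]) (c : R[i]) : Filter F ->
  (f x : (R[i])^o) @[x --> F] --> (c : (R[i])^o) <->
  complex.Re (f x) @[x --> F] --> complex.Re c /\
  complex.Im (f x) @[x --> F] --> complex.Im c.
Proof.
move=> FF; split=> [/cvgrPdist_lt H|[/cvgrPdist_lt HR /cvgrPdist_lt HI]].
  split; apply/cvgrPdist_lt => e e0.
    have /H : 0 < e%:C by rewrite ltcR.
    apply: filterS => x; have [h _] := complex_norm_ge (c - f x).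
    by move=> /(le_lt_trans h); rewrite ltcR; case: (f x); case: c {H h}.
  have /H : 0 < e%:C by rewrite ltcR.
  apply: filterS => x; have [_ h] := complex_norm_ge (c - f x).
  by move=> /(le_lt_trans h); rewrite ltcR; case: (f x); case: c {H h}.
apply/cvgrPdist_lt => _/gt0_complexP[r r0 ->].
have r20 : 0 < r / 2 by rewrite divr_gt0.
near=> x; apply: le_lt_trans (complex_norm_le _) _; rewrite ltcR.
have h1 : `|complex.Re c - complex.Re (f x)| < r / 2 by near: x; exact: HR.
have h2 : `|complex.Im c - complex.Im (f x)| < r / 2 by near: x; exact: HI.
rewrite (_ : complex.Re (c - f x) = complex.Re c - complex.Re (f x)).
  rewrite (_ : complex.Im (c - f x) = complex.Im c - complex.Im (f x)); first by lra.
  by case: (f x); case: (c).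
by case: (f x); case: (c).
Unshelve. all: by end_near. Qed.

Lemma cvg0_mul_bounded T (F : set_system T) (f g : T -> R) (C : R) : Filter F ->
  f x @[x --> F] --> (0 : R) -> (forall x, `|g x| <= C) -> f x * g x @[x --> F] --> (0 : R).
Proof.
move=> FF /cvgrPdist_le f0 gC; apply/cvgrPdist_le => e e0.
have C0 : 0 < `|C| + 1 by rewrite ltr_wpDl.
have /f0 : 0 < e / (`|C| + 1) by rewrite divr_gt0.
apply: filterS => x; rewrite !sub0r !normrN normrM ler_pdivlMr// => h.
apply: le_trans h; rewrite ler_wpM2l//.
by apply: le_trans (gC x) _; apply: le_trans (ler_norm _) _; rewrite lerDl.
Qed.

Lemma cvg_ext (F : set_system R) (y u : R -> R) (l : R) : (forall x, y x = u x) ->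
  y x @[x --> F] --> l -> u x @[x --> F] --> l.
Proof. by move=> /funext ->. Qed.

Lemma cvg0D (F : set_system R) (y u : R -> R) : Filter F ->
  y x @[x --> F] --> (0 : R) -> u x @[x --> F] --> (0 : R) -> y x + u x @[x --> F] --> (0 : R).
Proof. by move=> FF y0 u0; rewrite -(addr0 0); exact: (@cvgD _ R^o _ _ _ y u). Qed.

Lemma cvg0B (F : set_system R) (y u : R -> R) : Filter F ->
  y x @[x --> F] --> (0 : R) -> u x @[x --> F] --> (0 : R) -> y x - u x @[x --> F] --> (0 : R).
Proof. by move=> FF y0 u0; rewrite -(subr0 0); exact: (@cvgB _ R^o _ _ _ y u). Qed.

(** A plane wave has modulus one, so the quotient tends to 1 exactly when the
    difference tends to 0. *)
Lemma wave_cvgP (F : set_system R) (k : R) (y : R -> R[i]) : Filter F ->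
  (y x / (cos (k * x) +i* sin (k * x)) : (R[i])^o) @[x --> F] --> (1 : (R[i])^o) <->
  complex.Re (y x) - cos (k * x) @[x --> F] --> (0 : R) /\
  complex.Im (y x) - sin (k * x) @[x --> F] --> (0 : R).
Proof.
move=> FF.
pose p x := complex.Re (y x) * cos (k * x) + complex.Im (y x) * sin (k * x).
pose s x := complex.Im (y x) * cos (k * x) - complex.Re (y x) * sin (k * x).
have C1 x : `|cos (k * x)| <= 1 by rewrite ler_norml cos_geN1 cos_le1.
have S1 x : `|sin (k * x)| <= 1 by rewrite ler_norml sin_geN1 sin_le1.
have CS x := cos2Dsin2 (k * x).
have yE x : y x / (cos (k * x) +i* sin (k * x)) = p x +i* s x.
  rewrite /p /s; case: (y x) => a b /=.
  by simpc; rewrite CS !divr1; congr (_ +i* _); ring.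
have -> : (fun x => y x / (cos (k * x) +i* sin (k * x)) : (R[i])^o) = (fun x => p x +i* s x).
  by apply/funext.
have cvg0P (g : R -> R) (l : R) : g x @[x --> F] --> l -> g x - l @[x --> F] --> (0 : R).
  by move=> gl; rewrite -(subrr l); apply: (@cvgB _ R^o _ _ _ g (cst l)) => //; exact: cvg_cst.
split=> [/cvgCP/= [p1 s0]|[c0 i0]].
  have {}p1 := cvg0P _ _ p1.
  split.
    rewrite (_ : (fun x => _) = fun x => (p x - 1) * cos (k * x) + s x * - sin (k * x)).
      by apply: cvg0D; [apply: cvg0_mul_bounded p1 C1|apply: cvg0_mul_bounded s0 _ => x; rewrite normrN].
    apply/funext => x; apply/eqP; rewrite -subr_eq0 /p /s.
    rewrite [X in X == 0](_ : _ = complex.Re (y x) * (1 - (cos (k * x) ^+ 2 + sin (k * x) ^+ 2))).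
      by rewrite CS subrr mulr0.
    by ring.
  rewrite (_ : (fun x => _) = fun x => (p x - 1) * sin (k * x) + s x * cos (k * x)).
    by apply: cvg0D; [apply: cvg0_mul_bounded p1 S1|apply: cvg0_mul_bounded s0 C1].
  apply/funext => x; apply/eqP; rewrite -subr_eq0 /p /s.
  rewrite [X in X == 0](_ : _ = complex.Im (y x) * (1 - (cos (k * x) ^+ 2 + sin (k * x) ^+ 2))).
    by rewrite CS subrr mulr0.
  by ring.
apply/cvgCP; split => /=.
  have : p x - 1 @[x --> F] --> (0 : R).
    rewrite (_ : (fun x => _) = fun x => (complex.Re (y x) - cos (k * x)) * cos (k * x) +
        (complex.Im (y x) - sin (k * x)) * sin (k * x)).
      by apply: cvg0D; [apply: cvg0_mul_bounded c0 C1|apply: cvg0_mul_bounded i0 S1].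
    by apply/funext => x; rewrite -(CS x) /p; ring.
  by move=> /(@cvg_sub0 _ _ _ _ _ _ _); apply; exact: cvg_cst.
rewrite (_ : (fun x => _) = fun x => (complex.Re (y x) - cos (k * x)) * - sin (k * x) +
    (complex.Im (y x) - sin (k * x)) * cos (k * x)).
  by apply: cvg0D; [apply: cvg0_mul_bounded c0 _ => x; rewrite normrN|apply: cvg0_mul_bounded i0 C1].
by apply/funext => x; rewrite /s; ring.
Qed.

Lemma cexp_wave (k x : R) :
  cexp ('i * k%:C * x%:C) = cos (k * x) +i* sin (k * x) /\
  cexp (- ('i * k%:C * x%:C)) = cos (- k * x) +i* sin (- k * x).
Proof.
have E : 'i * k%:C * x%:C = 0 +i* (k * x) by simpc.
have EN : - ('i * k%:C * x%:C) = 0 +i* (- k * x) by rewrite E mulNr -[X in _ = X +i* _]oppr0.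
by rewrite /cexp EN E /= expR0; split; simpc.
Qed.

End ComplexLimits.

(** * Jost solutions *)

Section JostSolutions.
Variable R : realType.
Implicit Types (y z u v : R -> R) (k a b c d x : R) (f : R -> R[i]).

Lemma solution_components q k f : schrodinger_solution q k%:C f ->
  (exists z, solves (pot q k) (fun x => complex.Re (f x)) z) /\
  (exists z, solves (pot q k) (fun x => complex.Im (f x)) z).
Proof.
move=> [fd f'd fE]; split.
  exists (fun x => derive1 (@complex.Re R \o f) x) => x; split.
    exact: derivable_drv (fd x).1.
  have f2 : drv (derive1 (@complex.Re R \o f)) x (derive1 (@complex.Re R \o cderive f) x).
    exact: derivable_drv (f'd x).1.
  apply: drv_eq f2 _.
  have := fE x; rewrite /cderive /pot; case: (f x) => a b /=.
  by simpc => -[+ _] => /eqP; rewrite -subr_eq0 => /eqP h; lra.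
exists (fun x => derive1 (@complex.Im R \o f) x) => x; split.
  exact: derivable_drv (fd x).2.
have f2 : drv (derive1 (@complex.Im R \o f)) x (derive1 (@complex.Im R \o cderive f) x).
    exact: derivable_drv (f'd x).2.
  apply: drv_eq f2 _.
have := fE x; rewrite /cderive /pot; case: (f x) => a b /=.
by simpc => -[_ +] => /eqP; rewrite -subr_eq0 => /eqP h; lra.
Qed.

Lemma components_solution q k y z u v : solves (pot q k) y z -> solves (pot q k) u v ->
  schrodinger_solution q k%:C (fun x => y x +i* u x).
Proof.
move=> yz uv.
have yd x := (yz x).1; have zd x := (yz x).2; have ud x := (uv x).1; have vd x := (uv x).2.
have y' : derive1 y = z by apply/funext => x; exact: drv_derive1.
have u' : derive1 u = v by apply/funext => x; exact: drv_derive1.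
have cd : cderive (fun x => y x +i* u x) = fun x => z x +i* v x.
  by apply/funext => x; rewrite /cderive -[_ \o _]/y -[X in _ +i* derive1 X x]/u y' u'.
split=> x.
- by split; [case: (yd x)|case: (ud x)].
- by rewrite cd; split; [case: (zd x)|case: (vd x)].
- rewrite cd /cderive -[X in derive1 X x +i* _]/z -[X in _ +i* derive1 X x]/v.
  rewrite (drv_derive1 (zd x)) (drv_derive1 (vd x)) /pot.
  by simpc; congr (_ +i* _); ring.
Qed.

Lemma cvg0_jap y K : (forall x, 1 <= x -> `|y x| * x <= K) -> y x @[x --> +oo] --> (0 : R).
Proof.
move=> yK; apply/cvgrPdist_le => e e0; near=> x.
have x1 : 1 <= x by near: x; apply: nbhs_pinfty_ge; rewrite num_real.
have xK : K / e <= x by near: x; apply: nbhs_pinfty_ge; rewrite num_real.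
have x0 : 0 < x by lra.
rewrite sub0r normrN -(ler_pM2r x0); apply: le_trans (yK _ x1) _.
by rewrite ler_pdivrMr// mulrC in xK.
Unshelve. all: by end_near. Qed.

Lemma asym_bound k y z a b K x :
  `|ampc k y z x - a| * (1 + x ^+ 2) <= K -> `|amps k y z x - b| * (1 + x ^+ 2) <= K ->
  `|y x - (a * kcos k x + b * ksin k x)| * `|x| <= K + K.
Proof.
move=> aK bK; rewrite (ampK k y z x).
rewrite (_ : _ - _ = (ampc k y z x - a) * kcos k x + (amps k y z x - b) * ksin k x); last by ring.
apply: le_trans (ler_wpM2r (normr_ge0 x) (ler_normD _ _)) _; rewrite mulrDl.
apply: lerD; rewrite normrM -mulrA.
  apply: le_trans aK; rewrite ler_wpM2l// (le_trans _ (norm_le_jap x))//.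
  by rewrite ler_piMl// kcos_le1.
apply: le_trans bK; rewrite ler_wpM2l//.
have -> : 1 + x ^+ 2 = 1 + `|x| * `|x| by rewrite -expr2 real_normK ?num_real.
by apply: le_trans (ler_wpM2r (normr_ge0 x) (ksin_le k x)) _; rewrite lerDr.
Qed.

Lemma asym_right_sub k y z a b : asym_right k y z a b ->
  y x - (a * kcos k x + b * ksin k x) @[x --> +oo] --> (0 : R).
Proof.
move=> [K KP]; apply: (@cvg0_jap _ (K + K)) => x x1; have [h1 h2] := KP x x1.
have := asym_bound h1 h2; rewrite [`|x|]ger0_norm//; lra.
Qed.

Lemma asym_left_sub k y z a b : asym_left k y z a b ->
  y x - (a * kcos k x + b * ksin k x) @[x --> -oo] --> (0 : R).
Proof.
move=> [K KP]; apply/cvgNy_compNP; apply: (@cvg0_jap _ (K + K)) => x x1 /=.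
have [|h1 h2] := KP (- x); first by lra.
by have := asym_bound h1 h2; rewrite normrN [`|x|]ger0_norm//; lra.
Qed.

(** No nonzero solution of the free equation tends to 0: a quarter of a period
    turns it into its derivative, and the sum of the squares is constant. *)
Lemma free_vanish k a b : a * kcos k x + b * ksin k x @[x --> +oo] --> (0 : R) ->
  a = 0 /\ b = 0.
Proof.
move=> f0; have [k0|k0] := eqVneq k 0.
  have fE x : a * kcos k x + b * ksin k x = a + b * x.
    by rewrite k0 kcos_0 ksin_0 mulr1.
  have {}f0 : a + b * x @[x --> +oo] --> (0 : R) by under eq_fun do rewrite -fE.
  have f1 : a + b * (x + 1) @[x --> +oo] --> (0 : R).
    by have := cvg_shiftr 1 (fun x => a + b * x) 0 => ->.
  have b0 : b = 0.
    have := cvg0B _ f1 f0; rewrite (_ : (fun x => _) = cst b) => [bc|].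
      apply: (@cvgr_unique _ +oo (cst b)); [exact: cvg_cst|exact: bc].
    by apply/funext => x /=; ring.
  split=> //; rewrite b0 in f0; apply: (@cvgr_unique _ +oo (cst a)); first exact: cvg_cst.
  by move: f0; apply: cvg_ext => x /=; ring.
pose s := pi / 2 / k.
have ks x : k * (x + s) = k * x + pi / 2 by rewrite /s; field.
have kE x : ksin k x = sin (k * x) / k by rewrite /ksin (negbTE k0).
have f1 : b / k * cos (k * x) - a * sin (k * x) @[x --> +oo] --> (0 : R).
  have := cvg_shiftr s (fun x => a * kcos k x + b * ksin k x) 0 => /esym e.
  have := f0; rewrite e; apply: cvg_ext => x.
  by rewrite /kcos kE !ks sinDpihalf cosDpihalf; field.
have g : (a * kcos k x + b * ksin k x) ^+ 2 + (b / k * cos (k * x) - a * sin (k * x)) ^+ 2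
    @[x --> +oo] --> (0 : R).
  rewrite -(addr0 0) -[X in X + _](mul0r 0) -[X in _ + X](mul0r 0).
  by apply: (@cvgD _ R^o); under eq_fun do rewrite expr2; apply: cvgM.
have sq0 : a ^+ 2 + (b / k) ^+ 2 = 0.
  apply: (@cvgr_unique _ +oo (cst (a ^+ 2 + (b / k) ^+ 2))); first exact: cvg_cst.
  move: g; apply: cvg_ext => x /=.
  rewrite -[RHS]mulr1 -(cos2Dsin2 (k * x)) /kcos kE; ring.
have := sqr_ge0 a; have := sqr_ge0 (b / k) => b2 a2.
have a20 : a ^+ 2 = 0 by lra.
have b20 : (b / k) ^+ 2 = 0 by lra.
split; first by apply/eqP; rewrite -sqrf_eq0 a20.
by apply/eqP; move/eqP: b20; rewrite sqrf_eq0 mulf_eq0 invr_eq0 (negbTE k0) orbF.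
Qed.

Variables (q : R -> R) (kap : R).
Hypothesis qc : continuous q.
Hypothesis q_decay : forall x, `|q x| * (1 + x ^+ 2) ^+ 4 <= kap.

(** The Wronskian of [y] with any other solution is constant and tends to 0 when the
    amplitudes of [y] do; a solution whose Wronskians with a basis are 0 is 0. *)
Lemma wronskian_vanish (F : set_system R) k y z : ProperFilter F ->
  (forall u v, solves (pot q k) u v -> exists a b,
    ampc k u v x @[x --> F] --> a /\ amps k u v x @[x --> F] --> b) ->
  solves (pot q k) y z -> ampc k y z x @[x --> F] --> (0 : R) ->
  amps k y z x @[x --> F] --> (0 : R) -> forall x, y x = 0.
Proof.
move=> FF lim yz A0 B0 x.
have W u v : solves (pot q k) u v -> y x * v x - z x * u x = 0.
  move=> uv; have [a [b [Aa Bb]]] := lim u v uv.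
  have := asym_det _ A0 B0 Aa Bb (e := y x * v x - z x * u x).
  rewrite !mul0r subrr => -> // t; rewrite amp_wronskian; exact: wronskian_cst.
have pc := pot_continuous qc (k := k).
have [cc _ _] := ivpP 1 0 pc; have [ss _ _] := ivpP 0 1 pc.
rewrite -[LHS]mulr1 -(ivp_wronskian x pc).
transitivity ((y x * (ivp (pot q k) 0 1).2 x - z x * (ivp (pot q k) 0 1).1 x) * (ivp (pot q k) 1 0).1 x
  - (y x * (ivp (pot q k) 1 0).2 x - z x * (ivp (pot q k) 1 0).1 x) * (ivp (pot q k) 0 1).1 x).
  by ring.
by rewrite !W// !mul0r subrr.
Qed.

(** A solution tending to 0 has zero limit amplitudes by [free_vanish]. This
    gives the uniqueness of the Jost solutions. *)
Lemma vanish_right k y z : solves (pot q k) y z -> y x @[x --> +oo] --> (0 : R) ->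
  forall x, y x = 0.
Proof.
move=> yz y0; have [[a [b ab]] _] := asym_exists q_decay yz.
have [a0 b0] : a = 0 /\ b = 0.
  apply: (@free_vanish k); apply: cvg_ext (cvg0B _ y0 (asym_right_sub ab)) => x.
  by ring.
rewrite a0 b0 in ab; have [A0 B0] := asym_right_cvg ab.
apply: wronskian_vanish yz A0 B0 => u v uv.
have [[c [d cd]] _] := asym_exists q_decay uv; exists c, d; exact: asym_right_cvg.
Qed.

Lemma vanish_left k y z : solves (pot q k) y z -> y x @[x --> -oo] --> (0 : R) ->
  forall x, y x = 0.
Proof.
move=> yz y0; have [_ [a [b ab]]] := asym_exists q_decay yz.
have [a0 b0] : a = 0 /\ - b = 0.
  have f0 : a * kcos k x + b * ksin k x @[x --> -oo] --> (0 : R).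
    by apply: cvg_ext (cvg0B _ y0 (asym_left_sub ab)) => x; ring.
  apply: (@free_vanish k); move/cvgNy_compNP: f0; apply: cvg_ext => x /=.
  by rewrite /kcos /ksin mulrN cosN sinN; case: ifP => _; ring.
have {}b0 : b = 0 by lra.
rewrite a0 b0 in ab; have [A0 B0] := asym_left_cvg ab.
apply: wronskian_vanish yz A0 B0 => u v uv.
have [_ [c [d cd]]] := asym_exists q_decay uv; exists c, d; exact: asym_left_cvg.
Qed.

Lemma jost_rightE k y z u v : right_basis q k y z u v ->
  jost_right q k%:C = fun x => y x +i* (k * u x).
Proof.
move=> [yz uv yA uA].
have kuv := solves_lin k 0 uv uv.
have kuE : (fun x => k * u x + 0 * u x) = fun x => k * u x.
  by apply/funext => x; rewrite mul0r addr0.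
rewrite kuE in kuv.
have y0 : y x - cos (k * x) @[x --> +oo] --> (0 : R).
  have := asym_right_sub yA; apply: cvg_ext => x.
  by rewrite /kcos; ring.
have u0 : k * u x - sin (k * x) @[x --> +oo] --> (0 : R).
  apply: (@cvg_ext _ _ (fun x => (u x - (0 * kcos k x + 1 * ksin k x)) * k)) => [x|].
    by rewrite -ksinE; ring.
  exact: (cvg0_mul_bounded _ (asym_right_sub uA) (fun=> lexx `|k|)).
rewrite /jost_right; apply: xget_subset1.
  split; first exact: components_solution yz kuv.
  under eq_fun do rewrite (cexp_wave k _).1.
  by apply/wave_cvgP.
move=> f g [fs fw] [gs gw].
have : forall f, is_jost_right q k%:C f -> f = fun x => y x +i* (k * u x).
  move=> {fs fw gs gw g}h [hs]; under eq_fun do rewrite (cexp_wave k _).1.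
  move=> /wave_cvgP[hr hi]; have [[z1 h1] [z2 h2]] := solution_components hs.
  apply/funext => x.
  have r0 : complex.Re (h x) - y x = 0.
    have := vanish_right (solves_lin 1 (-1) h1 yz) _ x.
    rewrite !mul1r mulN1r; apply.
    apply: cvg_ext (cvg0B _ hr y0) => t; ring.
  have i0 : complex.Im (h x) - k * u x = 0.
    have := vanish_right (solves_lin 1 (-1) h2 kuv) _ x.
    rewrite !mul1r mulN1r; apply.
    apply: cvg_ext (cvg0B _ hi u0) => t; ring.
  by move: r0 i0; case: (h x) => a b /= r0 i0; congr (_ +i* _); lra.
by move=> U; rewrite (U f)// (U g).
Qed.

Lemma jost_leftE k y z u v : left_basis q k y z u v ->
  jost_left q k%:C = fun x => y x +i* (- (k * u x)).
Proof.
move=> [yz uv yA uA].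
have kuv := solves_lin (- k) 0 uv uv.
have kuE : (fun x => - k * u x + 0 * u x) = fun x => - (k * u x).
  by apply/funext => x; rewrite mul0r addr0 mulNr.
rewrite kuE in kuv.
have y0 : y x - cos (- k * x) @[x --> -oo] --> (0 : R).
  have := asym_left_sub yA; apply: cvg_ext => x.
  by rewrite /kcos mulNr cosN; ring.
have u0 : - (k * u x) - sin (- k * x) @[x --> -oo] --> (0 : R).
  apply: (@cvg_ext _ _ (fun x => (u x - (0 * kcos k x + 1 * ksin k x)) * - k)) => [x|].
    by rewrite mulNr sinN -ksinE; ring.
  exact: (cvg0_mul_bounded _ (asym_left_sub uA) (fun=> lexx `|- k|)).
rewrite /jost_left; apply: xget_subset1.
  split; first exact: components_solution yz kuv.
  under eq_fun do rewrite (cexp_wave k _).2.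
  by apply/wave_cvgP.
move=> f g [fs fw] [gs gw].
have : forall f, is_jost_left q k%:C f -> f = fun x => y x +i* (- (k * u x)).
  move=> {fs fw gs gw g}h [hs]; under eq_fun do rewrite (cexp_wave k _).2.
  move=> /wave_cvgP[hr hi]; have [[z1 h1] [z2 h2]] := solution_components hs.
  apply/funext => x.
  have r0 : complex.Re (h x) - y x = 0.
    have := vanish_left (solves_lin 1 (-1) h1 yz) _ x.
    rewrite !mul1r mulN1r; apply.
    apply: cvg_ext (cvg0B _ hr y0) => t; ring.
  have i0 : complex.Im (h x) - - (k * u x) = 0.
    have := vanish_left (solves_lin 1 (-1) h2 kuv) _ x.
    rewrite !mul1r mulN1r; apply.
    apply: cvg_ext (cvg0B _ hi u0) => t; ring.
  by move: r0 i0; case: (h x) => a b /= r0 i0; congr (_ +i* _); lra.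
by move=> U; rewrite (U f)// (U g).
Qed.

End JostSolutions.

(** * The scattering coefficients at low energy *)

Section Scattering.
Variable R : realType.
Implicit Types (y z u v : R -> R) (k a b c d x : R).

Lemma near0_cvg (f : R -> R) (l K : R) :
  (forall k, k != 0 -> `|k| <= 1 -> `|f k - l| <= K * `|k|) -> f k @[k --> 0^'] --> l.
Proof.
move=> fK; apply/cvgrPdist_le => e e0.
have K0 : 0 < `|K| + 1 by rewrite ltr_wpDl.
have eK : 0 < e / (`|K| + 1) by rewrite divr_gt0.
near=> k.
have k0 : k != 0 by near: k; exact: nbhs_dnbhs_neq.
have k1 : `|k| <= 1 by near: k; exact: dnbhs0_le.
have ke : `|k| <= e / (`|K| + 1) by near: k; exact: dnbhs0_le.
rewrite distrC; apply: le_trans (fK k k0 k1) _.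
rewrite ler_pdivlMr// mulrC in ke; apply: le_trans ke; rewrite ler_wpM2r//.
by apply: le_trans (ler_norm K) _; rewrite lerDl.
Unshelve. all: by end_near. Qed.

Lemma flat_cvg (f : R -> R) : flat f -> f k @[k --> 0^'] --> f 0.
Proof.
move=> [K KP]; apply: (@near0_cvg _ _ `|K|) => k k0 k1.
apply: le_trans (KP k k1) _; rewrite -real_normK ?num_real// expr2 mulrA.
rewrite ler_wpM2r//; apply: le_trans (_ : `|K| * `|k| <= _); last by rewrite ler_piMr.
by rewrite ler_wpM2r// ler_norm.
Qed.

Lemma flat_div_cvg (f : R -> R) : flat f -> f 0 = 0 -> f k / k @[k --> 0^'] --> (0 : R).
Proof.
move=> [K KP] f0; apply: (@near0_cvg _ _ K) => k k0 k1.
have := KP k k1; rewrite f0 !subr0 normrM normfV ler_pdivrMr ?normr_gt0//.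
by rewrite -mulrA -expr2 real_normK ?num_real.
Qed.

Lemma id_cvg0 : k @[k --> (0 : R)^'] --> (0 : R).
Proof. by apply: (@near0_cvg _ _ 1) => k _ _; rewrite subr0 mul1r. Qed.

Lemma near0M (f g : R -> R) a b : f k @[k --> (0 : R)^'] --> a ->
  g k @[k --> (0 : R)^'] --> b -> f k * g k @[k --> (0 : R)^'] --> a * b.
Proof. by move=> fa gb; apply: cvgM. Qed.

Lemma near0_unique (f : R -> R) a b : f k @[k --> (0 : R)^'] --> a ->
  f k @[k --> (0 : R)^'] --> b -> a = b.
Proof. exact: cvgr_unique. Qed.

Lemma near0_cst c : (fun=> c) k @[k --> (0 : R)^'] --> c.
Proof. exact: cvg_cst. Qed.

Lemma near0V (f : R -> R) a : a != 0 -> f k @[k --> (0 : R)^'] --> a ->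
  (f k)^-1 @[k --> (0 : R)^'] --> a^-1.
Proof. by move=> a0 fa; apply: cvgV. Qed.

Lemma sum_sqr_cvg0 (F : set_system R) (f g : R -> R) : Filter F ->
  f x ^+ 2 + g x ^+ 2 @[x --> F] --> (0 : R) -> f x @[x --> F] --> (0 : R).
Proof.
move=> FF /cvgrPdist_le h; apply/cvgrPdist_le => e e0.
have /h : 0 < e ^+ 2 by rewrite exprn_gt0.
apply: filterS => x; rewrite !sub0r !normrN ger0_norm ?addr_ge0 ?sqr_ge0// => fg.
rewrite -(@ler_pXn2r _ 2)// ?nnegrE ?(ltW e0)// real_normK ?num_real//.
by apply: le_trans fg; rewrite lerDl sqr_ge0.
Qed.

Lemma value_at_zero_eq (F G : R -> R[i]) (c : R[i]) : (forall k, k != 0 -> F k = G k) ->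
  value_at_zero F c <-> value_at_zero G c.
Proof.
have H (F' G' : R -> R[i]) : (forall k, k != 0 -> F' k = G' k) -> value_at_zero F' c ->
    value_at_zero G' c.
  move=> FG; apply: cvg_trans; apply: near_eq_cvg; near=> k.
  by rewrite FG//; near: k; exact: nbhs_dnbhs_neq.
by move=> FG; split; apply: H => // k k0; rewrite FG.
Unshelve. all: by end_near. Qed.

Variables (q : R -> R) (kap : R).
Hypothesis qc : continuous q.
Hypothesis q_decay : forall x, `|q x| * (1 + x ^+ 2) ^+ 4 <= kap.

Lemma right_basisN k y z u v : right_basis q k y z u v -> right_basis q (- k) y z u v.
Proof.
have CN : kcos (- k) = kcos k by apply/funext => x; rewrite /kcos mulNr cosN.
have SN : ksin (- k) = ksin k.
  apply/funext => x; rewrite /ksin oppr_eq0; case: ifP => // _.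
  by rewrite mulNr sinN invrN mulrNN.
have aN f g : ampc (- k) f g = ampc k f g by apply/funext => x; rewrite /ampc CN SN.
have bN f g : amps (- k) f g = amps k f g.
  by apply/funext => x; rewrite /amps CN SN sqrrN.
have pN : pot q (- k) = pot q k by apply/funext => x; rewrite /pot sqrrN.
by rewrite /right_basis pN /asym_right !aN !bN.
Qed.

Lemma basis_indep k y z u v c d : right_basis q k y z u v ->
  (forall x, c * y x + d * u x = 0) -> c = 0 /\ d = 0.
Proof.
move=> [yz uv yA uA] cd; have [h1 h2] := asym_right_cvg (asym_right_lin c d yA uA).
have cz x : c * z x + d * v x = 0.
  have [+ _] := solves_lin c d yz uv x.
  rewrite (_ : (fun t => _) = fun=> 0); last by apply/funext.
  by move=> /drv_derive1 <-; rewrite derive1_cst.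
move: h1 h2; rewrite !mulr1 !mulr0 addr0 add0r => h1 h2; split.
  apply: (cvgr_unique _ h1); apply: cvg_ext (cvg_cst 0) => x.
  by rewrite /ampc cd cz; ring.
apply: (cvgr_unique _ h2); apply: cvg_ext (cvg_cst 0) => x.
by rewrite /amps cd cz; ring.
Qed.

(** For real [k] the Jost solutions are [f_- (k) = Y - i k U], [f_+ (k) = y + i k u]
    and [f_+ (- k) = y - i k u]; since [y] and [u] are independent, comparing coefficients
    determines [a_q (k)] and [b_q (k)]. *)
Lemma scatteringE k y z u v Y Z U V al be ga de : k != 0 ->
  right_basis q k y z u v -> left_basis q k Y Z U V ->
  (forall x, Y x = al * y x + ga * u x /\ U x = be * y x + de * u x) ->
  scattering q k = (((al + de) / 2) +i* ((ga / k - k * be) / 2),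
                    ((al - de) / 2) +i* (- (k * be + ga / k) / 2)).
Proof.
move=> k0 rb lb YU.
have kN : - k%:C = (- k)%:C :> R[i] by simpc.
have jN : jost_right q (- k%:C) = fun x => y x +i* (- k * u x).
  by rewrite kN; apply: jost_rightE (right_basisN rb).
rewrite /scattering (jost_leftE qc q_decay lb) jN (jost_rightE qc q_decay rb).
apply: xget_subset1 => /=.
  move=> x; have [-> ->] := YU x; simpc.
  by congr (_ +i* _); field.
move=> [[p s] [r t]] [[p' s'] [r' t']] /= e1 e2.
have e x : (p - p' + (r - r')) * y x + k * (s - s' - (t - t')) * u x = 0 /\
    (s - s' + (t - t')) * y x + k * (r - r' - (p - p')) * u x = 0.
  have := e1 x; rewrite e2; simpc => -[h1 h2]; split.
    by move/eqP: h1; rewrite -subr_eq0 => /eqP h1; rewrite -[RHS]oppr0 -h1; ring.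
  by move/eqP: h2; rewrite -subr_eq0 => /eqP h2; rewrite -[RHS]oppr0 -h2; ring.
have [a1 a2] := basis_indep rb (fun x => (e x).1).
have [a3 a4] := basis_indep rb (fun x => (e x).2).
move/eqP: a2; rewrite mulf_eq0 (negbTE k0) => /eqP a2.
move/eqP: a4; rewrite mulf_eq0 (negbTE k0) => /eqP a4.
by congr (_ +i* _, _ +i* _); lra.
Qed.

Section Limits.
Variables al be ga de : R -> R.
Hypotheses (fal : flat al) (fbe : flat be) (fga : flat ga) (fde : flat de).
Hypothesis det1 : forall k, al k * de k - be k * ga k = 1.
Hypothesis scE : forall k, k != 0 ->
  scattering q k = (((al k + de k) / 2) +i* ((ga k / k - k * be k) / 2),
                    ((al k - de k) / 2) +i* (- (k * be k + ga k / k) / 2)).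

(* [a_q (k) = p + i s], [b_q (k) = r + i t], [N = |a_q (k)| ^ 2] *)
Let p k := (al k + de k) / 2.
Let s k := (ga k / k - k * be k) / 2.
Let r k := (al k - de k) / 2.
Let t k := - (k * be k + ga k / k) / 2.
Let N k := p k ^+ 2 + s k ^+ 2.

Lemma unitarity k : k != 0 -> N k = 1 + (r k ^+ 2 + t k ^+ 2).
Proof. by move=> k0; rewrite -(det1 k) /N /p /s /r /t; field. Qed.

Lemma N_neq0 k : k != 0 -> N k != 0.
Proof.
move=> k0; rewrite gt_eqF// unitarity// ltr_pwDl// addr_ge0 ?sqr_ge0//.
Qed.

Lemma transmissionP c d : value_at_zero (transmission q) (c +i* d) <->
  p k / N k @[k --> 0^'] --> c /\ - s k / N k @[k --> 0^'] --> d.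
Proof.
rewrite (@value_at_zero_eq _ (fun k => (p k / N k) +i* (- s k / N k))).
  by split => [/cvgCP|] //= h; apply/cvgCP.
by move=> k k0; rewrite /transmission scE//= -/(p k) -/(s k); simpc; congr (_ +i* _); ring.
Qed.

Lemma reflectionP c d : value_at_zero (reflection q) (c +i* d) <->
  (r k * p k + t k * s k) / N k @[k --> 0^'] --> c /\
  (t k * p k - r k * s k) / N k @[k --> 0^'] --> d.
Proof.
rewrite (@value_at_zero_eq _ (fun k => ((r k * p k + t k * s k) / N k) +i*
    ((t k * p k - r k * s k) / N k))).
  by split => [/cvgCP|] //= h; apply/cvgCP.
move=> k k0; rewrite /reflection scE//= -/(p k) -/(s k) -/(r k) -/(t k).
by simpc; rewrite -/(N k); congr (_ +i* _); ring.
Qed.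

Lemma dnbhs_ext (f g : R -> R) (l : R) : (forall k, k != 0 -> f k = g k) ->
  f k @[k --> 0^'] --> l -> g k @[k --> 0^'] --> l.
Proof.
move=> FG; apply: cvg_trans; apply: near_eq_cvg; near=> k.
by rewrite FG//; near: k; exact: nbhs_dnbhs_neq.
Unshelve. all: by end_near. Qed.

Lemma p_cvg : p k @[k --> 0^'] --> (al 0 + de 0) / 2.
Proof. by apply: near0M; [apply: (@cvgD _ R^o); exact: flat_cvg|exact: cvg_cst]. Qed.

Lemma r_cvg : r k @[k --> 0^'] --> (al 0 - de 0) / 2.
Proof. by apply: near0M; [apply: (@cvgB _ R^o); exact: flat_cvg|exact: cvg_cst]. Qed.

Lemma kbe_cvg : k * be k @[k --> 0^'] --> (0 : R).
Proof. by have := near0M id_cvg0 (flat_cvg fbe); rewrite mul0r. Qed.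

Lemma cvgr_lin (f g : R -> R) a b c d : f k @[k --> (0 : R)^'] --> a ->
  g k @[k --> (0 : R)^'] --> b -> c * f k + d * g k @[k --> (0 : R)^'] --> c * a + d * b.
Proof.
move=> fa gb.
by apply: (@cvgD _ R^o); apply: near0M => //; exact: cvg_cst.
Qed.
Arguments cvgr_lin {f g a b} c d _ _.

(** A pole of the scattering coefficients at zero energy is excluded as soon as one
    of their imaginary parts tends to 0. *)
Lemma ga0_s : s k @[k --> 0^'] --> (0 : R) -> ga 0 = 0.
Proof.
move=> s0; have := cvgr_lin 2 1 (near0M id_cvg0 s0) (near0M id_cvg0 kbe_cvg).
rewrite !mul0r !mulr0 addr0 => h.
apply: (near0_unique (flat_cvg fga)); apply: dnbhs_ext h => k k0.
by rewrite /s; field.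
Qed.

Lemma ga0_t : t k @[k --> 0^'] --> (0 : R) -> ga 0 = 0.
Proof.
move=> t0; have := cvgr_lin (- 2) (-1) (near0M id_cvg0 t0) (near0M id_cvg0 kbe_cvg).
rewrite !mul0r !mulr0 addr0 => h.
apply: (near0_unique (flat_cvg fga)); apply: dnbhs_ext h => k k0.
by rewrite /t; field.
Qed.

(** If [1 / a] tends to 1 then so does [a]: there is no pole, and the diagonal entries
    have sum 2 and product 1. *)
Lemma transmission_one : value_at_zero (transmission q) 1 -> ga 0 = 0 /\ al 0 = 1.
Proof.
move=> /transmissionP[P1 Q0].
have N1 : N k @[k --> 0^'] --> (1 : R).
  have h : (p k / N k) * (p k / N k) + (- s k / N k) * (- s k / N k) @[k --> 0^'] --> (1 : R).
    rewrite -[X in _ --> X]addr0 -[X in _ --> X + _]mulr1 -[X in _ --> _ + X](mulr0 0).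
    by apply: (@cvgD _ R^o); apply: near0M.
  have := near0V (oner_neq0 R) h; rewrite invr1; apply: dnbhs_ext => k k0.
  have nN := N_neq0 k0.
  transitivity ((N k / (N k ^+ 2))^-1); last by field.
  by congr (_^-1); rewrite [X in _ = X / _]/N; field.
have p1 : p k @[k --> 0^'] --> (1 : R).
  have := near0M P1 N1; rewrite mulr1; apply: dnbhs_ext => k k0.
  by rewrite divfK// N_neq0.
have s0 : s k @[k --> 0^'] --> (0 : R).
  have := cvgr_lin (-1) 0 (near0M Q0 N1) N1; rewrite !mul0r mulr0 addr0.
  by apply: dnbhs_ext => k k0; have nN := N_neq0 k0; field.
have g0 := ga0_s s0; split=> //.
have := near0_unique p_cvg p1; have := det1 0; rewrite g0 mulr0 subr0.
move=> h1 h2; have h3 : de 0 = 2 - al 0 by lra.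
rewrite h3 in h1; apply/eqP; rewrite -subr_eq0 -sqrf_eq0; apply/eqP.
by rewrite (_ : _ ^+ 2 = 1 - al 0 * (2 - al 0)); [rewrite h1 subrr|ring].
Qed.

(** By unitarity [1 - |R| ^ 2 = 1 / |a| ^ 2], so [b = R a] tends to 0 with [R]: there is
    no pole, and the diagonal entries are equal with product 1. *)
Lemma reflection_zero : value_at_zero (reflection q) 0 ->
  ga 0 = 0 /\ (al 0 = 1 \/ al 0 = -1).
Proof.
move=> /reflectionP[P0 Q0].
have h : 1 - (N k)^-1 @[k --> 0^'] --> (0 : R).
  have := cvgr_lin 1 1 (near0M P0 P0) (near0M Q0 Q0); rewrite !mulr0 addr0.
  apply: dnbhs_ext => k k0; have nN := N_neq0 k0.
  transitivity ((r k ^+ 2 + t k ^+ 2) / N k).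
    transitivity ((r k ^+ 2 + t k ^+ 2) * N k / N k ^+ 2); last by field.
    by rewrite [X in _ = _ * X / _]/N; field.
  have -> : r k ^+ 2 + t k ^+ 2 = N k - 1 by rewrite unitarity//; ring.
  by field.
have N1 : N k @[k --> 0^'] --> (1 : R).
  have : (N k)^-1 @[k --> 0^'] --> (1 : R).
    have := cvgr_lin 1 (-1) (@near0_cst 1) h; rewrite !mulr1 mulr0 addr0.
    by apply: cvg_ext => k /=; ring.
  by move=> /(near0V (oner_neq0 R)); rewrite invr1; apply: cvg_ext => k; rewrite invrK.
have rt : r k ^+ 2 + t k ^+ 2 @[k --> 0^'] --> (0 : R).
  have := cvgr_lin (-1) 1 (@near0_cst 1) N1; rewrite !mulr1 addNr.
  by apply: dnbhs_ext => k k0 /=; rewrite unitarity//; ring.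
have r0 : r k @[k --> 0^'] --> (0 : R) by exact: sum_sqr_cvg0 rt.
have t0 : t k @[k --> 0^'] --> (0 : R).
  by apply: (@sum_sqr_cvg0 _ _ r); apply: cvg_ext rt => k; rewrite addrC.
have g0 := ga0_t t0; split=> //.
have := near0_unique r_cvg r0; have := det1 0; rewrite g0 mulr0 subr0.
move=> h1 h2; have h3 : de 0 = al 0 by lra.
rewrite h3 -expr2 in h1; move/eqP: h1; rewrite sqrf_eq1 => /orP[]/eqP; by [left|right].
Qed.

(** Flatness turns [ga 0 = 0] into [ga k / k] tending to 0, so [a] tends to 1 and [b]
    to 0. *)
Lemma scattering_exceptional : ga 0 = 0 -> al 0 = 1 ->
  value_at_zero (transmission q) 1 /\ value_at_zero (reflection q) 0.
Proof.
move=> g0 a0; have d0 : de 0 = 1 by have := det1 0; rewrite g0 a0; lra.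
have p1 : p k @[k --> 0^'] --> (1 : R).
  by have := p_cvg; rewrite a0 d0 (_ : (1 + 1) / 2 = 1 :> R)//; field.
have r0 : r k @[k --> 0^'] --> (0 : R) by have := r_cvg; rewrite a0 d0 subrr mul0r.
have gk := flat_div_cvg fga g0.
have s0 : s k @[k --> 0^'] --> (0 : R).
  have := cvgr_lin (2^-1) (- 2^-1) gk kbe_cvg; rewrite !mulr0 addr0.
  by apply: cvg_ext => k; rewrite /s; ring.
have t0 : t k @[k --> 0^'] --> (0 : R).
  have := cvgr_lin (- 2^-1) (- 2^-1) gk kbe_cvg; rewrite !mulr0 addr0.
  by apply: cvg_ext => k; rewrite /t; ring.
have N1 : N k @[k --> 0^'] --> (1 : R).
  have := cvgr_lin 1 1 (near0M p1 p1) (near0M s0 s0); rewrite !mulr0 !mulr1 addr0.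
  by apply: cvg_ext => k; rewrite /N; ring.
have iN : (N k)^-1 @[k --> 0^'] --> (1 : R).
  by have := near0V (oner_neq0 R) N1; rewrite invr1.
split.
  apply/transmissionP; split.
    by have := near0M p1 iN; rewrite mulr1.
  have := cvgr_lin (-1) 0 (near0M s0 iN) iN; rewrite !mul0r mulr0 addr0.
  by apply: cvg_ext => k; ring.
apply/reflectionP; split.
  have := near0M (cvgr_lin 1 1 (near0M r0 p1) (near0M t0 s0)) iN.
  rewrite !mul0r !mulr0 addr0 mul0r.
  by apply: cvg_ext => k; ring.
have := near0M (cvgr_lin 1 (-1) (near0M t0 p1) (near0M r0 s0)) iN.
rewrite !mul0r !mulr0 addr0 mul0r.
by apply: cvg_ext => k; ring.
Qed.

End Limits.
End Scattering.

(** * Schwartz functions *)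

Section SchwartzAlgebra.
Variable R : realType.
Implicit Types (f g : R -> R) (P Q S : (R -> R) -> Prop) (n m : nat) (x : R).

(** The recursion follows the derivative, which makes stability under products an
    induction without Leibniz formula. The last level still asks for
    differentiability: all the derivatives up to order [n + 1] exist. *)
Fixpoint Cn P n f : Prop :=
  [/\ P f, forall x, derivable f x 1 & if n is m.+1 then Cn P m (derive1 f) else True].

Lemma Cn_here P n f : Cn P n f -> P f.
Proof. by case: n => [|n] []. Qed.

Lemma Cn_drv P n f x : Cn P n f -> drv f x (derive1 f x).
Proof. by case: n => [|n] [_ fd _]; exact: derivable_drv. Qed.

Lemma Cn_derive1 P n f : Cn P n.+1 f -> Cn P n (derive1 f).
Proof. by case. Qed.

Lemma CnS P n f : Cn P n.+1 f -> Cn P n f.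
Proof.
elim: n f => [|n IH] f [Pf fd f'] //; split=> //.
exact: IH.
Qed.

Lemma Cn_intro P n f g : (forall x, drv f x (g x)) -> P f -> Cn P n g -> Cn P n.+1 f.
Proof.
move=> fg Pf gn; split=> // [x|]; first by case: (fg x).
by rewrite (_ : derive1 f = g)//; apply/funext => x; exact: drv_derive1.
Qed.

Lemma Cn_drvn P f n k : (forall m, Cn P m f) -> Cn P n (derive1n k f).
Proof.
move=> fm; elim: k n => [|k IH] n; first exact: fm.
by rewrite derive1nS; exact/Cn_derive1/IH.
Qed.

Lemma CnP P f : (forall n, Cn P n f) <->
  forall n, P (derive1n n f) /\ forall x, derivable (derive1n n f) x 1.
Proof.
split=> [fn n|].
  by have := Cn_drvn 0 n fn; case.
move=> H n; have : forall k, Cn P n (derive1n k f).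
  elim: n => [|n IH] k; first by have [? ?] := H k.
  by have [? ?] := H k; split=> //; rewrite -derive1nS.
by move=> /(_ 0%N).
Qed.

Lemma Cn_sub P Q n f : (forall g, P g -> Q g) -> Cn P n f -> Cn Q n f.
Proof.
move=> PQ; elim: n f => [|n IH] f [Pf fd f']; split=> //; try exact: PQ.
exact: IH.
Qed.

Lemma CnD P n f g : (forall f g, P f -> P g -> P (fun x => f x + g x)) ->
  Cn P n f -> Cn P n g -> Cn P n (fun x => f x + g x).
Proof.
move=> PD; elim: n f g => [|n IH] f g fn gn.
  split=> // [|x]; first by apply: PD; exact: Cn_here fn || exact: Cn_here gn.
  by have [] := drvD (Cn_drv x fn) (Cn_drv x gn).
apply: (@Cn_intro _ _ _ (fun x => derive1 f x + derive1 g x)).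
- by move=> x; exact: drvD (Cn_drv x fn) (Cn_drv x gn).
- by apply: PD; [exact: Cn_here fn|exact: Cn_here gn].
- exact: IH (Cn_derive1 fn) (Cn_derive1 gn).
Qed.

Lemma CnM P Q S n f g : (forall f g, P f -> Q g -> S (fun x => f x * g x)) ->
  (forall f g, S f -> S g -> S (fun x => f x + g x)) ->
  Cn P n f -> Cn Q n g -> Cn S n (fun x => f x * g x).
Proof.
move=> PQ SD; elim: n f g => [|n IH] f g fn gn.
  split=> // [|x]; first by apply: PQ; [exact: Cn_here fn|exact: Cn_here gn].
  by have [] := drvM (Cn_drv x fn) (Cn_drv x gn).
apply: (@Cn_intro _ _ _ (fun x => f x * derive1 g x + derive1 f x * g x)).
- by move=> x; have := drvM (Cn_drv x fn) (Cn_drv x gn); rewrite (mulrC (g x)).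
- by apply: PQ; [exact: Cn_here fn|exact: Cn_here gn].
- apply: CnD => //.
    exact: IH (CnS fn) (Cn_derive1 gn).
  exact: IH (Cn_derive1 fn) (CnS gn).
Qed.

Definition rapid f := forall n, exists C, forall x, `|f x| * (1 + x ^+ 2) ^+ n <= C.
Definition bdd f := exists C, forall x, `|f x| <= C.
Definition unrestricted f := True.

Lemma rapid_bdd f : rapid f -> bdd f.
Proof.
by move=> /(_ 0%N)[C CP]; exists C => x; have := CP x; rewrite expr0 mulr1.
Qed.

Lemma bddD f g : bdd f -> bdd g -> bdd (fun x => f x + g x).
Proof.
move=> [C CP] [D DP]; exists (C + D) => x.
by apply: le_trans (ler_normD _ _) _; rewrite lerD.
Qed.

Lemma bddM f g : bdd f -> bdd g -> bdd (fun x => f x * g x).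
Proof.
by move=> [C CP] [D DP]; exists (C * D) => x; rewrite normrM ler_pM.
Qed.

Lemma rapidD f g : rapid f -> rapid g -> rapid (fun x => f x + g x).
Proof.
move=> fr gr n; have [C CP] := fr n; have [D DP] := gr n; exists (C + D) => x.
apply: le_trans (ler_wpM2r _ (ler_normD _ _)) _.
  by rewrite exprn_ge0// ltW// jap_gt0.
by rewrite mulrDl lerD.
Qed.

Lemma rapidM f g : rapid f -> bdd g -> rapid (fun x => f x * g x).
Proof.
move=> fr [D DP] n; have [C CP] := fr n; exists (C * D) => x.
by rewrite normrM mulrAC ler_pM// mulr_ge0// exprn_ge0// ltW// jap_gt0.
Qed.

Lemma Cn_bddM n f g : Cn bdd n f -> Cn bdd n g -> Cn bdd n (fun x => f x * g x).
Proof. exact: (CnM bddM bddD). Qed.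

Lemma Cn_rapidM n f g : Cn rapid n f -> Cn bdd n g -> Cn rapid n (fun x => f x * g x).
Proof. exact: (CnM rapidM rapidD). Qed.

Lemma Cn_bddD n f g : Cn bdd n f -> Cn bdd n g -> Cn bdd n (fun x => f x + g x).
Proof. exact: (CnD bddD). Qed.

Lemma Cn_bdd_cst n (c : R) : Cn bdd n (fun=> c).
Proof.
have bc (d : R) : bdd (fun=> d) by exists `|d|.
elim: n c => [|n IH] c; first by split=> // x; exact: derivable_cst.
by apply: (@Cn_intro _ _ _ (fun=> 0)) => // x; exact: drv_cst.
Qed.

Lemma Cn_ext P n f g : f =1 g -> Cn P n f -> Cn P n g.
Proof. by move=> /funext ->. Qed.

Lemma Cn_rapid_bdd n f : Cn rapid n f -> Cn bdd n f.
Proof. by apply: Cn_sub; exact: rapid_bdd. Qed.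

Lemma rapidP f : rapid f <-> forall m, exists C, forall x, `|x| ^+ m * `|f x| <= C.
Proof.
split=> [fr m|H n].
  have [C CP] := fr m; exists C => x; apply: le_trans (CP x).
  rewrite mulrC ler_wpM2l// lerXn2r ?nnegrE ?norm_le_jap//.
  exact: ltW (jap_gt0 x).
elim: n f H => [|n IH] f H.
  by have [C CP] := H 0%N; exists C => x; have := CP x; rewrite !expr0 mulr1 mul1r.
have [|C CP] := IH (fun x => (1 + x ^+ 2) * f x).
  move=> m; have [C CP] := H m; have [D DP] := H m.+2; exists (C + D) => x.
  rewrite normrM gtr0_norm ?jap_gt0// mulrDl mul1r mulrDr lerD//.
  by rewrite mulrA -(@real_normK _ x) ?num_real// -exprD addn2.
exists C => x; apply: le_trans (CP x).
by rewrite normrM gtr0_norm ?jap_gt0// exprS mulrCA mulrA.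
Qed.

Lemma schwartzP f : schwartz f <-> forall n, Cn rapid n f.
Proof.
split=> [[fs fr]|/CnP H].
  apply/CnP => n; split; last exact: fs.
  by apply/rapidP => m; exact: fr.
split=> [n x|m n]; first exact: (H n).2.
by have [/rapidP/(_ m)] := H n.
Qed.

Lemma smoothP f : smooth f <-> forall n, Cn unrestricted n f.
Proof.
split=> [fs|/CnP H n x]; last exact: (H n).2.
by apply/CnP => n; split=> // x; exact: fs.
Qed.

(** By [decay] a primitive of a rapidly decreasing function differs from its limits
    by a rapidly decreasing function. *)
Lemma rapid_primitive f g : (forall x, drv f x (g x)) -> rapid g ->
  f x @[x --> +oo] --> (0 : R) -> f x @[x --> -oo] --> (0 : R) -> rapid f.
Proof.
move=> fg gr fp fm n.
have [K KP] := gr n.+2; have [l lP] := decay fg (fun x _ => KP x).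
have [l' lP'] := decayN fg (fun x _ => KP x).
have jn x : 1 + x ^+ 2 <= (1 + x ^+ 2) ^+ n.+1 by rewrite [leRHS]exprS ler_peMr ?exprn_ege1 ?jap_ge1// ltW// jap_gt0.
have l0 : l = 0.
  apply: cvgr_unique fp; apply: (@cvg_pinfty_jap _ _ _ K) => x x1.
  by apply: le_trans (lP x x1); rewrite ler_wpM2l.
have l'0 : l' = 0.
  apply: cvgr_unique fm; apply: (@cvg_ninfty_jap _ _ _ K) => x x1.
  by apply: le_trans (lP' x x1); rewrite ler_wpM2l.
rewrite l0 in lP; rewrite l'0 in lP'.
have fc : continuous f by exact: continuous_drv fg.
have [M M0 MP] := bounded_on 1 fc.
exists (K + M * 2 ^+ n) => x.
have K0 : 0 <= K by apply: le_trans (KP 0); rewrite mulr_ge0// exprn_ge0// ltW// jap_gt0.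
have M20 : 0 <= M * 2 ^+ n by rewrite mulr_ge0 ?exprn_ge0// ltW.
have jS : (1 + x ^+ 2) ^+ n <= (1 + x ^+ 2) ^+ n.+1 by rewrite [leRHS]exprS ler_peMl ?jap_ge1// exprn_ge0// ltW// jap_gt0.
have [x1|x1] := leP 1 x.
  apply: le_trans (_ : _ <= K) _; last by rewrite lerDl.
  by have := lP x x1; rewrite subr0; apply: le_trans; rewrite ler_wpM2l.
have [x1'|x1'] := leP x (-1).
  apply: le_trans (_ : _ <= K) _; last by rewrite lerDl.
  by have := lP' x x1'; rewrite subr0; apply: le_trans; rewrite ler_wpM2l.
have ax : `|x| <= 1 by rewrite ler_norml; lra.
apply: le_trans (_ : _ <= M * 2 ^+ n) _; last by rewrite lerDr.
rewrite ler_pM ?exprn_ge0 ?MP// ?(ltW (jap_gt0 x))//.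
rewrite lerXn2r ?nnegrE ?(ltW (jap_gt0 x))//.
by rewrite -(@real_normK _ x) ?num_real//; have := normr_ge0 x; nra.
Qed.

Lemma rapid_cvg0 f : rapid f ->
  f x @[x --> +oo] --> (0 : R) /\ f x @[x --> -oo] --> (0 : R).
Proof.
move=> /(_ 1%N)[C CP]; split.
  by apply: (@cvg_pinfty_jap _ _ _ C) => x _; have := CP x; rewrite subr0 expr1.
by apply: (@cvg_ninfty_jap _ _ _ C) => x _; have := CP x; rewrite subr0 expr1.
Qed.

(** Far out [f] lies between 1/2 and 3/2, and on the remaining segment both [f] and
    its inverse are continuous. *)
Lemma pos_inv_bdd f : continuous f -> (forall x, 0 < f x) ->
  f x @[x --> +oo] --> (1 : R) -> f x @[x --> -oo] --> (1 : R) ->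
  bdd f /\ bdd (fun x => (f x)^-1).
Proof.
move=> fc f0 /cvgrPdist_le fp /cvgrPdist_le fm.
have h0 : (0 : R) < 2^-1 by rewrite invr_gt0.
have /(fp)[X [_ XP]] := h0; have /(fm)[Y [_ YP]] := h0.
pose Z := `|X| + `|Y| + 1.
have far x : `|x| > Z -> `|1 - f x| <= 2^-1.
  move=> xZ; have := normr_ge0 X; have := normr_ge0 Y => Y0 X0.
  have := ler_norm X; have := ler_norm (- Y); rewrite normrN => Y1 X1.
  have [x0|x0] := leP 0 x.
    by apply: XP; rewrite ger0_norm// /Z in xZ; lra.
  by apply: YP; rewrite ltr0_norm// /Z in xZ; lra.
have [M M0 MP] := bounded_on Z fc.
have ic : continuous (fun x => (f x)^-1).
  by move=> x; apply: cvgV; [rewrite gt_eqF|exact: fc].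
have [N N0 NP] := bounded_on Z ic.
split; [exists (M + 2)|exists (N + 2)] => x; have [xZ|xZ] := leP `|x| Z.
- by apply: le_trans (MP x xZ) _; lra.
- by have := far x xZ; rewrite ler_norml (ger0_norm (ltW (f0 x))) => /andP[h1 h2]; lra.
- by apply: le_trans (NP x xZ) _; lra.
- have := far x xZ; rewrite ler_norml (ger0_norm (ltW _)) ?invr_gt0// => /andP[h1 h2].
  have : (f x)^-1 <= 2; last by lra.
  rewrite -[leRHS]invrK lef_pV2 ?posrE ?invr_gt0//; lra.
Qed.

(** The derivative [- f' / f ^ 2] is a product of [f'] with two copies of [1 / f], so
    the orders of differentiability are gained one at a time. *)
Lemma Cn_inv n f : (forall x, f x != 0) -> (forall m, Cn bdd m f) ->
  bdd (fun x => (f x)^-1) -> Cn bdd n (fun x => (f x)^-1).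
Proof.
move=> f0 fb ib.
have id x : drv (fun x => (f x)^-1) x (- derive1 f x * ((f x)^-1 * (f x)^-1)).
  apply: drv_eq (drvV (f0 x) (Cn_drv x (fb 0%N))) _.
  by rewrite expr2 invfM.
elim: n => [|n IH]; first by split=> // x; case: (id x).
apply: (Cn_intro id) => //; apply: Cn_bddM; last exact: Cn_bddM.
apply: (@Cn_ext _ _ (fun x => -1 * derive1 f x)) => [x|]; first by rewrite mulN1r.
by apply: Cn_bddM; [exact: Cn_bdd_cst|exact/Cn_derive1].
Qed.

Lemma schwartz_decay f : schwartz f -> continuous f /\
  exists kap, forall x, `|f x| * (1 + x ^+ 2) ^+ 4 <= kap.
Proof.
move=> /schwartzP fn; split; last exact: (Cn_here (fn 0%N)) 4%N.
by move=> x; exact: drv_continuous (Cn_drv x (fn 0%N)).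
Qed.

End SchwartzAlgebra.

Arguments rapid {R} f.
Arguments bdd {R} f.
Arguments unrestricted {R} f.

(** * Integrals over the line *)

Section Integrals.
Variable R : realType.
Implicit Types (u w f F U : R -> R) (a b x : R).
Local Notation mu := (@lebesgue_measure R).

Lemma integral_segment f F a b : a <= b -> continuous f ->
  (forall x, drv F x (f x)) ->
  (\int[mu]_(x in `[a, b]) (f x)%:E = (F b - F a)%:E)%E.
Proof.
move=> ab fc Fd; have [<-|aNb] := eqVneq a b.
  by rewrite set_itv1 integral_set1 subrr.
have Fc := continuous_drv Fd.
have ab' : a < b by rewrite lt_neqAle aNb.
rewrite (continuous_FTC2 ab' (F := F)) ?EFinB//.
- exact: continuous_subspaceT.
- split=> [x _||]; first by case: (Fd x).
  + by apply: cvg_at_right_filter; exact: Fc.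
  + by apply: cvg_at_left_filter; exact: Fc.
- by move=> x _; exact: drv_derive1.
Qed.

Lemma continuous_measurable f : continuous f -> measurable_fun setT f.
Proof. exact: continuous_measurable_fun. Qed.

Lemma ge0_integral_line u U a b : continuous u -> (forall x, 0 <= u x) ->
  (forall x, drv U x (u x)) -> U x @[x --> +oo] --> b -> U x @[x --> -oo] --> a ->
  (\int[mu]_x (u x)%:E = (b - a)%:E)%E.
Proof.
move=> uc u0 Ud Ub Ua.
pose v : R -> \bar R := EFin \o u.
pose I n : set R := `[- n%:R, n%:R]%classic.
have ndI : nondecreasing_seq I.
  move=> m n mn; apply/subsetPset => x; rewrite /I /= !in_itv /= => /andP[h1 h2].
  have mn' : m%:R <= n%:R :> R by rewrite ler_nat.
  by apply/andP; split; [apply: le_trans h1; rewrite lerN2|apply: le_trans h2 _].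
have bigI : \bigcup_n I n = setT.
  apply/seteqP; split=> // x _; exists (Num.bound `|x|) => //.
  rewrite /I /= in_itv /= -ler_norml; apply: ltW.
  exact: (@archi_boundP R `|x| (normr_ge0 x)).
have mI i : measurable (I i) by exact: measurable_itv.
have mu_f i : measurable_fun (I i) v.
  by apply/measurable_EFinP; apply: measurable_funTS; exact: continuous_measurable.
have u0' i x : I i x -> (0 <= v x)%E by move=> _; rewrite /v /= lee_fin.
have := ge0_nondecreasing_set_cvg_integral (mu := mu) ndI mI mu_f u0'.
rewrite bigI => h; apply: (cvg_unique _ h); first exact: ereal_hausdorff.
have -> : (fun i => \int[mu]_(x in I i) (u x)%:E)%E = (fun n => (U n%:R - U (- n%:R))%:E).
  by apply/funext => n; apply: integral_segment => //; rewrite lerNl -subr_ge0 opprK addr_ge0.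
apply: cvg_EFin; first by near=> n.
have Unb : U n%:R @[n --> \oo] --> b by apply: (cvg_comp _ _ _ Ub); exact: cvgr_idn.
move/cvgNy_compNP: Ua => Ua.
have Una : U (- n%:R) @[n --> \oo] --> a by apply: (cvg_comp _ _ _ Ua); exact: cvgr_idn.
exact: (@cvgB _ R^o _ _ _ _ _ _ _ Unb Una).
Unshelve. all: by end_near. Qed.

Lemma bounded_primitive_cvg u U M : (forall x, 0 <= u x) -> (forall x, drv U x (u x)) ->
  (forall x, `|U x| <= M) ->
  exists a b, U x @[x --> +oo] --> b /\ U x @[x --> -oo] --> a.
Proof.
move=> u0 Ud UM.
have nd (V v : R -> R) : (forall x, 0 <= v x) -> (forall x, drv V x (v x)) ->
    (forall x, `|V x| <= M) -> exists b, V x @[x --> +oo] --> b.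
  move=> v0 Vd VM; exists (sup (range V)); apply: nondecreasing_cvgr.
    by move=> x y xy; exact: drv_ge0_le xy Vd _.
  by exists M => _ [x _ <-]; exact: le_trans (ler_norm _) (VM x).
have [b Ub] := nd U u u0 Ud UM.
have [|||c Uc] := nd (fun x => - U (- x)) (fun x => u (- x)).
- by move=> x.
- by move=> x; apply: drv_eq (drvN (drv_refl (Ud (- x)))) (opprK _).
- by move=> x; rewrite normrN.
exists (- c), b; split=> //; apply/cvgNy_compNP.
have : - - U (- x) @[x --> +oo] --> - c by apply: (@cvgN _ R^o).
by apply: cvg_ext => x /=; rewrite opprK.
Qed.

Lemma ge0_integrable_line u : continuous u -> (forall x, 0 <= u x) ->
  (\int[mu]_x (u x)%:E < +oo)%E -> mu.-integrable setT (EFin \o u).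
Proof.
move=> uc u0 uy; apply/integrableP; split.
  by apply/measurable_EFinP; exact: continuous_measurable.
have -> : (fun x => `|(EFin \o u) x|)%E = (fun x => (u x)%:E) => //.
by apply/funext => x /=; rewrite ger0_norm.
Qed.

Lemma integrable_bounded_primitive u U M : continuous u -> (forall x, 0 <= u x) ->
  (forall x, drv U x (u x)) -> (forall x, `|U x| <= M) ->
  mu.-integrable setT (EFin \o u).
Proof.
move=> uc u0 Ud UM; have [a [b [Ub Ua]]] := bounded_primitive_cvg u0 Ud UM.
by apply: ge0_integrable_line; rewrite ?(ge0_integral_line uc u0 Ud Ub Ua) ?ltry.
Qed.

Lemma continuous_jap_inv (C : R) : continuous (fun x => C / (1 + x ^+ 2)).
Proof.
have jd x : drv (fun x => C / (1 + x ^+ 2)) x (- (C * (2 * x)) / (1 + x ^+ 2) ^+ 2).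
  have j0 : 1 + x ^+ 2 != 0 by rewrite gt_eqF// jap_gt0.
  by drv => //; field.
exact: continuous_drv jd.
Qed.

(** For nonnegative functions this is monotone convergence over growing segments; adding
    [C / (1 + x ^ 2)], a derivative as well, reduces the general case to that one. *)
Lemma Rintegral_line w F (C a b : R) : continuous w ->
  (forall x, `|w x| * (1 + x ^+ 2) <= C) ->
  (forall x, drv F x (w x)) -> F x @[x --> +oo] --> b -> F x @[x --> -oo] --> a ->
  (\int[mu]_x w x)%R = b - a.
Proof.
move=> wc wC Fd Fb Fa.
have C0 : 0 <= C by apply: le_trans (wC 0); rewrite mulr_ge0// ltW// jap_gt0.
pose v x := C / (1 + x ^+ 2); pose u x := w x + v x.
have v0 x : 0 <= v x by rewrite divr_ge0// ltW// jap_gt0.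
have u0 x : 0 <= u x.
  have := wC x; rewrite -ler_pdivlMr ?jap_gt0// -/(v x) ler_norml => /andP[].
  by rewrite /u; lra.
have vd := hat_drv C.
have hM x : `|hat C x| <= C * 2.
  by have := hat_le x C0; rewrite {2}/hat atan0 mulr0 subr0.
have vc : continuous v := @continuous_jap_inv C.
have uc : continuous u by move=> x; apply: (@cvgD _ R^o); [exact: wc|exact: vc].
have [a' [b' [vb va]]] := bounded_primitive_cvg v0 vd hM.
have iv := ge0_integral_line vc v0 vd vb va.
have ud x : drv (fun x => F x + hat C x) x (u x) := drvD (Fd x) (vd x).
have ub : F x + hat C x @[x --> +oo] --> b + b' by apply: (@cvgD _ R^o).
have ua : F x + hat C x @[x --> -oo] --> a + a' by apply: (@cvgD _ R^o).
have iu := ge0_integral_line uc u0 ud ub ua.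
have Iu : mu.-integrable setT (EFin \o u) by apply: ge0_integrable_line => //; rewrite iu ltry.
have Iv : mu.-integrable setT (EFin \o v) by apply: ge0_integrable_line => //; rewrite iv ltry.
have -> : w = (fun x => u x - v x) by apply/funext => x; rewrite /u addrK.
rewrite RintegralB//= /Rintegral iu iv /=; ring.
Qed.

End Integrals.

(** * Zero-energy ground states *)

Section GroundState.
Variable R : realType.
Implicit Types (phi w y z : R -> R) (x : R).

Variable q : R -> R.
Hypothesis hq : schwartz q.

(** The existence of such a solution is the common content of the Bers map, Riccati
    and scattering conditions. *)
Definition ground_state y z := [/\ solves (pot q 0) y z, forall x, 0 < y x,
  y x @[x --> +oo] --> (1 : R) & y x @[x --> -oo] --> (1 : R)].

Lemma pot0 : pot q 0 = q.
Proof. by apply/funext => x; rewrite /pot expr0n addr0. Qed.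

Lemma ground_state_unique y z u v : ground_state y z -> ground_state u v ->
  y = u /\ z = v.
Proof.
move=> [yz _ yp _] [uv _ up _]; have [qc [kap q_decay]] := schwartz_decay hq.
have d0 : y x - u x @[x --> +oo] --> (0 : R).
  by rewrite -(subrr 1); apply: (@cvgB _ R^o _ _ _ y u).
have yu : y = u.
  apply/funext => x; apply/eqP; rewrite -subr_eq0; apply/eqP.
  have := vanish_right qc q_decay (solves_lin 1 (-1) yz uv) _ x.
  rewrite !mul1r mulN1r; apply; apply: cvg_ext d0 => t; ring.
split=> //; apply/funext => x.
by rewrite -(drv_derive1 (yz x).1) yu; exact: drv_derive1 (uv x).1.
Qed.

(** A bounded solution has no linear growth, so its second amplitude is 0 at both
    ends. *)
Lemma ground_state_asym y z : ground_state y z ->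
  asym_right 0 y z 1 0 /\ asym_left 0 y z 1 0.
Proof.
move=> [yz _ yp ym]; have [qc [kap q_decay]] := schwartz_decay hq.
have [[a [b ab]] [c [d cd]]] := asym_exists q_decay yz.
split.
  have [a1 b0] : 1 - a = 0 /\ - b = 0; last first.
    have ea : a = 1 by lra.
    have eb : b = 0 by lra.
    by rewrite ea eb in ab.
  apply: (@free_vanish _ 0).
  have h : y x - (a * kcos 0 x + b * ksin 0 x) - (y x - 1) @[x --> +oo] --> (0 : R).
    apply: cvg0B; first exact: asym_right_sub ab.
    by rewrite -(subrr 1); apply: (@cvgB _ R^o _ _ _ y (cst 1)) => //; exact: cvg_cst.
  by apply: cvg_ext h => x; rewrite kcos_0; ring.
have [c1 d0] : 1 - c = 0 /\ d = 0; last first.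
  have ec : c = 1 by lra.
  by rewrite ec d0 in cd.
apply: (@free_vanish _ 0).
have h : y x - (c * kcos 0 x + d * ksin 0 x) - (y x - 1) @[x --> -oo] --> (0 : R).
  apply: cvg0B; first exact: asym_left_sub cd.
  by rewrite -(subrr 1); apply: (@cvgB _ R^o _ _ _ y (cst 1)) => //; exact: cvg_cst.
by move/cvgNy_compNP: h; apply: cvg_ext => x /=; rewrite !kcos_0 !ksin_0; ring.
Qed.

(** The slope [z] tends to 0 at both ends and has the rapidly decreasing derivative
    [- q y]; hence [z], then [y - 1], are rapidly decreasing, and the equation carries
    this over to all derivatives. *)
Lemma ground_state_schwartz y z : ground_state y z ->
  [/\ forall n, Cn rapid n (fun x => y x - 1), forall n, Cn bdd n y,
      forall n, Cn rapid n z & forall n, Cn bdd n (fun x => (y x)^-1)].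
Proof.
move=> gs; have [yz y0 yp ym] := gs; have [asr asl] := ground_state_asym gs.
move: yz; rewrite pot0 => yz.
have qn := (schwartzP q).1 hq.
have yd x := (yz x).1; have zd x := (yz x).2.
have yc : continuous y := continuous_drv yd.
have [yb iyb] := pos_inv_bdd yc y0 yp ym.
have zE : amps 0 y z = z.
  by apply/funext => x; rewrite /amps kcos_0; ring.
have zp : z x @[x --> +oo] --> (0 : R) by have [_] := asym_right_cvg asr; rewrite zE.
have zm : z x @[x --> -oo] --> (0 : R) by have [_] := asym_left_cvg asl; rewrite zE.
have qyE : (fun x => -1 * q x * y x) = (fun x => - q x * y x) by apply/funext => x; rewrite mulN1r.
have Cq n : Cn rapid n (fun x => -1 * q x).
  apply: (Cn_ext (fun x => mulrC (q x) (-1))).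
  by apply: Cn_rapidM => //; exact: Cn_bdd_cst.
have zr : rapid z.
  apply: rapid_primitive zd _ zp zm.
  by rewrite -qyE; apply: rapidM => //; exact: Cn_here (Cq 0%N).
have Cyz n : Cn bdd n y /\ Cn rapid n z.
  elim: n => [|n [IHy IHz]].
    by split; split=> // x; [case: (yd x)|case: (zd x)].
  split; first by apply: (Cn_intro yd) => //; exact: Cn_rapid_bdd.
  by apply: (Cn_intro zd) => //; rewrite -qyE; exact: Cn_rapidM.
have y1d x : drv (fun x => y x - 1) x (z x) by drv; exact: subr0.
have y1p : y x - 1 @[x --> +oo] --> (0 : R).
  by rewrite -(subrr 1); apply: (@cvgB _ R^o _ _ _ y (cst 1)) => //; exact: cvg_cst.
have y1m : y x - 1 @[x --> -oo] --> (0 : R).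
  by rewrite -(subrr 1); apply: (@cvgB _ R^o _ _ _ y (cst 1)) => //; exact: cvg_cst.
have y1r : rapid (fun x => y x - 1) by exact: rapid_primitive y1d zr y1p y1m.
split=> n.
- by apply: (@CnS _ _ n); apply: (Cn_intro y1d) => //; exact: (Cyz n).2.
- exact: (Cyz n).1.
- exact: (Cyz n).2.
- apply: Cn_inv iyb => [x|m]; first by rewrite gt_eqF.
  exact: (Cyz m).1.
Qed.

Lemma cvgDcst (F : set_system R) {FF : Filter F} (f : R -> R) (l c : R) :
  f x @[x --> F] --> l -> f x + c @[x --> F] --> l + c.
Proof.
by move=> fl; apply: (@cvgD _ R^o _ _ _ f (cst c)) => //; exact: cvg_cst.
Qed.
Arguments cvgDcst {F FF f l} c _.

Lemma asym_right_cvg1 y z : asym_right 0 y z 1 0 -> y x @[x --> +oo] --> (1 : R).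
Proof.
move=> ya; have h0 : y x - 1 @[x --> +oo] --> (0 : R).
  by apply: cvg_ext (asym_right_sub ya) => x; rewrite kcos_0; ring.
have h1 : y x - 1 + 1 @[x --> +oo] --> (0 + 1 : R) by exact: cvgDcst.
by rewrite add0r in h1; apply: cvg_ext h1 => x; rewrite subrK.
Qed.

Lemma asym_left_cvg1 y z : asym_left 0 y z 1 0 -> y x @[x --> -oo] --> (1 : R).
Proof.
move=> ya; have h0 : y x - 1 @[x --> -oo] --> (0 : R).
  by apply: cvg_ext (asym_left_sub ya) => x; rewrite kcos_0; ring.
have h1 : y x - 1 + 1 @[x --> -oo] --> (0 + 1 : R) by exact: cvgDcst.
by rewrite add0r in h1; apply: cvg_ext h1 => x; rewrite subrK.
Qed.

Lemma cvg_expR0 (F : set_system R) (f : R -> R) : Filter F ->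
  f x @[x --> F] --> (0 : R) -> expR (f x) @[x --> F] --> (1 : R).
Proof.
move=> FF f0; rewrite -expR0; apply: (cvg_comp _ _ f0); exact: continuous_expR.
Qed.

Lemma cvg_ln1 (F : set_system R) (f : R -> R) : Filter F ->
  f x @[x --> F] --> (1 : R) -> ln (f x) @[x --> F] --> (0 : R).
Proof.
move=> FF f1; rewrite -ln1; apply: (cvg_comp _ _ f1); exact: continuous_ln.
Qed.

(** The square root of the derivative solves the Schrodinger equation whose
    potential is half of the Schwarzian. *)
Lemma derivative_ground d1 d2 d3 : (forall x, 0 < d1 x) ->
  (forall x, drv d1 x (d2 x)) -> (forall x, drv d2 x (d3 x)) ->
  d1 x @[x --> +oo] --> (1 : R) -> d1 x @[x --> -oo] --> (1 : R) ->
  (forall x, q x = 2^-1 * (d3 x / d1 x - 3 / 2 * (d2 x / d1 x) ^+ 2)) ->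
  exists y z, ground_state y z /\ forall x, d1 x = (y x) ^- 2.
Proof.
move=> d1p d1d d2d d1c d1c' qE; have d10 x : d1 x != 0 by rewrite gt_eqF.
pose y x := expR (- 2^-1 * ln (d1 x)); pose z x := - 2^-1 * (d2 x / d1 x) * y x.
have yd x : drv y x (z x).
  have ? := d1p x.
  by rewrite /y; drv; [by []|rewrite /z /y; ring].
have zd x : drv z x (- pot q 0 x * y x).
  have ? := d10 x.
  rewrite pot0 qE {1}/z; drv; first by [].
  by rewrite /z; field.
have lim (F : set_system R) : Filter F -> d1 x @[x --> F] --> (1 : R) -> y x @[x --> F] --> (1 : R).
  move=> FF h; apply: cvg_expR0; rewrite -(mulr0 (- 2^-1)).
  by apply: cvgM; [exact: cvg_cst|exact: cvg_ln1].
exists y, z; split.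
  by split=> [x|x||]; [split|exact: expR_gt0|exact: lim|exact: lim].
move=> x; rewrite /y expr2 -expRD -expRN.
have -> : - (- 2^-1 * ln (d1 x) + - 2^-1 * ln (d1 x)) = ln (d1 x) by field.
by rewrite lnK// posrE.
Qed.

Lemma diff_schwartz_ground phi : diff_schwartz phi -> q = bers phi ->
  exists y z, ground_state y z /\ forall x, derive1 phi x = (y x) ^- 2.
Proof.
move=> [_ phi0 /schwartzP sn _] qE.
pose s x := derive1 phi x - 1.
pose d1 := derive1 phi; pose d2 := derive1 s; pose d3 := derive1 d2.
have d1d x : drv d1 x (d2 x).
  apply: (@drv_ext _ (fun x => s x + 1)) => [t|]; first by rewrite /s subrK.
  by have sd := Cn_drv x (sn 0%N); drv; exact: addr0.
have d2d x : drv d2 x (d3 x) by exact: Cn_drv x (Cn_derive1 (sn 1%N)).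
have e2 : derive1n 2 phi = d2.
  by rewrite derive1nS derive1n1; apply/funext => x; exact: drv_derive1.
have e3 : derive1n 3 phi = d3 by rewrite derive1nS e2.
have [s0 sm] := rapid_cvg0 (Cn_here (sn 0%N)).
have d1p : d1 x @[x --> +oo] --> (1 : R).
  rewrite -[X in _ --> X]add0r; apply: cvg_ext (cvgDcst 1 s0) => x.
  by rewrite /s subrK.
have d1m : d1 x @[x --> -oo] --> (1 : R).
  rewrite -[X in _ --> X]add0r; apply: cvg_ext (cvgDcst 1 sm) => x.
  by rewrite /s subrK.
apply: (derivative_ground phi0 d1d d2d d1p d1m) => x.
by rewrite {1}qE /bers /schwarzian e2 e3.
Qed.

(** [y] is the exponential of minus the primitive of [w], which linearizes the Riccati
    equation; that it has the same limit at both ends is the vanishing of the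
    integral of [w]. *)
Lemma riccati_ground w : schwartz0 w -> q = (fun x => derive1 w x - w x ^+ 2) ->
  exists y z, ground_state y z /\ forall x, z x = - w x * y x.
Proof.
move=> [/schwartzP wn w0] qE.
have wc : continuous w by move=> x; exact: drv_continuous (Cn_drv x (wn 0%N)).
have [_ Fd] := primP wc; set F := prim w in Fd.
have wr := Cn_here (wn 0%N).
have [C CP] := wr 1%N; have [K KP] := wr 2%N.
have [l lP] := decay Fd (fun x _ => KP x); have [m mP] := decayN Fd (fun x _ => KP x).
have Fl : F x @[x --> +oo] --> l by apply: (@cvg_pinfty_jap _ _ _ K) => x /lP; rewrite expr1.
have Fm : F x @[x --> -oo] --> m by apply: (@cvg_ninfty_jap _ _ _ K) => x /mP; rewrite expr1.
have lm : l - m = 0.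
  rewrite -w0; apply/esym; apply: (@Rintegral_line _ w F C _ _ wc _ Fd Fl Fm) => x.
  by have := CP x; rewrite expr1.
have ml : m = l by apply/esym/eqP; rewrite -subr_eq0 lm.
rewrite ml in Fm.
pose y x := expR (l - F x); pose z x := - w x * y x.
have yd x : drv y x (z x) by rewrite /y; drv; rewrite /z /y; ring.
have zd x : drv z x (- pot q 0 x * y x).
  have wd := Cn_drv x (wn 0%N).
  by rewrite pot0 qE {1}/z; drv; rewrite /z; ring.
have lim (G : set_system R) : Filter G -> F x @[x --> G] --> l -> y x @[x --> G] --> (1 : R).
  move=> FF h; apply: cvg_expR0; rewrite -(subrr l).
  by apply: (@cvgB _ R^o _ _ _ (cst l) F) => //; exact: cvg_cst.
exists y, z; split=> //.
by split=> [x|x||]; [split|exact: expR_gt0|exact: lim|exact: lim].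
Qed.

Lemma ground_riccati y z : ground_state y z ->
  schwartz0 (fun x => - (z x / y x)) /\
  q = (fun x => derive1 (fun x => - (z x / y x)) x - (- (z x / y x)) ^+ 2).
Proof.
move=> gs; have [yz y0 yp ym] := gs; have [_ _ Cz Ci] := ground_state_schwartz gs.
move: yz; rewrite pot0 => yz.
have yd x := (yz x).1; have zd x := (yz x).2.
have yN0 x : y x != 0 by rewrite gt_eqF.
pose w x := - (z x / y x); rewrite -/w.
have wn n : Cn rapid n w.
  apply: (@Cn_ext _ _ _ (fun x => z x * (y x)^-1 * -1)) => [x|].
    by rewrite mulrN1.
  apply: Cn_rapidM; last exact: Cn_bdd_cst.
  exact: Cn_rapidM.
have wd x : drv w x (q x + w x ^+ 2).
  by have := yN0 x => ?; rewrite {1}/w; drv => //; rewrite /w; field.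
split; last by apply/funext => x; rewrite (drv_derive1 (wd x)) addrK.
split; first exact/schwartzP.
have Fd x : drv (fun x => - ln (y x)) x (w x) by drv => //.
have [C CP] := Cn_here (wn 0%N) 1%N.
rewrite -(subrr 0); apply: (@Rintegral_line _ w (fun x => - ln (y x)) C) => //.
- by move=> x; exact: drv_continuous (wd x).
- by rewrite -oppr0; apply: (@cvgN _ R^o); exact: cvg_ln1.
- by rewrite -oppr0; apply: (@cvgN _ R^o); exact: cvg_ln1.
Qed.

End GroundState.

(** * The diffeomorphism of a ground state *)

Section Diffeomorphism.
Variable R : realType.
Implicit Types (phi psi : R -> R) (x : R).

Lemma bounded_displacement_surjective phi (M : R) : continuous phi ->
  (forall x, `|phi x - x| <= M) -> forall y, exists x, phi x = y.
Proof.
move=> phic phiM y; have M0 : 0 <= M by apply: le_trans (phiM 0).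
have yy : y - M <= y + M by lra.
have [||x _ xy] := @IVT _ phi _ _ y yy; last by exists x.
  exact: continuous_subspaceT.
have := phiM (y - M); have := phiM (y + M); rewrite !ler_norml => /andP[h1 _] /andP[_ h2].
by rewrite ge_min le_max; apply/andP; split; apply/orP; [left|right]; lra.
Qed.

Lemma inverse_drv phi psi (dphi : R -> R) : (forall x, drv phi x (dphi x)) ->
  (forall x, dphi x != 0) -> cancel phi psi -> cancel psi phi ->
  forall y, drv psi y (dphi (psi y))^-1.
Proof.
move=> pd p0 pK Kp y; rewrite -{1}(Kp y).
apply: (@is_derive_inverse _ phi).
- by near=> t; exact: pK.
- by near=> t; exact: drv_continuous (pd t).
- exact: pd.
- exact: p0.
Unshelve. all: by end_near. Qed.

(** The inverse satisfies [psi' = g o psi], hence [(f o psi)' = (f' g) o psi] for all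
    smooth [f]: smoothness follows by induction, for all such compositions at
    once. *)
Lemma smooth_inverse phi psi (g : R -> R) : (forall x, drv phi x ((g x)^-1)) ->
  (forall x, g x != 0) -> smooth g -> cancel phi psi -> cancel psi phi -> smooth psi.
Proof.
move=> pd g0 /smoothP gs pK Kp.
have sd y : drv psi y (g (psi y)).
  have gi0 x : (g x)^-1 != 0 by rewrite invr_eq0.
  by have := inverse_drv pd gi0 pK Kp y; rewrite invrK.
have U n (f h : R -> R) : Cn unrestricted n f -> Cn unrestricted n h ->
    Cn unrestricted n (fun x => f x * h x) by apply: CnM.
have Cc n (f : R -> R) : (forall m, Cn unrestricted m f) -> Cn unrestricted n (fun y => f (psi y)).
  elim: n f => [|n IH] f fm.
    split=> // y; by have [] := drv_comp (Cn_drv (psi y) (fm 0%N)) (sd y).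
  apply: (@Cn_intro _ _ _ _ (fun y => derive1 f (psi y) * g (psi y))) => [y||] //.
    exact: drv_comp (Cn_drv (psi y) (fm 0%N)) (sd y).
  apply: (IH (fun x => derive1 f x * g x)) => m.
  by apply: U => //; exact/Cn_derive1.
apply/smoothP => n; apply: (@CnS _ _ n); apply: (Cn_intro sd) => //.
exact: Cc.
Qed.

Variable q : R -> R.
Hypothesis hq : schwartz q.

(** The diffeomorphism is the primitive of [y ^- 2] normalized at [-oo]; it stays at
    bounded distance from the identity, so it is onto. *)
Lemma ground_diff y z : ground_state q y z ->
  exists phi, diff_schwartz phi /\ q = bers phi.
Proof.
move=> gs; have [yz y0 yp ym] := gs; have [C1 Cy Cz Ci] := ground_state_schwartz hq gs.
move: yz; rewrite pot0 => yz.
have yd x := (yz x).1; have zd x := (yz x).2.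
have yN0 x : y x != 0 by rewrite gt_eqF.
pose s x := (y x)^-1 * (y x)^-1 - 1.
have sn n : Cn rapid n s.
  apply: (@Cn_ext _ _ _ (fun x => (y x - 1) * ((y x + 1) * ((y x)^-1 * ((y x)^-1 * -1))))) => [x|].
    by have ? := yN0 x; rewrite /s; field.
  apply: Cn_rapidM => //; apply: Cn_bddM; first by apply: Cn_bddD => //; exact: Cn_bdd_cst.
  by do 2! [apply: Cn_bddM => //]; exact: Cn_bdd_cst.
have sc : continuous s by move=> x; exact: drv_continuous (Cn_drv x (sn 0%N)).
have [F0 Fd] := primP sc; set F := prim s in F0 Fd.
have sr := Cn_here (sn 0%N).
have [K KP] := sr 2%N; have [m mP] := decayN Fd (fun x _ => KP x).
have Fm : F x @[x --> -oo] --> m by apply: (@cvg_ninfty_jap _ _ _ K) => x /mP; rewrite expr1.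
pose phi x := x + (F x - m).
have pd x : drv phi x ((y x)^-1 * (y x)^-1).
  by rewrite /phi; drv; rewrite /s; ring.
have p1 : derive1 phi = fun x => (y x)^-1 * (y x)^-1.
  by apply/funext => x; exact: drv_derive1.
have gp x : 0 < (y x)^-1 * (y x)^-1 by rewrite mulr_gt0// invr_gt0.
have phic : continuous phi by exact: continuous_drv pd.
have [C CP] := sr 1%N.
have C0 : 0 <= C by apply: le_trans (CP 0); rewrite mulr_ge0// exprn_ge0// ltW// jap_gt0.
have FC x : `|F x| <= C * 2.
  have [x0 xx] := ball_norm x.
  have h0 : hat C (0 : R) = 0 by rewrite /hat atan0 mulr0.
  apply: le_trans (drv_norm_le x0 xx Fd (hat_drv C) F0 h0 _) _.
    by move=> t _; rewrite ler_pdivlMr ?jap_gt0//; have := CP t; rewrite expr1.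
  by have := hat_le x C0; rewrite h0 subr0.
have pM x : `|phi x - x| <= C * 2 + `|m|.
  rewrite /phi addrC addKr; apply: le_trans (ler_normB _ _) _.
  by rewrite lerD.
have inc a b : a < b -> phi a < phi b.
  move=> ab; have fc : {within `[a, b], continuous phi} by exact: continuous_subspaceT.
  have [c _ e] := MVT ab (fun x _ => pd x) fc.
  by rewrite -subr_gt0 e mulr_gt0// subr_gt0.
have [psi psiP] := choice (bounded_displacement_surjective phic pM).
have pinj : injective phi.
  by move=> a b e; case: (ltgtP a b) => // /inc; rewrite e ltxx.
have Kp : cancel psi phi by exact: psiP.
have pK : cancel phi psi by move=> x; apply: pinj; exact: psiP.
have Cg n : Cn bdd n (fun x => (y x)^-1 * (y x)^-1) by exact: Cn_bddM.
have un n f : Cn bdd n f -> Cn unrestricted n f by apply: Cn_sub.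
exists phi; split.
  split.
  - exists psi; split=> //.
      apply/smoothP => n; apply: (@CnS _ _ n); apply: (Cn_intro pd) => //.
      exact: un.
    apply: (smooth_inverse (g := fun x => y x * y x) _ _ _ pK Kp).
    + by move=> x; apply: drv_eq (pd x) _; rewrite invfM.
    + by move=> x; rewrite mulf_neq0.
    + by apply/smoothP => n; apply: un; exact: Cn_bddM.
  - by move=> x; rewrite p1.
  - by rewrite p1; exact/schwartzP.
  - have h : F x - m @[x --> -oo] --> m - m by exact: cvgDcst.
    rewrite subrr in h; apply: cvg_ext h => x.
    by rewrite /phi; ring.
pose d2 x := - 2 * z x * ((y x)^-1 ^+ 3).
pose d3 x := 2 * q x * (y x)^-1 ^+ 2 + 6 * z x ^+ 2 * (y x)^-1 ^+ 4.
have d1d x : drv (fun x => (y x)^-1 * (y x)^-1) x (d2 x).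
  by have ? := yN0 x; drv => //; rewrite /d2; field.
have d2d x : drv d2 x (d3 x).
  by have ? := yN0 x; rewrite /d2; drv => //; rewrite /d3; field.
have e2 : derive1n 2 phi = d2.
  by rewrite derive1nS derive1n1 p1; apply/funext => x; exact: drv_derive1.
have e3 : derive1n 3 phi = d3.
  by rewrite derive1nS e2; apply/funext => x; exact: drv_derive1.
apply/funext => x; rewrite /bers /schwarzian e2 e3 p1 /d2 /d3.
by have ? := yN0 x; field.
Qed.

End Diffeomorphism.

(** * A ground state excludes negative eigenvalues *)

Section NoNegativeEigenvalue.
Variable R : realType.
Implicit Types (v e E g : R -> R) (x a b c : R).
Local Notation mu := (@lebesgue_measure R).

Lemma integrable_primitive_bounded e E : continuous e -> (forall x, 0 <= e x) ->
  (forall x, drv E x (e x)) -> mu.-integrable setT (EFin \o e) ->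
  exists M, forall a b, a <= b -> E b - E a <= M.
Proof.
move=> ec e0 Ed ie; exists (fine (\int[mu]_x (e x)%:E)%E) => a b ab.
have fi : (\int[mu]_x (e x)%:E)%E \is a fin_num by apply: integrable_fin_num.
rewrite -lee_fin fineK// -(integral_segment ab ec Ed).
apply: ge0_subset_integral => //.
- by apply/measurable_EFinP; exact: continuous_measurable.
- by move=> x _; rewrite lee_fin.
Qed.

Variables (q y z : R -> R).
Hypothesis hq : schwartz q.
Hypothesis gs : ground_state q y z.

(** The function [P = v v' - v ^ 2 y' / y] has derivative
    [(v' - v y' / y) ^ 2 - lambda v ^ 2], because the operator factors through its ground
    state. So [P] is nondecreasing; being dominated by [v ^ 2 + v' ^ 2] it is integrable,
    hence 0, and so is its derivative. *)
Lemma ground_state_L2 lambda v dv : lambda < 0 ->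
  solves (fun x => q x + lambda) v dv ->
  mu.-integrable setT (EFin \o (fun x => v x ^+ 2)) ->
  mu.-integrable setT (EFin \o (fun x => dv x ^+ 2)) -> forall x, v x = 0.
Proof.
move=> l0 vdv iv idv; have [yz y0 _ _] := gs.
have [_ _ Cz Ci] := ground_state_schwartz hq gs.
move: yz; rewrite pot0 => yz.
have yN0 x : y x != 0 by rewrite gt_eqF.
have vd x := (vdv x).1; have dvd x := (vdv x).2.
have yd x := (yz x).1; have zd x := (yz x).2.
pose P x := v x * dv x - v x ^+ 2 * (z x / y x).
pose dP x := (dv x - v x * (z x / y x)) ^+ 2 - lambda * v x ^+ 2.
have Pd x : drv P x (dP x).
  have yx0 := yN0 x; rewrite /P; drv; first exact: yx0.
  by rewrite /dP; field.
have dP0 x : - lambda * v x ^+ 2 <= dP x.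
  by rewrite /dP; have := sqr_ge0 (dv x - v x * (z x / y x)); lra.
have Pnd a b : a <= b -> P a <= P b.
  move=> ab; apply: (drv_ge0_le ab Pd) => x _; apply: le_trans (dP0 x).
  by rewrite mulr_ge0 ?sqr_ge0// oppr_ge0 ltW.
pose e x := v x ^+ 2 + dv x ^+ 2.
have [M MP] : bdd (fun x => z x * (y x)^-1).
  by apply: bddM; [apply: rapid_bdd; exact: Cn_here (Cz 0%N)|exact: Cn_here (Ci 0%N)].
have M0 : 0 <= M by apply: le_trans (MP 0).
have Pe x : `|P x| <= (1 + M) * e x.
  have h1 : `|v x * dv x| <= e x.
    rewrite normrM /e -(@real_normK _ (v x)) ?num_real// -(@real_normK _ (dv x)) ?num_real//.
    have := normr_ge0 (v x); have := normr_ge0 (dv x).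
    move: `|v x| `|dv x| => a b b0 a0; have := sqr_ge0 (a - b); have := mulr_ge0 a0 b0; nra.
  have h2 : `|v x ^+ 2 * (z x / y x)| <= M * e x.
    rewrite normrM ger0_norm ?sqr_ge0// mulrC ler_pM ?sqr_ge0 ?MP//.
    by rewrite /e lerDl sqr_ge0.
  by apply: le_trans (ler_normB _ _) _; lra.
have vc : continuous v := continuous_drv vd.
have dvc : continuous dv := continuous_drv dvd.
have ec : continuous e.
  by move=> x; apply: (@cvgD _ R^o); rewrite /GRing.exp /=; apply: cvgM; [exact: vc|exact: vc|exact: dvc|exact: dvc].
have e0 x : 0 <= e x by rewrite addr_ge0 ?sqr_ge0.
have ie : mu.-integrable setT (EFin \o e).
  by apply: eq_integrable (integrableD measurableT iv idv).
have [_ Ed] := primP ec; set E := prim e in Ed.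
have [N NP] := integrable_primitive_bounded ec e0 Ed ie.
(* an integrable function does not stay above [c > 0] on arbitrarily long segments *)
have tail c : (forall n : nat, exists a b, [/\ a <= b, b - a = n%:R &
    forall x, a <= x <= b -> c <= (1 + M) * e x]) -> c <= 0.
  move=> H; rewrite leNgt; apply/negP => c0.
  have N0 : 0 <= N by have := NP 0 0 (lexx _); rewrite subrr.
  have MN0 : 0 <= (1 + M) * N / c by rewrite divr_ge0 ?mulr_ge0 ?addr_ge0// ltW.
  have := archi_boundP MN0; set n := Num.bound _ => hn.
  have [a [b [ab ban hab]]] := H n.
  have ld x : drv (fun x => (1 + M) * E x - c * x) x ((1 + M) * e x - c) by drv; ring.
  have := drv_ge0_le ab ld _; rewrite -subr_ge0 => /(_ _) h.
  have {}h : 0 <= (1 + M) * E b - c * b - ((1 + M) * E a - c * a).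
    by apply: h => x /hab; rewrite subr_ge0.
  have := NP a b ab; rewrite ltr_pdivrMr// -ban in hn => hN.
  have : (1 + M) * (E b - E a) <= (1 + M) * N by rewrite ler_wpM2l// addr_ge0.
  lra.
have P0 x : P x = 0.
  apply/eqP; rewrite eq_le; apply/andP; split.
    apply: tail => n; exists x, (x + n%:R); split.
    - by rewrite lerDl.
    - by rewrite addrC addKr.
    move=> t /andP[xt _]; apply: le_trans (Pnd _ _ xt) _.
    exact: le_trans (ler_norm _) (Pe t).
  rewrite -oppr_le0; apply: tail => n; exists (x - n%:R), x.
  split.
  - by rewrite gerBl.
  - by rewrite opprB addrC subrK.
  move=> t /andP[_ tx]; apply: le_trans (_ : - P t <= _); first by rewrite lerN2 Pnd.
  by apply: le_trans (Pe t); rewrite -normrN ler_norm.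
move=> x; have dP00 : dP x = 0.
  have := Pd x; rewrite (_ : P = fun=> 0); last by apply/funext.
  by move=> /drv_derive1 <-; rewrite derive1_cst.
have := dP0 x; rewrite dP00 => h; apply/eqP; rewrite -sqrf_eq0 eq_le sqr_ge0 andbT.
by rewrite -(@pmulr_rle0 _ (- lambda))// oppr_gt0.
Qed.

(** The weak second derivative agrees almost everywhere with a continuous function, so
    [v'] is a primitive of that function: an eigenfunction is a classical solution. *)
Lemma weak_solution lambda v g : continuous q -> (forall x, derivable v x 1) ->
  measurable_fun setT g ->
  (forall a b, a <= b -> derive1 v b - derive1 v a = \int[mu]_(x in `[a, b]) g x) ->
  {ae mu, forall x, g x = - (q x + lambda) * v x} ->
  solves (fun x => q x + lambda) v (derive1 v).
Proof.
move=> qc vd mg vg gE; pose p x := - (q x + lambda) * v x.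
have vc : continuous v by move=> x; exact: drv_continuous (derivable_drv (vd x)).
have pc : continuous p.
  move=> x; apply: cvgM; last exact: vc.
  by apply: (@cvgN _ R^o); apply: (@cvgD _ R^o); [exact: qc|exact: cvg_cst].
have [_ Gd] := primP pc; set G := prim p in Gd.
have vG a b : a <= b -> derive1 v b - derive1 v a = G b - G a.
  move=> ab; rewrite vg// /Rintegral -[RHS]/(fine (G b - G a)%:E).
  rewrite -(integral_segment ab pc Gd); congr fine; apply: ae_eq_integral => //.
  - by apply/measurable_EFinP; exact: measurable_funTS.
  - by apply/measurable_EFinP; apply: measurable_funTS; exact: continuous_measurable.
  - by apply: (@filterS _ _ (ae_filter_ringOfSetsType mu)) gE => x /= gx _; rewrite gx.
have vE x : derive1 v x = G x + (derive1 v 0 - G 0).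
  have [x0|/ltW x0] := leP 0 x; first by have := vG _ _ x0; lra.
  by have := vG _ _ x0; lra.
move=> x; split; first exact: derivable_drv.
apply: (@drv_ext _ (fun x => G x + (derive1 v 0 - G 0))) => [t|]; first by rewrite -vE.
by drv; exact: addr0.
Qed.

Lemma ground_state_no_negative_eigenvalue : no_negative_eigenvalue q.
Proof.
move=> lambda l0 [u uN0 [g [[uR uI] [u'R u'I] [gR gI] ud ug] gE]].
have [qc _] := schwartz_decay hq.
apply: uN0; apply: aeW => x.
have part (f : R[i] -> R) : (forall x, derivable (f \o u) x 1) ->
    f \o u \in Lfun mu 2%:E -> derive1 (f \o u) \in Lfun mu 2%:E -> f \o g \in Lfun mu 2%:E ->
    (forall a b, a <= b -> derive1 (f \o u) b - derive1 (f \o u) a =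
      \int[mu]_(x in `[a, b]) (f \o g) x) ->
    (forall x, lambda%:C * u x = - g x - (q x)%:C * u x ->
      f (g x) = - (q x + lambda) * f (u x)) -> f (u x) = 0.
  move=> fd fu fu' fg fi fE.
  have mg : measurable_fun setT (f \o g).
    by move: fg; rewrite inE => /andP[/[!inE]/= + _].
  apply: (ground_state_L2 l0 (weak_solution qc fd mg fi _)).
  - by apply: (@filterS _ _ (ae_filter_ringOfSetsType mu)) gE => t /fE.
  - exact: Lfun2_integrable_sqr.
  - exact: Lfun2_integrable_sqr.
have r0 : complex.Re (u x) = 0.
  apply: part => //; first by move=> t; case: (ud t).
    by move=> a b ab; have := ug a b ab; rewrite /cderive /cintegral; simpc => -[].
  by move=> t; case: (u t) => ? ?; case: (g t) => ? ?; simpc => -[h _] /=; lra.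
have i0 : complex.Im (u x) = 0.
  apply: part => //; first by move=> t; case: (ud t).
    by move=> a b ab; have := ug a b ab; rewrite /cderive /cintegral; simpc => -[].
  by move=> t; case: (u t) => ? ?; case: (g t) => ? ?; simpc => -[_ h] /=; lra.
by move: r0 i0; case: (u x) => ? ? /= -> ->.
Qed.

End NoNegativeEigenvalue.

(** * Solutions in the forbidden region *)

Section Growth.
Variable R : realType.
Implicit Types (p y z v dv : R -> R) (x X a b d : R).

Lemma solves_refl p y z : solves p y z ->
  solves (fun x => p (- x)) (fun x => y (- x)) (fun x => - z (- x)).
Proof.
move=> yz x; have [yd zd] := yz (- x); split; first exact: drv_refl.
by apply: drv_eq (drvN (drv_refl zd)) _; rewrite opprK mulNr.
Qed.

Lemma pos_no_zero y a b : continuous y -> 0 < y a -> a <= b ->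
  (forall x, a <= x <= b -> y x != 0) -> 0 < y b.
Proof.
move=> yc ya ab y0; rewrite ltNge; apply/negP => yb.
have [||c cab /eqP yc0] := @IVT _ y a b 0 ab.
- exact: continuous_subspaceT.
- by rewrite ge_min le_max yb (ltW ya) orbT.
by move: cab yc0; rewrite in_itv/= => /y0/negbTE ->.
Qed.

Lemma energy_flux_drv p y z x : solves p y z ->
  drv (fun t => y t * z t) x (z x ^+ 2 - p x * y x ^+ 2).
Proof. by move=> yz; have [yd zd] := yz x; drv; ring. Qed.

(** In the forbidden region [y y'] is nondecreasing, so a solution which starts
    growing never vanishes afterwards. *)
Lemma growth_right p v dv X : solves p v dv -> (forall x, X <= x -> p x <= 0) ->
  0 < v X -> 0 < dv X -> forall x, X <= x -> 0 < v x /\ 0 < dv x.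
Proof.
move=> vs p0 vX dvX x Xx.
have flux t : X <= t -> 0 < v t * dv t.
  move=> Xt; apply: lt_le_trans (_ : v X * dv X <= _); first exact: mulr_gt0.
  apply: (drv_ge0_le Xt (fun t => energy_flux_drv t vs)) => s /andP[Xs _].
  have := p0 s Xs; have := sqr_ge0 (v s); have := sqr_ge0 (dv s); nra.
have vc : continuous v by apply: continuous_drv => t; exact: (vs t).1.
have vx : 0 < v x.
  apply: (pos_no_zero vc vX Xx) => t /andP[/flux h _].
  by apply/eqP => v0; rewrite v0 mul0r ltxx in h.
by split=> //; have := flux x Xx; rewrite pmulr_rgt0.
Qed.

Lemma growth_left p v dv X : solves p v dv -> (forall x, x <= X -> p x <= 0) ->
  0 < v X -> dv X < 0 -> forall x, x <= X -> 0 < v x.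
Proof.
move=> vs p0 vX dvX x xX.
have p0' t : - X <= t -> p (- t) <= 0 by move=> Xt; apply: p0; lra.
have Xx : - X <= - x by rewrite lerN2.
have := growth_right (solves_refl vs) p0' _ _ Xx.
by rewrite !opprK oppr_gt0 => /(_ vX dvX)[].
Qed.

(** The flux [y y'] stays nonpositive, whereas its derivative dominates [d y ^ 2] and
    [y' ^ 2]: both squares are integrable near [+oo]. *)
Lemma decay_right p y z X d (E E1 : R -> R) : solves p y z -> 0 < d ->
  (forall x, X <= x -> p x <= - d) -> (forall x, 0 < y x) ->
  (forall x, X <= x -> z x <= 0) ->
  (forall x, drv E x (y x ^+ 2)) -> (forall x, drv E1 x (z x ^+ 2)) ->
  exists M, forall x, X <= x -> E x <= M /\ E1 x <= M.
Proof.
move=> yz d0 pd y0 z0 Ed E1d; exists (Num.max (E X - y X * z X / d) (E1 X - y X * z X)).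
move=> x Xx; have yzx : y x * z x <= 0 by rewrite pmulr_rle0// z0.
have fd t := energy_flux_drv t yz.
have h1 : y X * z X - d * E X <= y x * z x - d * E x.
  have Ld t : drv (fun t => y t * z t - d * E t) t (z t ^+ 2 - p t * y t ^+ 2 - d * y t ^+ 2).
    by have := fd t => ft; apply: drvB ft _; drv; ring.
  apply: (drv_ge0_le Xx Ld) => t /andP[Xt _].
  have := pd t Xt; have := sqr_ge0 (y t); have := sqr_ge0 (z t); nra.
have h2 : y X * z X - E1 X <= y x * z x - E1 x.
  have Ld t : drv (fun t => y t * z t - E1 t) t (z t ^+ 2 - p t * y t ^+ 2 - z t ^+ 2).
    exact: drvB (fd t) (E1d t).
  apply: (drv_ge0_le Xx Ld) => t /andP[Xt _].
  have := pd t Xt; have := sqr_ge0 (y t); nra.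
split; rewrite le_max; apply/orP; [left|right]; last by lra.
rewrite -(ler_pM2l d0) mulrBr mulrCA divff ?gt_eqF// mulr1; lra.
Qed.

Lemma decay_left p y z X d (E E1 : R -> R) : solves p y z -> 0 < d ->
  (forall x, x <= - X -> p x <= - d) -> (forall x, 0 < y x) ->
  (forall x, x <= - X -> 0 <= z x) ->
  (forall x, drv E x (y x ^+ 2)) -> (forall x, drv E1 x (z x ^+ 2)) ->
  exists M, forall x, x <= - X -> - M <= E x /\ - M <= E1 x.
Proof.
move=> yz d0 pd y0 z0 Ed E1d.
have pd' x : X <= x -> p (- x) <= - d by move=> Xx; apply: pd; rewrite lerN2.
have z0' x : X <= x -> - z (- x) <= 0.
  by move=> Xx; rewrite oppr_le0; apply: z0; rewrite lerN2.
have Ed' x : drv (fun x => - E (- x)) x (y (- x) ^+ 2).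
  by have h := drvN (drv_refl (Ed (- x))); rewrite opprK in h.
have E1d' x : drv (fun x => - E1 (- x)) x ((- z (- x)) ^+ 2).
  by have h := drvN (drv_refl (E1d (- x))); rewrite opprK in h; rewrite sqrrN.
have [M MP] := decay_right (solves_refl yz) d0 pd' (fun x => y0 (- x)) z0' Ed' E1d'.
exists M => x xX; have Xx : X <= - x by lra.
by have [] := MP _ Xx; rewrite !opprK; split; lra.
Qed.

Lemma ivp_at p X a b : continuous p ->
  exists v dv, [/\ solves p v dv, v X = a & dv X = b].
Proof.
move=> pc; have [cc _ _] := ivpP 1 0 pc; have [ss _ _] := ivpP 0 1 pc.
have W := ivp_wronskian X pc.
set c := (ivp p 1 0).1 in cc W; set c' := (ivp p 1 0).2 in cc W.
set s := (ivp p 0 1).1 in ss W; set s' := (ivp p 0 1).2 in ss W.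
exists (fun x => (a * s' X - b * s X) * c x + (b * c X - a * c' X) * s x).
exists (fun x => (a * s' X - b * s X) * c' x + (b * c X - a * c' X) * s' x).
split; first exact: solves_lin.
  by rewrite -[RHS]mulr1 -W; ring.
by rewrite -[RHS]mulr1 -W; ring.
Qed.

Lemma pos_lower_bound y (Y : R) : continuous y -> (forall x, 0 < y x) -> 0 <= Y ->
  exists2 m, 0 < m & forall x, `|x| <= Y -> m <= y x.
Proof.
move=> yc y0 Y0; have YY : - Y <= Y by lra.
have [c _ cP] := EVT_min YY (continuous_subspaceT yc).
by exists (y c) => // x; rewrite ler_norml => xY; apply: cP; rewrite in_itv.
Qed.

(** Adding a small multiple of a growing solution makes a positive solution grow at
    [+oo] without changing its growth at [-oo]. *)
Lemma make_grow_right p y z X X2 : continuous p -> solves p y z -> 0 <= X -> X <= X2 ->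
  (forall x, X <= `|x| -> p x <= 0) -> (forall x, 0 < y x) -> z (- X2) < 0 ->
  exists u v, [/\ solves p u v, forall x, 0 < u x, v (- X2) < 0 &
    exists2 X1, X <= X1 & 0 < v X1].
Proof.
move=> pc yz X0 XX2 p0 y0 zX2.
have p0r x : X <= x -> p x <= 0 by move=> Xx; apply: p0; apply: le_trans Xx (ler_norm _).
have p0l x : x <= - X2 -> p x <= 0.
  move=> Xx; apply: p0; have := ler_norm (- x); rewrite normrN; lra.
have [[X1 /andP[XX1 zX1]]|NG] := pselect (exists X1, (X <= X1) && (0 < z X1)).
  by exists y, z; split=> //; exists X1.
have zle x : X <= x -> z x <= 0.
  by move=> Xx; rewrite leNgt; apply/negP => zx; apply: NG; exists x; rewrite Xx.
have [v [dv [vs vX dvX]]] := ivp_at X 1 1 pc.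
have v0 x : X <= x -> 0 < v x /\ 0 < dv x.
  by apply: (growth_right vs p0r); rewrite ?vX ?dvX ltr01.
have dv1 x : X <= x -> 1 <= dv x.
  move=> Xx; rewrite -dvX; apply: (drv_ge0_le Xx (fun t => (vs t).2)) => t /andP[Xt _].
  by rewrite mulNr -mulrN mulr_le0// ?p0r// oppr_le0 ltW//; case: (v0 t Xt).
have yc : continuous y by apply: continuous_drv => t; exact: (yz t).1.
have vc : continuous v by apply: continuous_drv => t; exact: (vs t).1.
have dvc : continuous dv by apply: continuous_drv => t; exact: (vs t).2.
have X20 : 0 <= X2 by lra.
have [m m0 mP] := pos_lower_bound yc y0 X20.
have [V V0 VP] := bounded_on X2 vc; have [V' V'0 V'P] := bounded_on X2 dvc.
pose e := Num.min (m / (2 * V)) (- z (- X2) / (2 * V')).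
have e0 : 0 < e by rewrite lt_min !divr_gt0 ?mulr_gt0// oppr_gt0.
have eV : e * V <= m / 2.
  have : e <= m / (2 * V) by rewrite /e ge_min lexx.
  by rewrite ler_pdivlMr ?mulr_gt0//; lra.
have eV' : e * V' <= - z (- X2) / 2.
  have : e <= - z (- X2) / (2 * V') by rewrite /e ge_min lexx orbT.
  by rewrite ler_pdivlMr ?mulr_gt0//; lra.
pose u x := 1 * y x + e * v x; pose du x := 1 * z x + e * dv x.
have us : solves p u du by exact: solves_lin.
have nX2 : `|- X2| <= X2 by rewrite normrN ger0_norm.
have u_mid x : `|x| <= X2 -> 0 < u x.
  move=> xX2; have := mP x xX2; have := VP x xX2.
  rewrite ler_norml /u => /andP[h _] h'.
  have : e * - V <= e * v x by rewrite ler_pM2l.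
  lra.
have duX2 : du (- X2) < 0.
  have := V'P _ nX2; rewrite ler_norml /du => /andP[_ h].
  have : e * dv (- X2) <= e * V' by rewrite ler_pM2l.
  lra.
exists u, du; split=> //.
- move=> x; have [xX2|xX2] := leP x (- X2).
    exact: growth_left us p0l (u_mid _ nX2) duX2 _ xX2.
  have [Xx|xX] := leP X x.
    by have [vx _] := v0 x Xx; rewrite /u mul1r addr_gt0// mulr_gt0.
  by apply: u_mid; rewrite ler_norml; lra.
apply: contrapT => H.
have dule x : X <= x -> z x <= - e.
  move=> Xx; rewrite leNgt; apply/negP => zx; apply: H; exists x => //.
  by rewrite /du; have := dv1 x Xx; nra.
pose x := X + y X / e.
have Xx : X <= x by rewrite lerDl divr_ge0// ltW.
have Ld t : drv (fun t => y t + e * t) t (z t + e) by have [yd _] := yz t; drv; ring.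
have : y x + e * x <= y X + e * X.
  apply: (drv_le0_ge Xx Ld) => t /andP[/dule]; lra.
have -> : e * x = e * X + y X by rewrite /x mulrDr mulrCA divff ?gt_eqF// mulr1.
by have := y0 x; lra.
Qed.

Lemma make_grow_left p y z X X1 : continuous p -> solves p y z -> 0 <= X -> X <= X1 ->
  (forall x, X <= `|x| -> p x <= 0) -> (forall x, 0 < y x) -> 0 < z X1 ->
  exists u v, [/\ solves p u v, forall x, 0 < u x, 0 < v X1 &
    exists2 X2, X <= X2 & v (- X2) < 0].
Proof.
move=> pc yz X0 XX1 p0 y0 zX1.
have pc' : continuous (fun x => p (- x)).
  have Nd (x : R) : drv (fun t : R => - t) x (- 1) by drv.
  by move=> x; apply: continuous_comp; [exact: drv_continuous (Nd x)|exact: pc].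
have p0' x : X <= `|x| -> p (- x) <= 0 by rewrite -normrN; exact: p0.
have zX1' : - z (- - X1) < 0 by rewrite opprK oppr_lt0.
have [u [v [us u0 v1 [X2 XX2 v2]]]] :=
  make_grow_right pc' (solves_refl yz) X0 XX1 p0' (fun x => y0 (- x)) zX1'.
exists (fun x => u (- x)), (fun x => - v (- x)); split=> //.
- have := solves_refl us; rewrite (_ : (fun x => p (- - x)) = p)//.
  by apply/funext => x; rewrite opprK.
- by rewrite oppr_gt0.
- by exists X2 => //; rewrite opprK oppr_lt0.
Qed.

End Growth.

(** * Positive eigenfunctions *)

Section EigenfunctionL2.
Variable R : realType.
Implicit Types (f y z q : R -> R) (x : R).
Local Notation mu := (@lebesgue_measure R).

Lemma continuous_Lfun2 f : continuous f ->
  mu.-integrable setT (EFin \o (fun x => f x ^+ 2)) -> f \in Lfun mu 2%:E.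
Proof.
move=> fc /integrableP[_ fi]; rewrite inE; apply/andP; split; rewrite inE/=.
  exact: continuous_measurable.
rewrite /finite_norm unlock; apply: poweR_lty; apply: le_lt_trans fi.
rewrite le_eqVlt; apply/orP; left; apply/eqP; apply: eq_integral => x _ /=.
by rewrite powR_mulrn// normrX.
Qed.

Lemma Lfun2_dominated f g (C : R) : continuous g -> 0 <= C ->
  (forall x, `|g x| <= C * `|f x|) ->
  mu.-integrable setT (EFin \o (fun x => f x ^+ 2)) -> g \in Lfun mu 2%:E.
Proof.
move=> gc C0 gf fi; apply: continuous_Lfun2 => //.
have g2c : continuous (fun x => g x ^+ 2).
  by move=> x; rewrite /GRing.exp /=; apply: cvgM; exact: gc.
have Cfi := integrableZl measurableT (C ^+ 2) fi.
apply: (le_integrable measurableT _ _ Cfi).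
  by apply/measurable_EFinP; exact: continuous_measurable.
move=> x _ /=; rewrite lee_fin -exprMn !normrX lerXn2r ?nnegrE//.
by apply: le_trans (gf x) _; rewrite normrM (ger0_norm C0).
Qed.

Lemma not_ae_false : ~ {ae mu, forall x : R, False}.
Proof.
move=> [A [mA A0 sA]].
have := @le_measure _ _ _ mu `[0, 1]%classic A; rewrite !inE => h.
have : (mu `[0%R, 1%R]%classic <= mu A)%E.
  by apply: h => // x _; exact: sA.
by rewrite A0 lebesgue_measure_itv /= lte_fin ltr01 oppr0 adde0 lee_fin ler10.
Qed.

Lemma positive_eigenfunction q lambda y z : schwartz q ->
  solves (fun x => q x + lambda) y z -> (forall x, 0 < y x) ->
  mu.-integrable setT (EFin \o (fun x => y x ^+ 2)) ->
  mu.-integrable setT (EFin \o (fun x => z x ^+ 2)) -> Defs.eigenvalue q lambda.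
Proof.
move=> hq yz y0 iy iz; have [qc _] := schwartz_decay hq.
have [Q QP] := rapid_bdd (Cn_here ((schwartzP q).1 hq 0%N)).
have yd x := (yz x).1; have zd x := (yz x).2.
have yc := continuous_drv yd; have zc := continuous_drv zd.
pose g x := - (q x + lambda) * y x.
have gc : continuous g.
  move=> x; apply: cvgM; last exact: yc.
  by apply: (@cvgN _ R^o); apply: (@cvgD _ R^o); [exact: qc|exact: cvg_cst].
have Q0 : 0 <= Q by apply: le_trans (QP 0).
have C0 : 0 <= Q + `|lambda| by rewrite addr_ge0.
have gf x : `|g x| <= (Q + `|lambda|) * `|y x|.
  rewrite normrM normrN ler_wpM2r//; apply: le_trans (ler_normD _ _) _.
  by rewrite lerD2r.
have L0 : (fun=> 0 : R) \in Lfun mu 2%:E.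
  apply: continuous_Lfun2; first exact: cst_continuous.
  apply: (integrable_bounded_primitive (U := fun=> 0) (M := 0)).
  - by under eq_fun do rewrite expr0n; exact: cst_continuous.
  - by move=> x; exact: sqr_ge0.
  - by move=> x; rewrite expr0n; exact: drv_cst.
  - by move=> x; rewrite normr0.
have cd : cderive (fun x => (y x)%:C) = fun x => (z x)%:C.
  apply/funext => x; rewrite /cderive -[_ \o _]/y (drv_derive1 (yd x)).
  by rewrite -[X in _ +i* derive1 X _]/(fun=> 0) derive1_cst.
exists (fun x => (y x)%:C).
  move=> ae; apply: not_ae_false; move: ae.
  apply: (@filterS _ _ (ae_filter_ringOfSetsType mu)) => x [yx].
  by have := y0 x; rewrite yx ltxx.
exists (fun x => (g x)%:C).
  split.
  - split; [exact: continuous_Lfun2 yc iy|exact: L0].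
  - by rewrite cd; split; [exact: continuous_Lfun2 zc iz|exact: L0].
  - by split; [exact: Lfun2_dominated gc C0 gf iy|exact: L0].
  - by move=> x; split; [case: (yd x)|exact: derivable_cst].
  - move=> a b ab; rewrite cd /cintegral /= /Rintegral (integral_segment ab gc zd) integral0 /=.
    by simpc.
by apply: aeW => x; rewrite /g; simpc; congr (_ +i* _); ring.
Qed.

End EigenfunctionL2.

(** * Dependence on the energy *)

Section EnergyDependence.
Variable R : realType.
Implicit Types (q y z u v : R -> R) (x la mu : R).

Definition epot q la x : R := q x + la.

Variable q : R -> R.
Hypothesis qc : continuous q.

Lemma epot_continuous la : continuous (epot q la).
Proof. by move=> x; apply: (@cvgD _ R^o); [exact: qc|exact: cvg_cst]. Qed.

(** Gronwall inequality for the squared distance of the Cauchy data increased by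
    [(la - mu) ^ 2], which absorbs the source term. *)
Lemma energy_lipschitz mu u v (X : R) : solves (epot q mu) u v -> exists C, 0 <= C /\
  forall la y z, `|la - mu| <= 1 -> solves (epot q la) y z -> y 0 = u 0 -> z 0 = v 0 ->
  forall x, `|x| <= X -> `|y x - u x| <= C * `|la - mu| /\ `|z x - v x| <= C * `|la - mu|.
Proof.
move=> uv; have [X0|X0] := ltP X 0.
  exists 0; split=> // la y z _ _ _ _ x xX; exfalso.
  by have := normr_ge0 x; rewrite leNgt (le_lt_trans xX X0).
have uc : continuous u by apply: continuous_drv => t; exact: (uv t).1.
have [Q Q0 QP] := bounded_on X (@epot_continuous mu).
have [U U0 UP] := bounded_on X uc.
pose L := 2 + Q + U; have L0 : 0 <= L by rewrite /L; lra.
exists (1 + expR (L * X)); split; first by rewrite addr_ge0 ?expR_ge0.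
move=> la y z d1 yz y0 z0 x xX; set d := la - mu in d1 *.
pose D1 t := y t - u t; pose D2 t := z t - v t.
pose F t := D1 t ^+ 2 + D2 t ^+ 2 + d ^+ 2.
pose dF t := 2 * D1 t * D2 t - 2 * epot q la t * D1 t * D2 t - 2 * d * u t * D2 t.
have Fd t : drv F t (dF t).
  have [yd zd] := yz t; have [ud vd] := uv t; rewrite /F /D1 /D2; drv.
  by rewrite /= /dF /D1 /D2 /epot /d; ring.
have dFF t : `|t| <= X -> `|dF t| <= L * F t.
  move=> tX; have q1 : `|epot q la t| <= Q + 1.
    rewrite (_ : epot q la t = epot q mu t + d); last by rewrite /epot /d; ring.
    by apply: le_trans (ler_normD _ _) _; rewrite lerD// QP.
  have u1 := UP t tX.
  have h (a b c M : R) : `|c| <= M -> `|2 * c * a * b| <= M * (a ^+ 2 + b ^+ 2).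
    move=> cM; rewrite (_ : 2 * c * a * b = c * (2 * a * b)); last by ring.
    rewrite normrM ler_pM// ler_norml.
    by have := sqr_ge0 (a - b); have := sqr_ge0 (a + b); lra.
  have h1 := h (D1 t) (D2 t) 1 1; rewrite normr1 lexx mulr1 mul1r in h1.
  have h2 := h (D1 t) (D2 t) _ _ q1.
  have h3 := h d (D2 t) _ _ u1.
  rewrite /dF (_ : 2 * d * u t * D2 t = 2 * u t * d * D2 t); last by ring.
  apply: le_trans (ler_normB _ _) _; apply: le_trans (lerD (ler_normB _ _) (lexx _)) _.
  apply: le_trans (lerD (lerD (h1 isT) h2) h3) _.
  rewrite /L /F; have := sqr_ge0 (D1 t); have := sqr_ge0 (D2 t); have := sqr_ge0 d.
  move: (D1 t ^+ 2) (D2 t ^+ 2) (d ^+ 2) => a b c c0 b0 a0; nra.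
have F0 : F 0 = d ^+ 2 by rewrite /F /D1 /D2 y0 z0 !subrr !expr0n !add0r.
have Hd t : drv (fun t => L * t) t L by drv; ring.
have XX : - X <= 0 <= X by lra.
have xXX : - X <= x <= X by rewrite -ler_norml.
have Fx : F x <= d ^+ 2 * expR (L * X).
  rewrite -F0; apply: le_trans (gronwall Fd Hd _ XX xXX _) _.
  - by rewrite F0 sqr_ge0.
  - by move=> t; rewrite -ler_norml; exact: dFF.
  rewrite ler_wpM2l ?F0 ?sqr_ge0// ler_expR mulr0 subr0 normrM ger0_norm//.
  by rewrite ler_wpM2l.
have E (D : R) : D ^+ 2 <= F x -> `|D| <= (1 + expR (L * X)) * `|d|.
  move=> DF; have e0 := expR_ge0 (L * X).
  rewrite -(@ler_pXn2r _ 2)// ?nnegrE ?mulr_ge0 ?addr_ge0// real_normK ?num_real//.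
  apply: le_trans DF (le_trans Fx _).
  rewrite exprMn real_normK ?num_real// mulrC ler_wpM2r ?sqr_ge0//; nra.
have := sqr_ge0 (D1 x); have := sqr_ge0 (D2 x); have := sqr_ge0 d.
move=> s1 s2 s3; have f1 : D1 x ^+ 2 <= F x by rewrite /F; lra.
have f2 : D2 x ^+ 2 <= F x by rewrite /F; lra.
by split; [exact: E f1|exact: E f2].
Qed.

Lemma ivp_energy_cvg a b mu x : (ivp (epot q la) a b).1 x @[la --> mu] --> (ivp (epot q mu) a b).1 x.
Proof.
have [uv u0 v0] := ivpP a b (@epot_continuous mu).
have [C [C0 CP]] := energy_lipschitz `|x| uv.
apply/cvgrPdist_le => e e0; near=> la.
have [yz y0 z0] := ivpP a b (@epot_continuous la).
have d1 : `|la - mu| <= 1.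
  by rewrite distrC; near: la; apply: cvgr_dist_le => //; exact: cvg_id.
have de : `|la - mu| <= e / (C + 1).
  rewrite distrC; near: la; apply: cvgr_dist_le; first exact: cvg_id.
  by rewrite divr_gt0// ltr_wpDl.
have [h _] := CP la _ _ d1 yz (etrans y0 (esym u0)) (etrans z0 (esym v0)) x (lexx _).
rewrite distrC; apply: le_trans h _.
rewrite ler_pdivlMr ?ltr_wpDl// in de; apply: le_trans de.
by rewrite mulrC ler_wpM2l// lerDl.
Unshelve. all: by end_near. Qed.

End EnergyDependence.

(** * Without negative eigenvalues, some zero-energy solution is positive *)

Section NegativeEigenvalue.
Variable R : realType.
Implicit Types (y z u v : R -> R) (x la be : R).
Local Notation mu := (@lebesgue_measure R).

Variable q : R -> R.
Hypothesis hq : schwartz q.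

Let qc : continuous q := (schwartz_decay hq).1.

(** Up to a positive factor, the Cauchy data at the origin of a positive solution are
    [(1 - |be|, be)] on the upper half of the unit circle of the l1 norm, a compact
    set. *)
Definition cauchy_ray la be x : R :=
  (1 - `|be|) * (ivp (epot q la) 1 0).1 x + be * (ivp (epot q la) 0 1).1 x.

Definition cauchy_ray' la be x : R :=
  (1 - `|be|) * (ivp (epot q la) 1 0).2 x + be * (ivp (epot q la) 0 1).2 x.

Lemma cauchy_ray_solves la be :
  [/\ solves (epot q la) (cauchy_ray la be) (cauchy_ray' la be),
      cauchy_ray la be 0 = 1 - `|be| & cauchy_ray' la be 0 = be].
Proof.
have pc := @epot_continuous _ _ qc la.
have [cc c0 c'0] := ivpP 1 0 pc; have [ss s0 s'0] := ivpP 0 1 pc.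
split; first exact: solves_lin.
  by rewrite /cauchy_ray c0 s0; ring.
by rewrite /cauchy_ray' c'0 s'0; ring.
Qed.

Lemma cauchy_ray_gt0 la be : (forall x, 0 <= cauchy_ray la be x) ->
  forall x, 0 < cauchy_ray la be x.
Proof.
move=> h; have [cs c0 c'0] := cauchy_ray_solves la be.
have pc := @epot_continuous _ _ qc la.
have [[x0 x0P]|nz] := pselect (exists x0, cauchy_ray la be x0 != 0).
  exact: solves_ge0_gt0 pc cs h x0P.
have z0 x : cauchy_ray la be x = 0.
  by apply/eqP; apply: contrapT => /negP cx; apply: nz; exists x.
exfalso; have [+ _] := cs 0; rewrite (_ : cauchy_ray la be = fun=> 0); last exact/funext.
move=> /drv_derive1; rewrite derive1_cst c'0 => be0.
by move: c0; rewrite z0 -be0 normr0 subr0 => /esym/eqP; rewrite oner_eq0.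
Qed.

Lemma ray_of_positive la y z : solves (epot q la) y z -> (forall x, 0 < y x) ->
  exists be, `|be| <= 1 /\ forall x, 0 <= cauchy_ray la be x.
Proof.
move=> yz y0; pose N := y 0 + `|z 0|.
have N0 : 0 < N by rewrite ltr_wpDr.
have NN : N != 0 by rewrite gt_eqF.
have pc := @epot_continuous _ _ qc la.
exists (z 0 / N).
have nb : `|z 0 / N| = `|z 0| / N by rewrite normrM normfV (gtr0_norm N0).
split; first by rewrite nb ler_pdivrMr// mul1r lerDr ltW.
move=> x; have [yx _] := ivp_basis pc yz x.
have -> : cauchy_ray la (z 0 / N) x = y x / N; last by rewrite divr_ge0// ltW.
rewrite /cauchy_ray nb yx (_ : 1 - `|z 0| / N = y 0 / N); first by field.
by rewrite /N in NN *; field.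
Qed.

Definition positive_rays (M : R) : set (R * R) :=
  [set lb | [/\ - M <= lb.1 <= 0, `|lb.2| <= 1 & forall x, 0 <= cauchy_ray lb.1 lb.2 x]].

(** Solutions depend continuously on the energy and on the data, so positivity is a
    closed condition. *)
Lemma positive_rays_compact M : compact (positive_rays M).
Proof.
have cray x : continuous (fun lb : R * R => cauchy_ray lb.1 lb.2 x).
  move=> lb; have c1 : l.1 @[l --> lb] --> lb.1 by exact: cvg_fst.
  have c2 : l.2 @[l --> lb] --> lb.2 by exact: cvg_snd.
  have e a b : (ivp (epot q l.1) a b).1 x @[l --> lb] --> (ivp (epot q lb.1) a b).1 x.
    exact: (cvg_comp _ _ c1 (@ivp_energy_cvg _ _ qc a b lb.1 x)).
  apply: (@cvgD _ R^o); apply: cvgM => //.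
  by apply: (@cvgB _ R^o); [exact: cvg_cst|exact: (@cvg_norm _ R^o)].
have BC : compact (`[- M, 0]%classic `*` `[-1, 1]%classic : set (R * R)).
  by apply: compact_setX; exact: segment_compact.
apply: (subclosed_compact _ BC); last first.
  by move=> [l b] /= [h1 h2 _]; split; rewrite /= in_itv/= -?ler_norml.
have -> : positive_rays M = (`[- M, 0]%classic `*` `[-1, 1]%classic) `&`
    \bigcap_(x in [set: R]) [set lb | 0 <= cauchy_ray lb.1 lb.2 x].
  apply/seteqP; split=> [[l b] /= [h1 h2 h3]|[l b] /= [[h1 h2] h3]].
    by split; [split; rewrite /= in_itv/= -?ler_norml|move=> x _; exact: h3].
  move: h1 h2; rewrite /= !in_itv/= -ler_norml => h1 h2; split=> // x; exact: h3.
apply: closedI; first by apply: compact_closed => //; exact: (@norm_hausdorff R (R * R)%type).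
apply: closed_bigI => x _.
exact: ((continuous_closedP _).1 (cray x) _ (@closed_ge R 0)).
Qed.

(** Below minus the supremum of [|q|] the whole line is forbidden: the square of the
    solution with slope 0 at the origin has its minimum there. *)
Lemma positive_low_energy M : (forall x, `|q x| <= M) -> positive_rays M !=set0.
Proof.
move=> qM; exists (- M, 0).
have M0 : 0 <= M by apply: le_trans (qM 0).
have [cs c0 c'0] := cauchy_ray_solves (- M) 0.
set y := cauchy_ray _ _ in cs c0 *; set z := cauchy_ray' _ _ in cs c'0.
split=> /=; [by rewrite lexx oppr_le0|by rewrite normr0|].
have p0 x : epot q (- M) x <= 0.
  by have := qM x; rewrite ler_norml /epot => /andP[_]; lra.
rewrite normr0 subr0 in c0.
have yzd x : drv (fun t => y t * z t) x (z x ^+ 2 - epot q (- M) x * y x ^+ 2).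
  exact: energy_flux_drv.
have flux0 x : 0 <= z x ^+ 2 - epot q (- M) x * y x ^+ 2.
  by rewrite addr_ge0 ?sqr_ge0// -mulNr mulr_ge0 ?sqr_ge0// oppr_ge0.
have yd x : drv (fun t => y t ^+ 2) x (2 * (y x * z x)).
  by have [h _] := cs x; drv; rewrite /=; ring.
have y1 x : 1 <= y x ^+ 2.
  rewrite -[leLHS](expr1n _ 2) -c0; have [x0|/ltW x0] := leP 0 x.
    apply: (drv_ge0_le x0 yd) => t /andP[t0 _].
    rewrite mulr_ge0//; apply: le_trans (_ : y 0 * z 0 <= _); first by rewrite c'0 mulr0.
    by apply: (drv_ge0_le t0 yzd) => s _.
  apply: (drv_le0_ge x0 yd) => t /andP[_ t0].
  rewrite mulr_ge0_le0//; apply: le_trans (_ : _ <= y 0 * z 0) _; last by rewrite c'0 mulr0.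
  by apply: (drv_ge0_le t0 yzd) => s _.
have yc : continuous y by apply: continuous_drv => t; exact: (cs t).1.
move=> x; rewrite leNgt; apply/negP => yx.
have y00 : 0 < y 0 by rewrite c0.
have [c yc0] := pos_ivt yc y00 (ltW yx).
by have := y1 c; rewrite yc0 expr0n ler10.
Qed.

(** Growth at both ends is stable under a small increase of the energy: on the segment
    [[-X2, X1]] the perturbed solution stays close to [y], and outside it the growth in the
    forbidden region keeps it positive. *)
Lemma positive_growing_open la y z X X1 X2 : la < 0 -> 0 <= X ->
  (forall x, X <= `|x| -> epot q (la / 2) x <= 0) ->
  solves (epot q la) y z -> (forall x, 0 < y x) ->
  X <= X1 -> 0 < z X1 -> X <= X2 -> z (- X2) < 0 ->
  exists2 la', la < la' <= 0 & exists u v, solves (epot q la') u v /\ forall x, 0 < u x.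
Proof.
move=> la0 X0 pX yz y0 XX1 zX1 XX2 zX2.
pose Y := X1 + X2; have Y0 : 0 <= Y by rewrite /Y; lra.
have [C [C0 CP]] := energy_lipschitz qc Y yz.
have yc : continuous y by apply: continuous_drv => t; exact: (yz t).1.
have [m m0 mP] := pos_lower_bound yc y0 Y0.
pose r := Num.min m (Num.min (z X1) (- z (- X2))).
have r0 : 0 < r by rewrite !lt_min m0 zX1 oppr_gt0.
pose e := Num.min 1 (Num.min (- la / 2) (r / (2 * (C + 1)))).
have C1 : 0 < C + 1 by rewrite ltr_wpDl.
have e0 : 0 < e by rewrite !lt_min ltr01 !divr_gt0 ?oppr_gt0// mulr_gt0.
have [e1 e2 e3] : [/\ e <= 1, e <= - la / 2 & e <= r / (2 * (C + 1))].
  by rewrite /e !ge_min lexx; split; rewrite ?lexx ?orbT.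
have Ce : C * e < r.
  rewrite ler_pdivlMr ?mulr_gt0// in e3.
  have : C * e <= (C + 1) * e by rewrite ler_pM2r// lerDl.
  lra.
have [rm rz1 rz2] : [/\ r <= m, r <= z X1 & r <= - z (- X2)].
  by rewrite /r !ge_min lexx; split; rewrite ?lexx ?orbT.
pose la' := la + e; have pc := @epot_continuous _ _ qc la'.
have [uv u0 v0] := ivpP (y 0) (z 0) pc.
set u := (ivp _ _ _).1 in uv u0; set v := (ivp _ _ _).2 in uv v0.
have de : `|la' - la| = e by rewrite /la' addrC addKr gtr0_norm.
have close x : `|x| <= Y -> `|u x - y x| <= C * e /\ `|v x - z x| <= C * e.
  by have := CP la' u v; rewrite de => /(_ e1 uv u0 v0); apply.
have u_mid x : `|x| <= Y -> 0 < u x.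
  move=> xY; have [+ _] := close x xY; have := mP x xY.
  by rewrite ler_norml => h1 /andP[h2 _]; lra.
have nX1 : `|X1| <= Y by rewrite ger0_norm /Y; lra.
have nX2 : `|- X2| <= Y by rewrite normrN ger0_norm /Y; lra.
have p' x : X <= `|x| -> epot q la' x <= 0.
  by move=> /pX; rewrite /epot /la'; lra.
exists la'; first by rewrite /la'; lra.
exists u, v; split=> // x.
have [xX1|X1x] := ltP x X1; last first.
  have pr t : X1 <= t -> epot q la' t <= 0.
    by move=> X1t; apply: p'; apply: le_trans (le_trans XX1 X1t) (ler_norm t).
  have vX1 : 0 < v X1.
    by have [_] := close _ nX1; rewrite ler_norml => /andP[h _]; lra.
  by have [] := growth_right uv pr (u_mid _ nX1) vX1 X1x.
have [xX2|X2x] := leP x (- X2); last by apply: u_mid; rewrite /Y ler_norml; lra.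
have pl t : t <= - X2 -> epot q la' t <= 0.
  move=> tX2; apply: p'; rewrite -normrN; apply: le_trans (ler_norm _).
  by rewrite lerNr; apply: le_trans tX2 _; rewrite lerN2.
have vX2 : v (- X2) < 0.
  by have [_] := close _ nX2; rewrite ler_norml => /andP[_ h]; lra.
exact: growth_left uv pl (u_mid _ nX2) vX2 _ xX2.
Qed.

Lemma decaying_eigenvalue la y z X d : 0 < d -> 0 <= X ->
  (forall x, X <= `|x| -> epot q la x <= - d) -> solves (epot q la) y z ->
  (forall x, 0 < y x) -> (forall x, X <= x -> z x <= 0) ->
  (forall x, x <= - X -> 0 <= z x) -> Defs.eigenvalue q la.
Proof.
move=> d0 X0 pX yz y0 zr zl.
have yc : continuous y by apply: continuous_drv => t; exact: (yz t).1.
have zc : continuous z by apply: continuous_drv => t; exact: (yz t).2.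
have y2c : continuous (fun x => y x ^+ 2).
  by move=> x; rewrite /GRing.exp /=; apply: cvgM; exact: yc.
have z2c : continuous (fun x => z x ^+ 2).
  by move=> x; rewrite /GRing.exp /=; apply: cvgM; exact: zc.
have [_ Ed] := primP y2c; have [_ E1d] := primP z2c.
set E := prim _ in Ed; set E1 := prim _ in E1d.
have pr x : X <= x -> epot q la x <= - d by move=> Xx; apply: pX; apply: le_trans Xx (ler_norm _).
have pl x : x <= - X -> epot q la x <= - d.
  by move=> xX; apply: pX; have := ler_norm (- x); rewrite normrN; lra.
have [M MP] := decay_right yz d0 pr y0 zr Ed E1d.
have [N NP] := decay_left yz d0 pl y0 zl Ed E1d.
have bd (F f : R -> R) : (forall x, drv F x (f x)) -> (forall x, 0 <= f x) ->
    (forall x, X <= x -> F x <= M) -> (forall x, x <= - X -> - N <= F x) ->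
    forall x, `|F x| <= `|M| + `|N|.
  move=> Fd f0 FM FN x; rewrite ler_norml.
  have Fnd a b : a <= b -> F a <= F b by move=> ab; exact: drv_ge0_le ab Fd _.
  have M1 := ler_norm M; have N1 := ler_norm N.
  have M2 := normr_ge0 M; have N2 := normr_ge0 N.
  have h1 : F x <= M.
    apply: le_trans (FM (Num.max x X) _); last by rewrite le_max lexx orbT.
    by apply: Fnd; rewrite le_max lexx.
  have h2 : - N <= F x.
    apply: le_trans (FN (Num.min x (- X)) _) _; first by rewrite ge_min lexx orbT.
    by apply: Fnd; rewrite ge_min lexx.
  lra.
apply: positive_eigenfunction hq yz y0 _ _.
- apply: (integrable_bounded_primitive y2c _ Ed (M := `|M| + `|N|)) => [x|]; first exact: sqr_ge0.
  apply: (bd _ _ Ed) => [x|x /MP[]|x /NP[]] //; exact: sqr_ge0.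
- apply: (integrable_bounded_primitive z2c _ E1d (M := `|M| + `|N|)) => [x|]; first exact: sqr_ge0.
  apply: (bd _ _ E1d) => [x|x /MP[]|x /NP[]] //; exact: sqr_ge0.
Qed.

(** By compactness there is a largest energy [la <= 0] with a positive solution. If
    [la < 0], that solution cannot grow at any end, since otherwise it could be changed
    into one growing at both ends, and then the energy could be raised. So it
    decays at both ends and is an eigenfunction. *)
Lemma positive_zero_energy : no_negative_eigenvalue q ->
  exists y z, solves q y z /\ forall x, 0 < y x.
Proof.
move=> ne; have [M MP] := rapid_bdd (Cn_here ((schwartzP q).1 hq 0%N)).
have PC : compact (positive_rays M) by exact: positive_rays_compact.
have fc : {within positive_rays M, continuous (fst : R * R -> R)}.
  by apply: continuous_subspaceT => lb; exact: cvg_fst.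
have [[la be]] := compact_EVT_max (positive_low_energy MP) PC fc.
rewrite inE => -[/= /andP[laM la0] be1 ray0] lamax.
have y0 := cauchy_ray_gt0 ray0; have [cs _ _] := cauchy_ray_solves la be.
set y := cauchy_ray la be in y0 cs; set z := cauchy_ray' la be in cs.
have e0 : epot q 0 = q by apply/funext => x; rewrite /epot addr0.
have [la00|laN0] := eqVneq la 0; first by exists y, z; rewrite la00 e0 in cs.
have {la0 laN0}la0 : la < 0 by rewrite lt_neqAle laN0.
exfalso.
(* beyond [X] the potential is below a quarter of the energy gap *)
have [K KP] := Cn_here ((schwartzP q).1 hq 0%N) 1%N.
have K0 : 0 <= K by apply: le_trans (KP 0); rewrite mulr_ge0// exprn_ge0// ltW// jap_gt0.
pose d := - la / 4; have d0 : 0 < d by rewrite /d; lra.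
pose X := K / d; have X0 : 0 <= X by rewrite divr_ge0// ltW.
have qX x : X <= `|x| -> `|q x| <= d.
  move=> Xx; have := KP x; rewrite expr1 => h.
  rewrite -(ler_pM2r (jap_gt0 x)); apply: le_trans h _.
  rewrite ler_pdivrMr// mulrC in Xx; apply: le_trans Xx _.
  by rewrite ler_pM2l// norm_le_jap.
have pX x : X <= `|x| -> epot q la x <= - d.
  by move=> /qX; rewrite ler_norml /epot /d => /andP[_ h]; lra.
have pX0 x : X <= `|x| -> epot q la x <= 0 by move=> /pX; lra.
have pX2 x : X <= `|x| -> epot q (la / 2) x <= 0.
  by move=> /qX; rewrite ler_norml /epot /d => /andP[_ h]; lra.
have top u v X1 X2 : solves (epot q la) u v -> (forall x, 0 < u x) ->
    X <= X1 -> 0 < v X1 -> X <= X2 -> v (- X2) < 0 -> False.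
  move=> uv u0 XX1 vX1 XX2 vX2.
  have [la' /andP[ll l0] [u' [v' [uv' u0']]]] := positive_growing_open la0 X0 pX2 uv u0 XX1 vX1 XX2 vX2.
  have [be' [be1' ray']] := ray_of_positive uv' u0'.
  have : la' <= la; last by rewrite leNgt ll.
  apply: (lamax (la', be')); rewrite inE; split=> //=.
  by rewrite l0 andbT (le_trans laM)// ltW.
have pc := @epot_continuous _ _ qc la.
have [[X1 /andP[XX1 zX1]]|NR] := pselect (exists X1, (X <= X1) && (0 < z X1)).
  have [u [v [uv u0 vX1 [X2 XX2 vX2]]]] := make_grow_left pc cs X0 XX1 pX0 y0 zX1.
  exact: top uv u0 XX1 vX1 XX2 vX2.
have [[X2 /andP[XX2 zX2]]|NL] := pselect (exists X2, (X <= X2) && (z (- X2) < 0)).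
  have [u [v [uv u0 vX2 [X1 XX1 vX1]]]] := make_grow_right pc cs X0 XX2 pX0 y0 zX2.
  exact: top uv u0 XX1 vX1 XX2 vX2.
apply: (ne la la0); apply: (decaying_eigenvalue d0 X0 pX cs y0) => x xX.
  by rewrite leNgt; apply/negP => zx; apply: NR; exists x; rewrite xX.
rewrite leNgt; apply/negP => zx; apply: NL; exists (- x); rewrite opprK zx andbT; lra.
Qed.

(** The principal zero-energy solution at [+oo] has no zero as soon as some
    zero-energy solution is positive: their quotient is nonincreasing. *)
Lemma principal_solution_no_zero y z u v : right_basis q 0 y z u v ->
  (exists f g, solves q f g /\ forall x, 0 < f x) -> forall x, y x != 0.
Proof.
move=> [yz uv yA uA] [f [g [fg f0]]] x0; apply/eqP => yx0.
have [qc' [kap q_decay]] := schwartz_decay hq.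
rewrite -[q](pot0 q) in fg.
have W x : y x * v x - z x * u x = 1.
  have [h1 h2] := asym_right_cvg yA; have [h3 h4] := asym_right_cvg uA.
  have <- : 1 * 1 - 0 * 0 = 1 :> R by rewrite mulr0 subr0 mulr1.
  apply/esym; apply: (asym_det _ h1 h2 h3 h4) => t.
  by rewrite amp_wronskian; exact: wronskian_cst.
have [a [b ab]] := solves_basis yz uv fg W.
have fsub : f x - (a + b * x) @[x --> +oo] --> (0 : R).
  apply: cvg_ext (asym_right_sub (asym_right_lin a b yA uA)) => x.
  by rewrite (ab x).1 kcos_0 ksin_0; ring.
have b0 : 0 <= b.
  rewrite leNgt; apply/negP => b0.
  have /cvgrPdist_le/(_ 1 ltr01)[X [_ XP]] := fsub.
  pose x := Num.max (X + 1) ((`|a| + 1) / - b).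
  have Xx : X < x by rewrite lt_max ltrDl ltr01.
  have := XP x Xx; rewrite /= sub0r normrN ler_norml => /andP[_ h].
  have : (`|a| + 1) / - b <= x by rewrite le_max lexx orbT.
  rewrite ler_pdivrMr ?oppr_gt0// => h2.
  have := f0 x; have := ler_norm a; lra.
have qd x : drv (fun x => y x / f x) x (- b / f x ^+ 2).
  have [yd zd] := yz x; have [fd gd] := fg x; have fN0 : f x != 0 by rewrite gt_eqF.
  drv => //; rewrite -[b]mulr1 -(W x) (_ : b * _ = y x * g x - z x * f x).
    by field.
  by rewrite (ab x).1 (ab x).2; ring.
have yle x : x0 <= x -> y x <= 0.
  move=> x0x; have : y x / f x <= y x0 / f x0.
    apply: (drv_le0_ge x0x qd) => t _; rewrite mulNr oppr_le0 divr_ge0//.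
    by rewrite ltW// exprn_gt0.
  by rewrite yx0 mul0r pmulr_lle0// invr_gt0.
have y1 := asym_right_cvg1 yA.
move: y1 => /cvgrPdist_lt/(_ 1 ltr01)[X [_ XP]].
pose x := Num.max (X + 1) x0.
have Xx : X < x by rewrite lt_max ltrDl ltr01.
have x0x : x0 <= x by rewrite le_max lexx orbT.
have := XP x Xx; rewrite ltr_norml => /andP[_ h].
by have := yle x x0x; lra.
Qed.

End NegativeEigenvalue.

(** * Ground states and the scattering data *)

Section Assembly.
Variable R : realType.
Implicit Types (q y z u v : R -> R) (k a b x : R).

Variable q : R -> R.
Hypothesis hq : schwartz q.

Let qc : continuous q := (schwartz_decay hq).1.

Lemma asym_right_unique k y z u v a b : solves (pot q k) y z -> solves (pot q k) u v ->
  asym_right k y z a b -> asym_right k u v a b -> y = u.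
Proof.
move=> yz uv ya ua; have [_ [kap q_decay]] := schwartz_decay hq.
apply/funext => x; apply/eqP; rewrite -subr_eq0; apply/eqP.
have := vanish_right qc q_decay (solves_lin 1 (-1) yz uv) _ x.
rewrite !mul1r mulN1r; apply.
by apply: cvg_ext (cvg0B _ (asym_right_sub ya) (asym_right_sub ua)) => t; ring.
Qed.

Lemma asym_left_unique k y z u v a b : solves (pot q k) y z -> solves (pot q k) u v ->
  asym_left k y z a b -> asym_left k u v a b -> y = u.
Proof.
move=> yz uv ya ua; have [_ [kap q_decay]] := schwartz_decay hq.
apply/funext => x; apply/eqP; rewrite -subr_eq0; apply/eqP.
have := vanish_left qc q_decay (solves_lin 1 (-1) yz uv) _ x.
rewrite !mul1r mulN1r; apply.
by apply: cvg_ext (cvg0B _ (asym_left_sub ya) (asym_left_sub ua)) => t; ring.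
Qed.

Lemma cvg1_pos (F : set_system R) y : ProperFilter F -> y x @[x --> F] --> (1 : R) ->
  exists x, 0 < y x.
Proof.
move=> FF /cvgrPdist_lt/(_ 1 ltr01) H; have [x] := filter_ex H.
by rewrite ltr_norml => /andP[_ h]; exists x; lra.
Qed.

(** The principal solutions at both ends have constant sign and tend to 1 at their own
    end, which excludes the factor [-1]. *)
Lemma exceptional_ground y z u v Y Z U V a : no_negative_eigenvalue q ->
  right_basis q 0 y z u v -> left_basis q 0 Y Z U V ->
  (forall x, Y x = a * y x) -> a = 1 \/ a = -1 -> a = 1 /\ ground_state q y z.
Proof.
move=> ne rb lb Ya a1; have yN0 := principal_solution_no_zero hq rb (positive_zero_energy hq ne).
have [yz _ yA _] := rb; have [YZ _ YA _] := lb.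
have yp := asym_right_cvg1 yA; have Ym := asym_left_cvg1 YA.
have [x1 y1] := cvg1_pos _ yp; have [x2 Y2] := cvg1_pos _ Ym.
have yc : continuous y by apply: continuous_drv => t; exact: (yz t).1.
have y0 x : 0 < y x.
  rewrite ltNge; apply/negP => yx; have [c yc0] := pos_ivt yc y1 yx.
  by have := yN0 c; rewrite yc0 eqxx.
have {a1}a1 : a = 1.
  case: a1 => // aN; move: Y2; rewrite Ya aN.
  by have := y0 x2; lra.
split=> //; split=> //; apply: cvg_ext Ym => x; by rewrite Ya a1 mul1r.
Qed.

Lemma ground_exceptional y z u v Y Z U V g dg a c : right_basis q 0 y z u v ->
  left_basis q 0 Y Z U V -> ground_state q g dg ->
  (forall x, Y x = a * y x + c * u x) -> [/\ y = g, a = 1 & c = 0].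
Proof.
move=> rb lb gs Yac; have [yz _ yA _] := rb; have [YZ _ YA _] := lb.
have [gr gl] := ground_state_asym hq gs; have [gsol _ _ _] := gs.
have yg : y = g by exact: asym_right_unique yz gsol yA gr.
have Yg : Y = g by exact: asym_left_unique YZ gsol YA gl.
have [a1 c0] : a - 1 = 0 /\ c = 0.
  apply: (basis_indep rb) => x; have := Yac x; rewrite Yg -yg.
  by move=> h; rewrite mulrBl mul1r {2}h; ring.
by split=> //; lra.
Qed.

Lemma jost_right0 y z u v : right_basis q 0 y z u v ->
  jost_right q 0 = fun x => (y x)%:C.
Proof.
move=> rb; have [_ [kap q_decay]] := schwartz_decay hq.
have := jost_rightE qc q_decay rb; rewrite (_ : (0 : R)%:C = 0 :> R[i])// => ->.
by apply/funext => x; rewrite mul0r.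
Qed.

Lemma diff_schwartz_unique (phi psi : R -> R) : diff_schwartz phi -> diff_schwartz psi ->
  derive1 phi = derive1 psi -> phi = psi.
Proof.
move=> [[phi' [_ _ ps _]] _ _ pl] [[psi' [_ _ qs _]] _ _ ql] E.
have pd x : drv phi x (derive1 phi x) by apply: derivable_drv; exact: (ps 0%N x).
have qd x : drv psi x (derive1 psi x) by apply: derivable_drv; exact: (qs 0%N x).
apply/funext => x.
have cst t : phi t - psi t = phi x - psi x.
  apply: (@drv_eq_cst _ (fun t => phi t - psi t)) (fun t => drvB (pd t) (qd t)) _ => s.
  by rewrite E subrr.
apply/eqP; rewrite -subr_eq0; apply/eqP.
have h : phi t - t - (psi t - t) @[t --> -oo] --> (0 : R) by exact: cvg0B.
have h' : phi t - psi t @[t --> -oo] --> (0 : R) by apply: cvg_ext h => t; ring.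
apply: (cvgr_unique _ _ h'); under eq_fun do rewrite cst.
exact: cvg_cst.
Qed.

End Assembly.

Theorem theorem2 (R : realType) (q : R -> R) (hq : schwartz q) :
  [<-> exists! phi : R -> R, diff_schwartz phi /\ q = bers phi;
       exists! w : R -> R,
         schwartz0 w /\ q = (fun x : R => derive1 w x - w x ^+ 2);
       no_negative_eigenvalue q /\ value_at_zero (reflection q) 0;
       no_negative_eigenvalue q /\ value_at_zero (transmission q) 1]
  /\
  ((exists! phi : R -> R, diff_schwartz phi /\ q = bers phi) ->
   [/\ forall x : R, 0 < jost_right q 0 x,
       (jost_right q 0 x : (R[i])^o) @[x --> +oo] --> (1 : (R[i])^o),
       (jost_right q 0 x : (R[i])^o) @[x --> -oo] --> (1 : (R[i])^o) &
       forall phi : R -> R, diff_schwartz phi -> q = bers phi ->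
         forall x : R, (derive1 phi x)%:C = jost_right q 0 x ^- 2]).
Proof.
have [qc [kap q_decay]] := schwartz_decay hq.
have [al [be [ga [de [y [z [u [v [Y [Z [U [V [[fal fbe fga fde] tr]]]]]]]]]]]]] :=
  transfer qc q_decay.
have det1 k : al k * de k - be k * ga k = 1 by case: (tr k).
have scE k : k != 0 -> scattering q k =
    (((al k + de k) / 2) +i* ((ga k / k - k * be k) / 2),
     ((al k - de k) / 2) +i* (- (k * be k + ga k / k) / 2)).
  by move=> k0; have [rb lb _ YU] := tr k; exact: (scatteringE qc q_decay k0 rb lb YU).
have [rb lb _ YU] := tr 0.
split; first tfae.
- move=> [phi [[Dphi qE] _]].
  have [g [dg [gs _]]] := diff_schwartz_ground Dphi qE.
  have [w0 wE] := ground_riccati hq gs.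
  exists (fun x => - (dg x / g x)); split=> // w [w0' wE'].
  have [g' [dg' [gs' w'E]]] := riccati_ground w0' wE'.
  have [gg dgg] := ground_state_unique hq gs gs'.
  apply/funext => x; have [_ g'0 _ _] := gs'.
  by rewrite gg dgg w'E mulNr mulNr opprK mulfK// gt_eqF.
- move=> [w [[w0 wE] _]].
  have [g [dg [gs _]]] := riccati_ground w0 wE.
  split; first exact: ground_state_no_negative_eigenvalue hq gs.
  have [_ al1 ga0] := ground_exceptional hq rb lb gs (fun x => (YU x).1).
  exact: (scattering_exceptional fal fbe fga fde det1 scE ga0 al1).2.
- move=> [ne R0]; split; first exact: ne.
  have [ga0 al1] := reflection_zero fal fbe fga fde det1 scE R0.
  have Ya x : Y 0 x = al 0 * y 0 x by rewrite (YU x).1 ga0 mul0r addr0.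
  have [{}al1 _] := exceptional_ground hq ne rb lb Ya al1.
  exact: (scattering_exceptional fal fbe fga fde det1 scE ga0 al1).1.
- move=> [ne T1].
  have [ga0 al1] := transmission_one fal fbe fga fde det1 scE T1.
  have Ya x : Y 0 x = al 0 * y 0 x by rewrite (YU x).1 ga0 mul0r addr0.
  have [_ gs] := exceptional_ground hq ne rb lb Ya (or_introl al1).
  have [phi [Dphi qE]] := ground_diff hq gs.
  exists phi; split=> // psi [Dpsi qE'].
  have [g [dg [gs1 phiE]]] := diff_schwartz_ground Dphi qE.
  have [h [dh [gs2 psiE]]] := diff_schwartz_ground Dpsi qE'.
  have [gh _] := ground_state_unique hq gs1 gs2.
  by apply: diff_schwartz_unique => //; apply/funext => x; rewrite phiE psiE gh.
move=> [phi0 [[Dphi0 qE0] _]].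
have [g [dg [gs _]]] := diff_schwartz_ground Dphi0 qE0.
have [yg _ _] := ground_exceptional hq rb lb gs (fun x => (YU x).1).
have [_ g0 gp gm] := gs; rewrite (jost_right0 hq rb) yg.
split.
- by move=> x; rewrite ltcR.
- by apply/cvgCP; split=> //=; exact: cvg_cst.
- by apply/cvgCP; split=> //=; exact: cvg_cst.
move=> phi Dphi qE x; have [h [dh [gs' phiE]]] := diff_schwartz_ground Dphi qE.
have [-> _] := ground_state_unique hq gs gs'.
by rewrite phiE fmorphV rmorphXn.
Qed.
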